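(* Let $p\ge 1$, $M\ge\lfloor p\rfloor$, $\beta=1/p$, $\Delta>0$, and let $\mathbf X$ be a random geometric $p$-rough path over a continuous process $X:[0,\infty)\to\mathbb R^d$ satisfying Moment control, Stationarity and the Discretization-rate property with constant $C_{\mathrm{approx}}(\Delta,M)$ and exponent $\gamma>0$ (all defined in the context). Suppose in addition that $X$ is $\alpha$-mixing in the sense (E) or (P), or that the block signatures have covariance decay in the sense (E$'$) or (P$'$). Then for all $K\ge1$ and $n\ge2$ the block-averaging estimator $\widehat\Sigma_K=K^{-1}\sum_{k=1}^K Y_k$ satisfies $$\mathrm{MSE}:=\mathbb E\bigl[\|\widehat\Sigma_K-\mathbb E[Z_1]\|_{\mathrm{HS}}^2\bigr]\le \frac{C_{\mathrm{bias}}(\Delta,M)}{(n-1)^\gamma}+V_K(\Delta),\qquad C_{\mathrm{bias}}(\Delta,M)=2C_{\mathrm{approx}}(\Delta,M)\Delta^\gamma,$$ where the deterministic quantity $V_K(\Delta)$ dominates $2\,\mathbb E\bigl\|K^{-1}\sum_{k=1}^K(Z_k-\mathbb E[Z_k])\bigr\|_{\mathrm{HS}}^2$ and satisfies: (i) (Summable regime.) Under (E), or (E$'$), or (P) with $\nu>1$, or (P$'$) with $\nu>1$: $V_K(\Delta)\le V(\Delta)/K$ with $V(\Delta):=2V_1(\Delta)+2\sum_{m=2}^M V_m(\Delta)<\infty$, where $V_1(\Delta)\le 4\,\mathrm{tr}(\mathrm{Cov}(X_0))$ and, for $2\le m\le M$, $$V_m(\Delta)\le\frac{d^m\widetilde C_m}{(\Lambda_p\,(m/p)!)^2}\,\Delta^{2m\beta}\,\Phi_m(\Delta),$$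 with $\widetilde C_m<\infty$ a level-dependent constant and $\Phi_m(\Delta)<\infty$ the dependence factor described in the context. (ii) (Non-summable $\alpha$-mixing.) Under (P) with $0<\nu\le1$: for every $\varepsilon\in(0,\nu)$, $V_K(\Delta)\le V_\varepsilon(\Delta)K^{-\nu+\varepsilon}$ with a finite $\varepsilon$-dependent constant $V_\varepsilon(\Delta)$. (iii) (Non-summable direct covariance decay.) Under (P$'$) with $\nu\le 1$: if $0<\nu<1$, then $V_K(\Delta)\le V_{\mathrm{poly}}(\Delta)K^{-\nu}$ with $V_{\mathrm{poly}}(\Delta)<\infty$; if $\nu=1$, then $V_K(\Delta)\le V_{\log}(\Delta)K^{-1}\log K$ for $K\ge2$ with $V_{\log}(\Delta)<\infty$. Moreover, the level-1 contribution to the variance term is $O(K^{-2})$.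
   Context: Algebra: $T^{(M)}(\mathbb R^d)=\bigoplus_{m=0}^M(\mathbb R^d)^{\otimes m}$ with $\|a\|_{\mathrm{HS}}^2=\sum_{m=0}^M\|a^{(m)}\|^2$, $a^{(m)}$ the degree-$m$ component. $(a)!:=\Gamma(a+1)$ for real $a\ge0$. Rough paths: $X:[0,\infty)\to\mathbb R^d$ is a continuous process with a lift to a random geometric $p$-rough path $\mathbf X$ in the step-$\lfloor p\rfloor$ free nilpotent group $G^{\lfloor p\rfloor}(\mathbb R^d)$; $\mathbf X_{s,t}$ is assumed $\sigma(X_u:u\in[s,t])$-measurable. By Lyons extension $\mathbf X$ determines its signature over $[s,t]$ at all levels; $S^{\le M}(\mathbf X)_{s,t}\in T^{(M)}(\mathbb R^d)$ is the signature truncated at degree $M$ and $S^{(m)}(\mathbf X)_{s,t}$ its degree-$m$ component. $\|\mathbf X\|_{p\text{-var};[s,t]}$ is the homogeneous $p$-variation norm $\sup(\sum_i\|\mathbf X_{t_i,t_{i+1}}\|_{CC}^p)^{1/p}$ over partitions of $[s,t]$ ($CC$ = Carnot–Carathéodory norm). $\Lambda_p>0$ is a Lyons factorial constant, depending only on $p$: if $\|\mathbf X^i_{s,t}\|\le\omega(s,t)^{i/p}/(\Lambda_p(i/p)!)$ for $i\le\lfloor p\rfloor$ and a control $\omega$, then the same bound holds at every extended level $i$. Blocks: $I_k=[(k-1)\Delta,k\Delta]$, each observed at $n\ge2$ equally spaced times (endpoints included) with mesh $\delta=\Delta/(n-1)$; $X^{(n)}_k$ is the piecewise-linear interpolation on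 $I_k$ and $\mathbf X^{(n)}_k$ its canonical (bounded-variation) lift. $Z_k=S^{\le M}(\mathbf X)_{I_k}$, $Y_k=S^{\le M}(\mathbf X_k^{(n)})_{I_k}$. $W_k^{(m)}=S^{(m)}(\mathbf X)_{I_k}-\mathbb E[S^{(m)}(\mathbf X)_{I_k}]$ and $c_{h,m}=\mathbb E[\langle W_1^{(m)},W_{1+h}^{(m)}\rangle_{\mathrm{HS}}]$ for $h\ge0$. Moment control: for all $r\ge1$, $T<\infty$ there is $C_r(T)<\infty$ with $\mathbb E[\|\mathbf X\|_{p\text{-var};[s,t]}^r]\le C_r(T)(t-s)^{r\beta}$ for $0\le s\le t\le T$; and $\mathbb E\|X_0\|^2<\infty$. $\alpha$-mixing: with $\mathcal F_{\le s}=\sigma(X_u:u\le s)$, $\mathcal F_{\ge t}=\sigma(X_u:u\ge t)$, $\alpha_X(t)=\sup_{s\ge0}\sup\{|\mathbb P(A\cap B)-\mathbb P(A)\mathbb P(B)|:A\in\mathcal F_{\le s},B\in\mathcal F_{\ge s+t}\}$. (E): $\alpha_X(t)\le C_Xe^{-\lambda_Xt}$ for some $C_X,\lambda_X>0$. (P): $\alpha_X(t)\le C_X(1+t)^{-\nu}$ for some $C_X,\nu>0$. Block-signature covariance decay: there are constants $\widetilde C_m>0$ (which may depend on $m$ and $\Delta$) with, for all $1\le m\le M$ and $h\ge1$, $|c_{h,m}|\le \frac{d^m\widetilde C_m}{(\Lambda_p(m/p)!)^2}\Delta^{2m\beta}\psi(h)$, where (E$'$): $\psi(h)=e^{-\lambda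 h\Delta}$ with some $\lambda>0$; (P$'$): $\psi(h)=(1+h)^{-\nu}$ with some $\nu>0$ ($\lambda$, $\nu$ uniform in $m$). Stationarity: $X$ is strictly stationary and $\vartheta_\tau\mathbf X\stackrel d=\mathbf X$ for all $\tau\ge0$, where $(\vartheta_\tau\mathbf X)_{s,t}=\mathbf X_{\tau+s,\tau+t}$. Discretization rate: there are $C_{\mathrm{approx}}(\Delta,M)>0$, $\gamma>0$ such that for every $n\ge2$, with $X^{(n)}$ the piecewise-linear interpolation of $n$ equally spaced observations on $[0,\Delta]$ and $\mathbf X^{(n)}$ its lift, $\mathbb E[\|S^{\le M}(\mathbf X)_{0,\Delta}-S^{\le M}(\mathbf X^{(n)})_{0,\Delta}\|_{\mathrm{HS}}^2]\le C_{\mathrm{approx}}(\Delta,M)\delta^\gamma$. Constants: $V_1(\Delta)=\sup_{T>0}\mathrm{Var}(X_T-X_0)$ where $\mathrm{Var}(U)=\mathbb E\|U-\mathbb EU\|^2$; for $m\ge2$, $V_m(\Delta)=c_{0,m}+2\sum_{h\ge1}|c_{h,m}|$ and $V_m^{(K)}(\Delta)=c_{0,m}+2\sum_{h=1}^{K-1}|c_{h,m}|$. $V_\varepsilon(\Delta)=2V_1(\Delta)+2\sup_{K\ge1}K^{\nu-1-\varepsilon}\sum_{m=2}^MV_m^{(K)}(\Delta)$; $V_{\mathrm{poly}}(\Delta)=2V_1(\Delta)+2\sup_{K\ge1}K^{\nu-1}\sum_{m=2}^MV_m^{(K)}(\Delta)$; $V_{\log}(\Delta)=2V_1(\Delta)+2\sup_{K\ge2}(\log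 K)^{-1}\sum_{m=2}^MV_m^{(K)}(\Delta)$. Dependence factor: under (E), $\Phi_m(\Delta)=1+2d^m/(1-e^{-\lambda_X\Delta/2})$; under (E$'$) or (P$'$) with $\nu>1$, $\Phi_m(\Delta)=1+2\sum_{h\ge1}\psi(h)$ (with $\widetilde C_m$ enlarged if necessary so that the displayed envelope without $\psi$ also bounds $c_{0,m}$); under (P) with $\nu>1$, $\Phi_m(\Delta)$ is some finite factor. The level-1 contribution to the variance term is $\mathbb E\|K^{-1}\sum_{k=1}^K W_k^{(1)}\|^2$. *)

(* Defs.v *)
From mathcomp Require Import all_boot all_order all_algebra.
From mathcomp Require Import all_classical all_reals all_analysis.

Set Implicit Arguments.
Unset Strict Implicit.
Unset Printing Implicit Defensive.

Import Order.TTheory GRing.Theory Num.Theory.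
Import numFieldNormedType.Exports.

Local Open Scope classical_set_scope.
Local Open Scope ring_scope.

(** ** Tensor series over R^d *)

(** A tensor series is given by its coefficients in the basis
    e_{i_1} (x) ... (x) e_{i_m}, indexed by the words i_1 ... i_m. Elements of
    T^(M)(R^d) are tensor series of which only the words of length at most M
    are looked at. *)
Definition tensor (R : realType) (d : nat) := seq 'I_d -> R.

Section tensor_algebra.
Context {R : realType} {d : nat}.
Implicit Types a b : tensor R d.

Definition level_dot (m : nat) a b : R :=
  \sum_(w : m.-tuple 'I_d) a w * b w.

Definition level_norm (m : nat) a : R := Num.sqrt (level_dot m a a).

Definition hs_norm (M : nat) a : R :=
  Num.sqrt (\sum_(m < M.+1) level_norm m a ^+ 2).

Definition tensor_sub a b : tensor R d := fun w => a w - b w.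

Definition tensor_one : tensor R d := fun w => (size w == 0)%:R.

Definition tensor_mul a b : tensor R d :=
  fun w => \sum_(i < (size w).+1) a (take i w) * b (drop i w).

Definition tensor_exp (N : nat) a : tensor R d :=
  fun w => \sum_(k < N.+1) (k`!%:R)^-1 * iter k (tensor_mul a) tensor_one w.

(** The Lie algebra generated by R^d in the tensor series. *)
Inductive lie_element : tensor R d -> Prop :=
| lie_zero : lie_element (fun _ => 0)
| lie_letter (i : 'I_d) : lie_element (fun w => (w == [:: i])%:R)
| lie_linear (c : R) a b : lie_element a -> lie_element b ->
    lie_element (fun w => c * a w + b w)
| lie_bracket a b : lie_element a -> lie_element b ->
    lie_element (tensor_sub (tensor_mul a b) (tensor_mul b a)).

(** G^N(R^d) = exp(g^N(R^d)), where g^N is the step-N truncation of the free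
    Lie algebra. *)
Definition free_nilpotent_group (N : nat) : set (tensor R d) :=
  [set g | exists2 l, lie_element l &
     forall w, (size w <= N)%N -> g w = tensor_exp N l w].

End tensor_algebra.

(** ** Paths of bounded variation and their signatures *)

Section bounded_variation_paths.
Context {R : realType} {d : nat}.

(** The supremum, over the partitions a = t_0 < t_1 < ... of [a, b] with points
    a :: s, of the sum of the F t_j t_{j+1}. *)
Definition partition_sup (F : R -> R -> \bar R) (a b : R) : \bar R :=
  ereal_sup [set (\sum_(0 <= j < size s)
                    F (nth b (a :: s) j) (nth b (a :: s) j.+1))%E
            | s in itv_partition a b].

Definition euclid_norm (v : 'rV[R]_d) : R :=
  Num.sqrt (\sum_(i < d) (v ord0 i) ^+ 2).

Definition path_length (x : R -> 'rV[R]_d) (a b : R) : \bar R :=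
  partition_sup (fun u v => (euclid_norm (x v - x u))%:E) a b.

Definition bv_path (a b : R) : set (R -> 'rV[R]_d) :=
  [set x | {within [set u | a <= u <= b], continuous x} /\
           (path_length x a b < +oo)%E].

(** I is the Riemann-Stieltjes integral of f against g over [a, b]. *)
Definition is_rs_integral (f g : R -> R) (a b I : R) : Prop :=
  forall eps, 0 < eps -> exists2 eta, 0 < eta &
  forall (s : seq R) (tag : nat -> R), itv_partition a b s ->
    (forall j, (j < size s)%N ->
       let t := nth b (a :: s) in
       t j.+1 - t j < eta /\ t j <= tag j <= t j.+1) ->
    `| \sum_(0 <= j < size s) f (tag j) *
         (g (nth b (a :: s) j.+1) - g (nth b (a :: s) j)) - I | < eps.

Definition rs_integral (f g : R -> R) (a b : R) : R :=
  xget 0 [set I | is_rs_integral f g a b I].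

(** Iterated integral along the letters of a word read from the last one. *)
Fixpoint bv_signature_rev (x : R -> 'rV[R]_d) (a : R) (w : seq 'I_d)
    (b : R) {struct w} : R :=
  match w with
  | [::] => 1
  | i :: w' =>
      rs_integral (bv_signature_rev x a w') (fun u => x u ord0 i) a b
  end.

(** The canonical lift: the coefficient of i_1 ... i_m is the integral of
    dx^{i_1}_{u_1} ... dx^{i_m}_{u_m} over a < u_1 < ... < u_m < b. *)
Definition bv_signature (x : R -> 'rV[R]_d) (a b : R) : tensor R d :=
  fun w => bv_signature_rev x a (rev w) b.

(** Carnot-Caratheodory norm on the step-N group: the infimum of the lengths
    of the paths with signature g (+oo if there is none). *)
Definition cc_norm (N : nat) (g : tensor R d) : \bar R :=
  ereal_inf [set path_length x 0 1 | x in
    [set x | bv_path 0 1 x /\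
       forall w, (size w <= N)%N -> bv_signature x 0 1 w = g w]].

End bounded_variation_paths.

(** ** Rough paths on [0, +oo[ *)

Section rough_paths.
Context {R : realType} {d : nat}.
Implicit Types A SX : R -> R -> tensor R d.

Definition multiplicative (N : nat) A : Prop :=
  (forall s t, 0 <= s -> s <= t -> A s t [::] = 1) /\
  forall s u t w, 0 <= s -> s <= u -> u <= t -> (size w <= N)%N ->
    A s t w = tensor_mul (A s u) (A u t) w.

Definition simplex : set (R * R) := [set z | 0 <= z.1 /\ z.1 <= z.2].

(** Multiplicative functionals of degree N which are continuous and of finite
    p-variation on bounded intervals. *)
Definition finite_pvar_functional (p : R) (N : nat) A : Prop :=
  [/\ multiplicative N A,
      forall w, (size w <= N)%N ->
        {within simplex, continuous (fun z : R * R => A z.1 z.2 w)} &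
      forall (T : R) (i : nat), 0 < T -> (0 < i <= N)%N ->
        (partition_sup (fun u v => (level_norm i (A u v) `^ (p / i%:R))%:E)
           0%R T < +oo)%E].

(** [Num.truncn p] is the integer part of p. *)
Definition rough_path (p : R) A : Prop :=
  finite_pvar_functional p (Num.truncn p) A.

(** Homogeneous p-variation norm over [s, t]. *)
Definition pvar_norm (p : R) A (s t : R) : \bar R :=
  (partition_sup (fun u v => cc_norm (Num.truncn p) (A u v) `^ p) s t
     `^ p^-1)%E.

(** p-variation distance between levels i of A and B over [0, T]. *)
Definition level_pvar_dist (p : R) (i : nat) A B (T : R) : \bar R :=
  (partition_sup (fun u v =>
       (level_norm i (tensor_sub (A u v) (B u v)) `^ (p / i%:R))%:E) 0%R T
     `^ (i%:R / p))%E.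

(** Geometric rough paths take their values in the free nilpotent group and
    are the limits, in p-variation on bounded intervals, of canonical lifts of
    paths of bounded variation. *)
Definition geometric_rough_path (p : R) A : Prop :=
  [/\ rough_path p A,
      forall s t, 0 <= s -> s <= t ->
        free_nilpotent_group (Num.truncn p) (A s t),
      forall T, 0 < T -> (pvar_norm p A 0 T < +oo)%E &
      forall T eps, 0 < T -> 0 < eps -> exists2 x : R -> 'rV[R]_d,
        bv_path 0 T x &
        forall i, (0 < i <= Num.truncn p)%N ->
          (level_pvar_dist p i A (bv_signature x) T < eps%:E)%E].

(** SX is the Lyons extension (the full signature) of A: the multiplicative
    functional of finite p-variation in every degree that agrees with A up to
    degree [p]; it exists and is unique. *)
Definition lyons_extension (p : R) A SX : Prop :=
  (forall N, finite_pvar_functional p N SX) /\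
  forall s t w, 0 <= s -> s <= t -> (size w <= Num.truncn p)%N ->
    SX s t w = A s t w.

Definition control (omega : R -> R -> R) : Prop :=
  [/\ forall s t, 0 <= s -> s <= t -> 0 <= omega s t,
      forall s, 0 <= s -> omega s s = 0,
      {within simplex, continuous (fun z : R * R => omega z.1 z.2)} &
      forall s u t, 0 <= s -> s <= u -> u <= t ->
        omega s u + omega u t <= omega s t].

End rough_paths.

Section factorials.
Context {R : realType}.

Definition Gamma (a : R) : R :=
  (\int[lebesgue_measure]_(t in `]0, +oo[) (t `^ (a - 1) * expR (- t)))%R.

Definition rfact (a : R) : R := Gamma (a + 1).

(** The implication is required in all dimensions d, so that Lambda depends on
    p only. Degree 0, where the tensor is 1, is excluded from the bounds. *)
Definition lyons_constant (p Lambda : R) : Prop :=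
  0 < Lambda /\
  forall (d : nat) (A SX : R -> R -> tensor R d) (omega : R -> R -> R),
    rough_path p A -> lyons_extension p A SX -> control omega ->
    let bounded (i : nat) := forall s t, 0 <= s -> s <= t ->
      level_norm i (SX s t) <=
        omega s t `^ (i%:R / p) / (Lambda * rfact (i%:R / p)) in
    (forall i, (0 < i <= Num.truncn p)%N -> bounded i) ->
    forall i, (0 < i)%N -> bounded i.

End factorials.

(** ** Random rough paths *)

Section processes.
Context {R : realType} {disp : measure_display} {Omega : measurableType disp}
        (P : probability Omega R) {d : nat}.
Implicit Types (X : Omega -> R -> 'rV[R]_d) (XX : Omega -> R -> R -> tensor R d).

Definition continuous_process X : Prop :=
  (forall u i, 0 <= u -> measurable_fun setT (fun o => X o u ord0 i)) /\
  forall o, {within [set u | 0 <= u], continuous (X o)}.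

(** sigma (X_u : u in D). *)
Definition sigma_of X (D : set R) : set (set Omega) :=
  <<s [set E | exists (u : R) (i : 'I_d) (B : set R),
         [/\ D u, measurable B & E = (fun o => X o u ord0 i) @^-1` B] ]>>.

(** A geometric rough path over X, the coordinates of which over [s, t] are
    sigma (X_u : u in [s, t])-measurable. *)
Definition random_geometric_rough_path (p : R) X XX : Prop :=
  [/\ forall o, geometric_rough_path p (XX o),
      forall o s t i, 0 <= s -> s <= t ->
        XX o s t [:: i] = X o t ord0 i - X o s ord0 i &
      forall s t w (B : set R), 0 <= s -> s <= t ->
        (size w <= Num.truncn p)%N -> measurable B ->
        sigma_of X [set u | s <= u <= t] ((fun o => XX o s t w) @^-1` B)].

Definition moment_control (p beta : R) X XX : Prop :=
  (forall r T : R, 1 <= r -> 0 < T -> exists C : R,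
     forall s t, 0 <= s -> s <= t -> t <= T ->
       (\int[P]_o (pvar_norm p (XX o) s t `^ r) <=
          (C * (t - s) `^ (r * beta))%:E)%E) /\
  ('E_P[fun o => (euclid_norm (X o 0%R) ^+ 2)%R] < +oo)%E.

(** Equality of the finite-dimensional distributions of two families of random
    variables indexed by J. *)
Definition same_law (I : Type) (J : set I) (U V : I -> Omega -> R) : Prop :=
  forall (n : nat) (j : 'I_n -> I) (B : 'I_n -> set R),
    (forall k, J (j k) /\ measurable (B k)) ->
    P [set o | forall k, B k (U (j k) o)] =
    P [set o | forall k, B k (V (j k) o)].

Definition stationarity (p : R) X XX : Prop :=
  forall tau : R, 0 <= tau ->
    same_law [set q : R * 'I_d | 0 <= q.1]
      (fun q o => X o (tau + q.1) ord0 q.2)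
      (fun q o => X o q.1 ord0 q.2) /\
    same_law [set q : (R * R) * seq 'I_d | simplex q.1 /\
                                   (size q.2 <= Num.truncn p)%N]
      (fun q o => XX o (tau + q.1.1) (tau + q.1.2) q.2)
      (fun q o => XX o q.1.1 q.1.2 q.2).

Definition alpha_mixing_coef X (t : R) : \bar R :=
  ereal_sup [set e | exists (s : R) (A B : set Omega),
    [/\ 0 <= s, sigma_of X [set u | 0 <= u <= s] A,
        sigma_of X [set u | s + t <= u] B &
        e = `| P (A `&` B) - P A * P B |%E]].

Definition mixing_exp X (CX lambdaX : R) : Prop :=
  [/\ 0 < CX, 0 < lambdaX &
      forall t, 0 <= t ->
        (alpha_mixing_coef X t <= (CX * expR (- (lambdaX * t)))%:E)%E].

Definition mixing_poly X (CX nu : R) : Prop :=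
  [/\ 0 < CX, 0 < nu &
      forall t, 0 <= t ->
        (alpha_mixing_coef X t <= (CX * (1 + t) `^ (- nu))%:E)%E].

(** Piecewise-linear interpolation of x from n points with mesh delta,
    starting from time a. *)
Definition interpolation (x : R -> 'rV[R]_d) (a delta : R) (n : nat) (u : R)
    : 'rV[R]_d :=
  let j := minn (Num.truncn ((u - a) / delta)) (n - 2) in
  let tj := a + j%:R * delta in
  x tj + ((u - tj) / delta) *: (x (tj + delta) - x tj).

End processes.

(** ** Blocks *)

Section blocks.
Context {R : realType} {disp : measure_display} {Omega : measurableType disp}
        (P : probability Omega R) {d : nat}.
Variable Delta : R.
Implicit Types (X : Omega -> R -> 'rV[R]_d) (SX : Omega -> R -> R -> tensor R d).

Definition mean_tensor (A : Omega -> tensor R d) : tensor R d :=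
  fun w => fine 'E_P[fun o => A o w].

Definition centered (A : Omega -> tensor R d) (o : Omega) : tensor R d :=
  tensor_sub (A o) (mean_tensor A).

(** Blocks are numbered from k = 1. *)
Definition block_start (k : nat) : R := k.-1%:R * Delta.
Definition block_end (k : nat) : R := k%:R * Delta.

Definition Zblock SX (k : nat) (o : Omega) : tensor R d :=
  SX o (block_start k) (block_end k).

Definition Yblock X (n k : nat) (o : Omega) : tensor R d :=
  bv_signature
    (interpolation (X o) (block_start k) (Delta / (n.-1)%:R) n)
    (block_start k) (block_end k).

Definition block_average (A : nat -> Omega -> tensor R d) (K : nat)
    (o : Omega) : tensor R d :=
  fun w => K%:R^-1 * \sum_(1 <= k < K.+1) A k o w.

Definition mse (M : nat) X SX (K n : nat) : \bar R :=
  'E_P[fun o => hs_norm M (tensor_sub (block_average (Yblock X n) K o)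
                                      (mean_tensor (Zblock SX 1))) ^+ 2].

Definition variance_term (M : nat) SX (K : nat) : \bar R :=
  'E_P[fun o =>
    hs_norm M (block_average (fun k => centered (Zblock SX k)) K o) ^+ 2].

Definition level1_variance SX (K : nat) : \bar R :=
  'E_P[fun o =>
    level_norm 1 (block_average (fun k => centered (Zblock SX k)) K o) ^+ 2].

Definition discretization_rate (M : nat) X SX (Capprox gamma : R) : Prop :=
  [/\ 0 < Capprox, 0 < gamma & forall n : nat, (2 <= n)%N ->
    let delta := Delta / (n.-1)%:R in
    ('E_P[fun o => (hs_norm M (tensor_sub (SX o 0 Delta)
        (bv_signature (interpolation (X o) 0 delta n) 0 Delta)) ^+ 2)%R] <=
     (Capprox * delta `^ gamma)%:E)%E].

(** c_{h,m}. *)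
Definition block_cov SX (h m : nat) : R :=
  fine 'E_P[fun o => level_dot m (centered (Zblock SX 1) o)
                                 (centered (Zblock SX h.+1) o)].

(** The envelope d^m C / (Lambda (m/p)!)^2 Delta^(2 m beta). *)
Definition envelope (p beta Lambda : R) (m : nat) (C : R) : R :=
  d%:R ^+ m * C / (Lambda * rfact (m%:R / p)) ^+ 2
    * Delta `^ (2 * m%:R * beta).

Definition psi_exp (lambda : R) (h : nat) : R := expR (- (lambda * h%:R * Delta)).
Definition psi_poly (nu : R) (h : nat) : R := (1 + h%:R) `^ (- nu).

Definition covariance_decay (p beta Lambda : R) (M : nat) SX
    (Ct : nat -> R) (psi : nat -> R) : Prop :=
  (forall m, (1 <= m <= M)%N -> 0 < Ct m) /\
  forall m h, (1 <= m <= M)%N -> (1 <= h)%N ->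
    `| block_cov SX h m | <= envelope p beta Lambda m (Ct m) * psi h.

(** The decay rates are uniform in the degree m. *)
Definition decay_exp (p beta Lambda : R) (M : nat) SX (Ct : nat -> R)
    (lambda : R) : Prop :=
  0 < lambda /\ covariance_decay p beta Lambda M SX Ct (psi_exp lambda).
Definition decay_poly (p beta Lambda : R) (M : nat) SX (Ct : nat -> R)
    (nu : R) : Prop :=
  0 < nu /\ covariance_decay p beta Lambda M SX Ct (psi_poly nu).

Definition cov_matrix (U : Omega -> 'rV[R]_d) : 'M[R]_d :=
  \matrix_(i, j) fine (covariance P (fun o => U o ord0 i)
                                    (fun o => U o ord0 j)).

(** Var(U) = E |U - E U|^2. *)
Definition vector_variance (U : Omega -> 'rV[R]_d) : \bar R :=
  'E_P[fun o =>
    euclid_norm (U o - \row_i fine 'E_P[fun o' => U o' ord0 i]) ^+ 2].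

Definition V1 X : \bar R :=
  ereal_sup [set vector_variance (fun o => X o T - X o 0)
            | T in [set T : R | 0 < T]].

Definition Vlevel SX (m : nat) : \bar R :=
  ((block_cov SX 0 m)%:E
     + 2%:E * \sum_(1 <= h <oo) (`| block_cov SX h m |%R)%:E)%E.

Definition VlevelK SX (m K : nat) : R :=
  block_cov SX 0 m + 2 * \sum_(1 <= h < K) `| block_cov SX h m |.

Definition Vsum (M : nat) X SX : \bar R :=
  (2%:E * V1 X + 2%:E * \sum_(2 <= m < M.+1) Vlevel SX m)%E.

(** 2 V_1 plus twice the supremum over K >= K0 of a_K times the sum of the
    V_m^(K). *)
Definition Vsup (M : nat) X SX (K0 : nat) (a : nat -> R) : \bar R :=
  (2%:E * V1 X + 2%:E * ereal_sup
     [set (a K * \sum_(2 <= m < M.+1) VlevelK SX m K)%R%:E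
     | K in [set K : nat | (K0 <= K)%N]])%E.

Definition Veps (M : nat) X SX (nu eps : R) : \bar R :=
  Vsup M X SX 1 (fun K => K%:R `^ (nu - 1 - eps)).
Definition Vpoly (M : nat) X SX (nu : R) : \bar R :=
  Vsup M X SX 1 (fun K => K%:R `^ (nu - 1)).
Definition Vlog (M : nat) X SX : \bar R :=
  Vsup M X SX 2 (fun K => (ln K%:R)^-1).

(** Dependence factors under exponential alpha-mixing, and under covariance
    decay. *)
Definition Phi_mixing (lambdaX : R) (m : nat) : R :=
  1 + 2 * d%:R ^+ m / (1 - expR (- (lambdaX * Delta / 2))).
Definition Phi_decay (psi : nat -> R) : \bar R :=
  (1 + 2%:E * \sum_(1 <= h <oo) (psi h)%:E)%E.

(** V_K <= V / K with V finite, and the bound on V_1. *)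
Definition summable_rate (M : nat) X SX (VK : nat -> R) : Prop :=
  [/\ (Vsum M X SX < +oo)%E,
      forall K, (1 <= K)%N -> ((VK K)%:E <= Vsum M X SX * (K%:R^-1)%:E)%E &
      (V1 X <= (4 * \tr (cov_matrix (fun o => X o 0%R)))%:E)%E].

(** The level bounds under covariance decay: the constant Ct m may be enlarged so
    that the envelope bounds c_{0,m}, and then the envelope times the
    dependence factor bounds V_m. *)
Definition enlarged_level_bound (p beta Lambda : R) (M : nat) SX
    (Ct : nat -> R) (Phi : \bar R) : Prop :=
  (Phi < +oo)%E /\
  forall m, (2 <= m <= M)%N ->
    (exists C, Ct m <= C /\ block_cov SX 0 m <= envelope p beta Lambda m C) /\
    forall C, Ct m <= C -> block_cov SX 0 m <= envelope p beta Lambda m C ->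
      (Vlevel SX m <= (envelope p beta Lambda m C)%:E * Phi)%E.

End blocks.

(* Main.v *)
From HB Require Import structures.
Require Import Defs.
From mathcomp Require Import all_boot all_order all_algebra.
From mathcomp Require Import all_classical all_reals all_analysis.
From mathcomp Require Import measurable_realfun.
From mathcomp Require Import ring lra zify.
Import Order.TTheory GRing.Theory Num.Theory.
Import numFieldNormedType.Exports.
Local Open Scope classical_set_scope.
Local Open Scope ring_scope.
Set Implicit Arguments.
Unset Strict Implicit.
Unset Printing Implicit Defensive.

(** The estimation error splits into a discretization error and a fluctuation:
    [Y_k - E Z_1 = (Y_k - Z_k) + (Z_k - E Z_k)], as the blocks have the same
    law. By [(a + b)^2 <= 2 a^2 + 2 b^2] and Jensen's inequality the mean square
    error is at most twice the one-block discretization error plus [V_K], where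
    [V_K] is exactly twice the variance of the average of the [Z_k]. Expanding
    the square of that average and using stationarity bounds its degree-[m]
    part by [K^-1 V_m^(K)] ([level_variance_le]). Degree 0 is deterministic, and
    in degree 1 the signature is an increment, so that the sum over the blocks
    telescopes to [X_(K Delta) - X_0] and its average has variance at most
    [K^-2 V_1] ([level_variance1_le]). The rates then follow from the
    summability of the block covariances, or from the growth of their partial
    sums ([summable_rateP], [Vsup_rate]).

    These computations rest on the following facts about signatures.

    Measurability and stationarity. The hypotheses speak of the rough path up to
    degree [floor p] only. In a degree [m > p] the sums of [S^(m)_(t_j, t_(j+1))]
    over uniform partitions tend to 0, because the variation of order [p / m]
    is finite and [p / m < 1]; by Chen's identity the degree-[m] signature is
    then a limit of polynomials in its components of lower degree
    ([lyons_extension_cvg]). So every component of [S_(s,t)] is a fixed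
    measurable function of the components of the rough path within [[s, t]]
    ([lyons_functionalE]), which gives its measurability with respect to
    [X] over [[s, t]], and the invariance of the joint law of blocks under shifts. The
    signature of the interpolated path is such a function too: its iterated
    Riemann-Stieltjes integrals exist and are limits of Riemann sums
    ([interpolation_functionalE]).

    Moments. By induction on the degree: removing the points of a partition one
    by one, always one over which the control is at most twice its average,
    bounds a component of degree [m] by a constant times the [m]-th power of the
    p-variation norm ([lyons_extension_bound]). Moment control hence gives
    moments of all orders.

    Mixing. For functions with values in [[0, 1]] the covariance is a limit of
    averages of covariances of level sets, hence bounded by the mixing coefficient;
    truncation extends this to variables with moments of all orders, at the price
    of an exponent [q / (q + 2)] which is as close to 1 as desired ([davydov]).
    Polynomial mixing of order [nu] therefore gives covariance decay of every
    order below [nu] ([mixing_covariance_decay]): this is where [eps] comes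
    from, and exponential mixing is reduced to polynomial mixing of order 2.

    Finally, the level bounds only compare numbers with the envelope, which is
    positive in positive dimension since the factorial of a nonnegative real is
    finite and positive ([rfact_gt0]). *)

(** * Sums of powers *)

Section power_sums.
Context {R : realType}.
Implicit Types a x : R.

Lemma powR_ge1D a x : 0 < a -> 1 + x * ln a <= a `^ x.
Proof.
by move=> a0; rewrite /powR gt_eqF// expR_ge1Dx.
Qed.

Lemma powR_subr1 x a : 0 < x -> x `^ (a - 1) = x `^ a / x.
Proof.
by move=> x0; rewrite powRB ?powRr1 ?ltW// (gt_eqF x0) implybT.
Qed.

Lemma ln_le_sub1 x : 0 < x -> ln x <= x - 1.
Proof.
move=> x0; have := @le_ln1Dx R (x - 1).
by rewrite ltrBrDl subrr [1 + _]addrC subrK; apply.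
Qed.

Lemma ln_ge_1subV x : 0 < x -> 1 - x^-1 <= ln x.
Proof.
move=> x0; have := @ln_le_sub1 x^-1; rewrite invr_gt0 => /(_ x0).
by rewrite lnV ?posrE//; lra.
Qed.

(** With [a = th - 1], the term [N^(-th)] is at most the difference
    [((N - 1)^(-a) - N^(-a)) / a], because
    [(1 - 1/N)^(-a) >= 1 - a ln (1 - 1/N) >= 1 + a/N]; the differences
    telescope. *)
Lemma sum_powRN_gt1 (th : R) (n : nat) : 1 < th ->
  \sum_(1 <= r < n.+1) r%:R `^ (- th) <= 1 + (th - 1)^-1.
Proof.
move=> th1; have a0 : 0 < th - 1 by rewrite subr_gt0.
suff H k : \sum_(1 <= r < k.+2) r%:R `^ (- th)
    <= 1 + (th - 1)^-1 - (th - 1)^-1 * k.+1%:R `^ (- (th - 1)).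
  case: n => [|k]; first by rewrite big_geq// addr_ge0// invr_ge0 ltW.
  by apply: le_trans (H k) _; rewrite gerBl mulr_ge0 ?powR_ge0// invr_ge0 ltW.
elim: k => [|k IH]; first by rewrite big_nat1 !powR1 mulr1 addrK.
rewrite big_nat_recr//=; apply: (le_trans (lerD IH (lexx _))).
set N : R := k.+2%:R; set m : R := k.+1%:R.
have m0 : 0 < m by rewrite ltr0n.
have N0 : 0 < N by rewrite ltr0n.
have NE : N = m + 1 by rewrite /N /m -natr1.
suff H : N `^ (- th) <= (th - 1)^-1 * (m `^ (- (th - 1)) - N `^ (- (th - 1))).
  by move: H; rewrite mulrBr; lra.
rewrite mulrC ler_pdivlMr//.
have -> : - th = - (th - 1) - 1 by lra.
rewrite powR_subr1//.
have -> : m `^ (- (th - 1)) = N `^ (- (th - 1)) * (m / N) `^ (- (th - 1)).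
  by rewrite -powRM ?ltW ?divr_gt0// mulrCA divff ?gt_eqF// mulr1.
have E (x y : R) : x * y - x = x * (y - 1) by ring.
rewrite E -mulrA ler_wpM2l ?powR_ge0//.
have := @powR_ge1D (m / N) (- (th - 1)); rewrite divr_gt0// => /(_ isT).
have := @ln_le_sub1 (m / N); rewrite divr_gt0// => /(_ isT).
have -> : m / N - 1 = - N^-1 by rewrite NE; field; lra.
move=> /(ler_wpM2l (ltW a0)).
by move: N^-1 (powR _ _) (ln _) => u v w; lra.
Qed.

(** The same comparison with the increments of [t^(1 - nu) / (1 - nu)], which
    now increase; the factor 2 pays for replacing [N] by [N - 1]. *)
Lemma sum_powRN_lt1 (nu : R) (K : nat) : 0 < nu < 1 -> (1 <= K)%N ->
  \sum_(1 <= h < K) (1 + h%:R) `^ (- nu) <= 2 / (1 - nu) * K%:R `^ (1 - nu).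
Proof.
move=> /andP[nu0 nu1]; have a0 : 0 < 1 - nu by rewrite subr_gt0.
case: K => // k _; elim: k => [|k IH].
  by rewrite big_geq// mulr_ge0 ?powR_ge0// divr_ge0// ltW.
rewrite big_nat_recr//=; apply: (le_trans (lerD IH (lexx _))).
set N : R := k.+2%:R; set m : R := k.+1%:R.
have -> : 1 + m = N by rewrite nat1r.
have m1 : 1 <= m by rewrite ler1n.
have m0 : 0 < m by rewrite ltr0n.
have N0 : 0 < N by rewrite ltr0n.
have NE : N = m + 1 by rewrite /N /m -natr1.
have NN : N `^ (1 - nu) = m `^ (1 - nu) * (N / m) `^ (1 - nu).
  by rewrite -powRM ?ltW ?divr_gt0// mulrCA divff ?gt_eqF// mulr1.
have E1 : 1 + (1 - nu) / N <= (N / m) `^ (1 - nu).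
  have := @powR_ge1D (N / m) (1 - nu); rewrite divr_gt0// => /(_ isT).
  have := @ln_ge_1subV (N / m); rewrite divr_gt0// => /(_ isT).
  have -> : 1 - (N / m)^-1 = N^-1 by rewrite NE; field; lra.
  move=> /(ler_wpM2l (ltW a0)).
  by move: N^-1 (powR _ _) (ln _) => u v w; lra.
have E2 : N `^ (- nu) <= 2 * (m `^ (1 - nu) / N).
  have -> : N `^ (- nu) = N `^ (1 - nu) / N.
    by rewrite -powR_subr1//; congr (_ `^ _); lra.
  rewrite mulrA.
  rewrite ler_pM2r ?invr_gt0//.
  apply: (@le_trans _ _ ((2 * m) `^ (1 - nu))).
    by apply: ge0_ler_powR; rewrite ?nnegrE ?(ltW a0)//; lra.
  rewrite powRM ?(ltW m0)// ler_wpM2r ?powR_ge0//.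
  by apply: ler1_powR; rewrite ?ler1n//; lra.
suff : N `^ (- nu) <= 2 / (1 - nu) * (N `^ (1 - nu) - m `^ (1 - nu)).
  by rewrite mulrBr; lra.
apply: le_trans E2 _.
have : m `^ (1 - nu) * ((1 - nu) / N) <= N `^ (1 - nu) - m `^ (1 - nu).
  have E (x y : R) : x * y - x = x * (y - 1) by ring.
  by rewrite NN E ler_wpM2l ?powR_ge0// lerBrDl.
move=> H; rewrite -mulrA ler_wpM2l// [leRHS]mulrC ler_pdivlMr//.
by apply: le_trans H; rewrite -mulrA ler_wpM2l ?powR_ge0// mulrC.
Qed.

(** The comparison with the increments of the logarithm, which are at least
    [1 / N]. *)
Lemma sum_inv_le_ln (K : nat) : (1 <= K)%N ->
  \sum_(1 <= h < K) (1 + h%:R : R)^-1 <= ln K%:R.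
Proof.
case: K => // k _; elim: k => [|k IH]; first by rewrite big_geq// ln1.
rewrite big_nat_recr//=; apply: (le_trans (lerD IH (lexx _))).
set N : R := k.+2%:R; set m : R := k.+1%:R.
have -> : 1 + m = N by rewrite nat1r.
have m0 : 0 < m by rewrite ltr0n.
have N0 : 0 < N by rewrite ltr0n.
have NE : N = m + 1 by rewrite /N /m -natr1.
have := @ln_ge_1subV (N / m); rewrite divr_gt0// => /(_ isT).
rewrite ln_div ?posrE//.
have -> : 1 - (N / m)^-1 = N^-1 by rewrite NE; field; lra.
by rewrite lerBrDl.
Qed.

End power_sums.

(** * Uniform partitions *)

Section uniform_partitions.
Context {R : realType}.
Implicit Types a b c : R.

Definition unif_time a b (k j : nat) : R := a + j%:R * ((b - a) / k%:R).

Definition unif_partition a b (k : nat) : seq R :=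
  [seq unif_time a b k j | j <- iota 1 k].

Lemma unif_time0 a b k : unif_time a b k 0 = a.
Proof. by rewrite /unif_time mul0r addr0. Qed.

Lemma unif_timen a b k : (0 < k)%N -> unif_time a b k k = b.
Proof.
by move=> k0; rewrite /unif_time mulrC divfK ?pnatr_eq0 -?lt0n// subrKC.
Qed.

Lemma unif_time_step a b k j : unif_time a b k j.+1 - unif_time a b k j = (b - a) / k%:R.
Proof. by rewrite /unif_time -natr1; ring. Qed.

Lemma unif_time_shift c a b k j : unif_time (c + a) (c + b) k j = c + unif_time a b k j.
Proof. by rewrite /unif_time addrA; congr (_ + _ * (_ / _)); ring. Qed.

Lemma unif_time_le a b k i j : a <= b -> (i <= j)%N -> unif_time a b k i <= unif_time a b k j.
Proof.
move=> ab ij; rewrite lerD2l ler_wpM2r ?ler_nat//.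
by rewrite divr_ge0// subr_ge0.
Qed.

Lemma unif_time_lt a b k i j :
  a < b -> (0 < k)%N -> (i < j)%N -> unif_time a b k i < unif_time a b k j.
Proof.
move=> ab k0 ij; rewrite ltrD2l ltr_pM2r ?ltr_nat//.
by rewrite divr_gt0 ?subr_gt0 ?ltr0n.
Qed.

Lemma unif_time_ge a b k j : a <= b -> a <= unif_time a b k j.
Proof. by move=> ab; rewrite -{1}(unif_time0 a b k) unif_time_le. Qed.

Lemma unif_time_leb a b k j : a <= b -> (j <= k)%N -> unif_time a b k j <= b.
Proof.
case: k => [|k] ab jk.
  by move: jk; rewrite leqn0 => /eqP ->; rewrite unif_time0.
by rewrite -{2}(@unif_timen a b k.+1)// unif_time_le.
Qed.

Lemma unif_timexx a k j : unif_time a a k j = a.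
Proof. by rewrite /unif_time subrr mul0r mulr0 addr0. Qed.

Lemma size_unif_partition a b k : size (unif_partition a b k) = k.
Proof. by rewrite size_map size_iota. Qed.

Lemma nth_unif_partition a b k j : (j <= k)%N ->
  nth b (a :: unif_partition a b k) j = unif_time a b k j.
Proof.
case: j => [|j] jk /=; first by rewrite unif_time0.
by rewrite (nth_map 0%N) ?size_iota// nth_iota// add1n.
Qed.

Lemma unif_partitionP a b k : a < b -> (0 < k)%N ->
  itv_partition a b (unif_partition a b k).
Proof.
move=> ab k0; split; last first.
  by rewrite (last_nth b) size_unif_partition nth_unif_partition// unif_timen.
apply/(pathP b) => i; rewrite size_unif_partition => ik.
rewrite nth_unif_partition 1?ltnW//.
have -> : nth b (unif_partition a b k) i = unif_time a b k i.+1.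
  by rewrite -nth_unif_partition.
exact: unif_time_lt.
Qed.

Lemma unif_partition_mesh a b (eta : R) : 0 < eta ->
  \forall k \near \oo, (b - a) / k.+1%:R < eta.
Proof.
move=> eta0.
have H : (b - a) / k.+1%:R @[k --> \oo] --> (0 : R).
  rewrite -[X in _ --> X](mulr0 (b - a)).
  by apply: cvgM; [exact: cvg_cst|exact: cvg_harmonic].
exact: (cvgr_lt _ H).
Qed.

End uniform_partitions.

(** * Suprema over partitions *)

Section partition_sums.
Context {R : realType}.
Implicit Types (F : R -> R -> \bar R) (a b c : R).

Lemma partition_sum_cat (V : nmodType) (G : R -> R -> V) (x0 y0 : R) s t a :
  \sum_(0 <= j < size (s ++ t))
     G (nth x0 (a :: s ++ t) j) (nth x0 (a :: s ++ t) j.+1) =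
  \sum_(0 <= j < size s) G (nth y0 (a :: s) j) (nth y0 (a :: s) j.+1) +
  \sum_(0 <= j < size t)
     G (nth x0 (last a s :: t) j) (nth x0 (last a s :: t) j.+1).
Proof.
elim: s a => [|x s IH] a /=; first by rewrite [X in _ = X + _]big_geq// add0r.
by rewrite big_nat_recl//= IH [X in _ = X + _]big_nat_recl//= addrA.
Qed.

Lemma partition_sup_ubound F a b s : itv_partition a b s ->
  (\sum_(0 <= j < size s) F (nth b (a :: s) j) (nth b (a :: s) j.+1)
     <= partition_sup F a b)%E.
Proof. by move=> abs; apply: ereal_sup_ubound; exists s. Qed.

Lemma partition_sup1 F a b : a < b -> (F a b <= partition_sup F a b)%E.
Proof.
move=> ab; apply: le_trans (partition_sup_ubound F (itv_partition1 ab)).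
by rewrite big_nat1.
Qed.

Lemma partition_sup_unif_time F a b k : a < b -> (0 < k)%N ->
  (\sum_(0 <= j < k) F (unif_time a b k j) (unif_time a b k j.+1)
     <= partition_sup F a b)%E.
Proof.
move=> ab k0; apply: le_trans (partition_sup_ubound F (unif_partitionP ab k0)).
rewrite size_unif_partition le_eqVlt; apply/orP; left; apply/eqP.
by apply: eq_big_nat => j /andP[_ jk]; rewrite !nth_unif_partition// ltnW.
Qed.

Lemma partition_sup_ge0 F a b : (forall u v, 0 <= F u v)%E -> a <= b ->
  (0 <= partition_sup F a b)%E.
Proof.
move=> F0; rewrite le_eqVlt => /orP[/eqP->|ab].
  apply: le_trans (@partition_sup_ubound F b b [::] _); first by rewrite big_geq.
  by split => //=.
exact: le_trans (F0 _ _) (partition_sup1 _ ab).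
Qed.

(** Partitions of the two halves concatenate to a partition of the whole. The
    inequality survives infinite values since all terms are nonnegative. *)
Lemma partition_sup_superadditive F a b c : (forall u v, 0 <= F u v)%E ->
  a <= b -> b <= c ->
  (partition_sup F a b + partition_sup F b c <= partition_sup F a c)%E.
Proof.
move=> F0 ab bc; have := @partition_sup_ge0 F a c F0 (le_trans ab bc).
have H s t : itv_partition a b s -> itv_partition b c t ->
    (\sum_(0 <= j < size s) F (nth b (a :: s) j) (nth b (a :: s) j.+1) +
     \sum_(0 <= j < size t) F (nth c (b :: t) j) (nth c (b :: t) j.+1)
       <= partition_sup F a c)%E.
  move=> abs bct.
  apply: le_trans (partition_sup_ubound F (itv_partition_cat abs bct)).
  by rewrite (@partition_sum_cat _ _ c b); case: abs => _ /eqP ->.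
have := partition_sup_ge0 F0 bc.
case: (partition_sup F a c) H => [r| |] H; last 2 first.
- by move=> _ _; rewrite leey.
- by move=> _; rewrite leeNy_eq.
move=> Fbc _.
have S0 (a' b' : R) s : (0 <= \sum_(0 <= j < size s)
    F (nth b' (a' :: s) j) (nth b' (a' :: s) j.+1))%E.
  by apply: sume_ge0.
have bcf : partition_sup F b c \is a fin_num.
  rewrite ge0_fin_numE// (@le_lt_trans _ _ r%:E) ?ltry//.
  apply: ge_ereal_sup => _ [t bct <-].
  have /orP[/eqP abE|ab'] : (a == b) || (a < b) by rewrite -le_eqVlt.
    have := H [::] t; rewrite big_geq// add0e; apply => //.
    by split => //=; rewrite abE.
  apply: le_trans (H [:: b] t (itv_partition1 ab') bct).
  by rewrite leeDr.
rewrite -leeBrDr//; apply: ge_ereal_sup => _ [s abs <-].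
have sf : (\sum_(0 <= j < size s)
    F (nth b (a :: s) j) (nth b (a :: s) j.+1))%E \is a fin_num.
  rewrite ge0_fin_numE// (@le_lt_trans _ _ r%:E) ?ltry//.
  have /orP[/eqP bcE|bc'] : (b == c) || (b < c) by rewrite -le_eqVlt.
    have := H s [::] abs; rewrite [X in (_ + X)%E]big_geq// adde0; apply => //.
    by split => //=; rewrite bcE.
  apply: le_trans (H s [:: c] abs (itv_partition1 bc')).
  by rewrite leeDl.
rewrite leeBrDr// addeC -leeBrDr//; apply: ge_ereal_sup => _ [t bct <-].
by rewrite leeBrDr// addeC; exact: H.
Qed.

Lemma partition_sup_sub F a b c e : (forall u v, 0 <= F u v)%E ->
  a <= b -> b <= c -> c <= e ->
  (partition_sup F b c <= partition_sup F a e)%E.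
Proof.
move=> F0 ab bc ce; apply: (@le_trans _ _ (partition_sup F b e)).
  apply: le_trans (partition_sup_superadditive F0 bc ce).
  by rewrite leeDl// partition_sup_ge0.
apply: le_trans (partition_sup_superadditive F0 ab (le_trans bc ce)).
by rewrite leeDr// partition_sup_ge0.
Qed.

End partition_sums.

(** * Riemann-Stieltjes integrals *)

Section riemann_stieltjes.
Context {R : realType}.
Implicit Types (f g : R -> R) (a b c e : R).

(** Heine's theorem on the line; [y] may leave the segment, since the compactness
    argument moves only [x]. *)
Lemma uniformly_continuous_itv (phi : R -> R) a b (eps : R) :
  continuous phi -> 0 < eps ->
  exists2 eta, 0 < eta &
    forall x y, a <= x <= b -> `|x - y| < eta -> `|phi x - phi y| < eps.
Proof.
move=> cphi eps0.
have /compact_near_coveringP cpt := @segment_compact R a b.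
have := cpt R (0^'+) (fun e x => forall y, `|x - y| < e -> `|phi x - phi y| < eps) _.
case; last first.
  move=> eta /= eta0 H; exists (eta / 2); first by rewrite divr_gt0.
  move=> x y xab xy; apply: (H (eta / 2)) xy; rewrite /= ?sub0r ?normrN.
  - by rewrite gtr0_norm ?divr_gt0// ltr_pdivrMr// ltr_pMr// ltr1n.
  - by rewrite divr_gt0.
  - by rewrite in_itv.
move=> x _; have /cvgrPdist_lt/(_ (eps / 2)) := cphi x.
rewrite divr_gt0// => /(_ isT) [r /= r0 Hr].
have e2 : 0 < r / 2 by rewrite divr_gt0.
near=> z e => y /= zy.
have xz : `|x - z| < r / 2 by near: z; apply/nbhs_ballP; exists (r / 2).
have er : e < r / 2 by near: e; apply: nbhs_right_lt.
rewrite -(subrK (phi x) (phi z)) -addrA.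
apply: le_lt_trans (ler_normD _ _) _.
rewrite (splitr eps) ltrD//.
  rewrite distrC; apply: Hr => /=; apply: lt_trans xz _.
  by rewrite ltr_pdivrMr// ltr_pMr// ltr1n.
apply: Hr => /=; rewrite -(subrK z x) -addrA (splitr r).
by apply: le_lt_trans (ler_normD _ _) _; rewrite ltrD// (lt_trans zy).
Unshelve. all: by end_near. Qed.

Lemma fine_partition_exists a b (eta : R) : a <= b -> 0 < eta ->
  exists2 s, itv_partition a b s &
    forall j, (j < size s)%N -> nth b (a :: s) j.+1 - nth b (a :: s) j < eta.
Proof.
rewrite le_eqVlt => /predU1P[->|ab] eta0; first by exists [::].
have [N _ HN] := unif_partition_mesh a b eta0.
exists (unif_partition a b N.+1); first exact: unif_partitionP.
move=> j; rewrite size_unif_partition => jN.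
by rewrite !nth_unif_partition// 1?ltnW// unif_time_step; apply: (HN N) => /=.
Qed.

Lemma itv_partition_nth_mono a b s j : itv_partition a b s -> (j < size s)%N ->
  nth b (a :: s) j <= nth b (a :: s) j.+1.
Proof. by move=> [+ _] js => /(pathP b)/(_ j js)/ltW. Qed.

Lemma is_rs_integral_left f g a b I : a <= b -> is_rs_integral f g a b I ->
  forall eps, 0 < eps -> exists2 eta, 0 < eta & forall s, itv_partition a b s ->
    (forall j, (j < size s)%N ->
       nth b (a :: s) j.+1 - nth b (a :: s) j < eta) ->
    `| \sum_(0 <= j < size s) f (nth b (a :: s) j) *
         (g (nth b (a :: s) j.+1) - g (nth b (a :: s) j)) - I | < eps.
Proof.
move=> ab H eps eps0; have [eta eta0 He] := H eps eps0.
exists eta => // s abs mesh; apply: (He s (nth b (a :: s))) => //= j js.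
by split; [exact: mesh|rewrite lexx itv_partition_nth_mono].
Qed.

Lemma min_lel (x y : R) : Num.min x y <= x.
Proof. by rewrite ge_min lexx. Qed.

Lemma min_ler (x y : R) : Num.min x y <= y.
Proof. by rewrite ge_min lexx orbT. Qed.

Lemma is_rs_integral_unique f g a b I J : a <= b ->
  is_rs_integral f g a b I -> is_rs_integral f g a b J -> I = J.
Proof.
move=> ab HI HJ; apply/eqP; rewrite -subr_eq0 -normr_le0; apply/ler_addgt0Pl => eps eps0.
rewrite addr0.
have e2 : 0 < eps / 2 by rewrite divr_gt0.
have [e1 e10 H1] := is_rs_integral_left ab HI e2.
have [e3 e30 H3] := is_rs_integral_left ab HJ e2.
have m0 : 0 < Num.min e1 e3 by rewrite lt_min e10.
have [s abs mesh] := fine_partition_exists ab m0.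
have /ltW A := H1 s abs (fun j js => lt_le_trans (mesh j js) (min_lel _ _)).
have /ltW B := H3 s abs (fun j js => lt_le_trans (mesh j js) (min_ler _ _)).
rewrite (splitr eps); set S := (X in `|X - I|) in A.
have -> : I - J = (S - J) - (S - I) by ring.
by rewrite (le_trans (ler_normB _ _))// lerD.
Qed.

Lemma rs_integralE f g a b I : a <= b -> is_rs_integral f g a b I ->
  rs_integral f g a b = I.
Proof.
move=> ab HI; apply: xget_unique => // J HJ.
exact: is_rs_integral_unique ab HJ HI.
Qed.

Lemma eq_is_rs_integral f f' g g' a b I :
  (forall u, a <= u <= b -> f u = f' u) ->
  (forall u, a <= u <= b -> g u = g' u) ->
  is_rs_integral f g a b I -> is_rs_integral f' g' a b I.
Proof.
move=> ff gg H eps eps0; have [eta eta0 He] := H eps eps0.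
exists eta => // s tag abs mesh; have := He s tag abs mesh.
congr (`| _ - I | < eps); apply: eq_big_nat => j /andP[_ js].
have [_ /andP[tj jt]] := mesh j js.
have A := @itv_partition_nth_ge _ _ a b s j (ltnW js) abs.
have B := @itv_partition_nth_le _ _ a b s j.+1 js abs.
have C := le_trans tj jt.
rewrite ff ?gg//; apply/andP; split => //.
- exact: le_trans C B.
- exact: le_trans A C.
- exact: le_trans tj.
- exact: le_trans jt B.
Qed.

(** An existing integral is the limit of left-tagged sums along one explicit
    sequence of partitions; this makes it a limit of measurable functions. *)
Lemma is_rs_integral_cvg f g a b I : a <= b -> is_rs_integral f g a b I ->
  (\sum_(0 <= j < k.+1) f (unif_time a b k.+1 j) *
     (g (unif_time a b k.+1 j.+1) - g (unif_time a b k.+1 j))) @[k --> \oo] --> I.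
Proof.
rewrite le_eqVlt => /predU1P[<-|ab] H.
  have -> : I = 0.
    apply: (is_rs_integral_unique (lexx a) H) => eps eps0; exists 1 => // s tag.
    by move=> /itv_partitionxx -> _; rewrite big_geq// subrr normr0.
  rewrite (_ : (fun k => _) = fun=> 0) ?cvg_cst//; first exact: cvg_cst.
  apply/funext => k; rewrite big1_seq// => j _.
  by rewrite !unif_timexx subrr mulr0.
apply/cvgrPdist_lt => eps eps0.
have [eta eta0 He] := is_rs_integral_left (ltW ab) H eps0.
have := unif_partition_mesh a b eta0; apply: filterS => k mk.
have := He (unif_partition a b k.+1) (unif_partitionP ab (ltn0Sn k)).
rewrite size_unif_partition distrC => {}He.
rewrite (_ : \sum_(0 <= j < k.+1) _ = \sum_(0 <= j < k.+1)
  f (nth b (a :: unif_partition a b k.+1) j) *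
  (g (nth b (a :: unif_partition a b k.+1) j.+1) -
   g (nth b (a :: unif_partition a b k.+1) j))); last first.
  by apply: eq_big_nat => j /andP[_ jk]; rewrite !nth_unif_partition// ltnW.
by apply: He => j jk; rewrite !nth_unif_partition// 1?ltnW// unif_time_step.
Qed.

Lemma is_rs_integral_linear f g1 g2 (c : R) a b I1 I2 :
  is_rs_integral f g1 a b I1 -> is_rs_integral f g2 a b I2 ->
  is_rs_integral f (fun u => g1 u + c * g2 u) a b (I1 + c * I2).
Proof.
move=> H1 H2 eps eps0.
have c0 : 0 < `|c| + 1 by rewrite ltr_wpDl.
have e2 : 0 < eps / 2 by rewrite divr_gt0.
have e3 : 0 < eps / 2 / (`|c| + 1) by rewrite divr_gt0.
have [eta1 e10 He1] := H1 _ e2; have [eta2 e20 He2] := H2 _ e3.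
exists (Num.min eta1 eta2); first by rewrite lt_min e10.
move=> s tag abs mesh.
have {}He1 := He1 s tag abs (fun j js => conj (lt_le_trans (mesh j js).1 (min_lel _ _)) (mesh j js).2).
have {}He2 := He2 s tag abs (fun j js => conj (lt_le_trans (mesh j js).1 (min_ler _ _)) (mesh j js).2).
move: He1 He2; set S1 := \sum_(0 <= j < size s) _; set S2 := \sum_(0 <= j < size s) _.
move=> He1 He2; rewrite (_ : \sum_(0 <= j < size s) _ = S1 + c * S2); last first.
  by rewrite mulr_sumr -big_split; apply: eq_bigr => j _ /=; ring.
rewrite (_ : _ - _ = (S1 - I1) + c * (S2 - I2)); last by ring.
apply: le_lt_trans (ler_normD _ _) _; rewrite (splitr eps) ltr_leD// normrM.
apply: (@le_trans _ _ ((`|c| + 1) * (eps / 2 / (`|c| + 1)))).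
  by rewrite ler_pM// ?lerDl// ltW.
by rewrite mulrC divfK// gt_eqF.
Qed.

Lemma is_rs_integral_cst f (c : R) a b : is_rs_integral f (fun=> c) a b 0.
Proof.
move=> eps eps0; exists 1 => // s tag _ _.
rewrite big1 => [|j _]; first by rewrite subr0 normr0.
by rewrite subrr mulr0.
Qed.

Lemma is_rs_integral_sum f (g : nat -> R -> R) (v : nat -> R) (I : nat -> R)
    (c : R) (n : nat) a b :
  (forall j, (j < n)%N -> is_rs_integral f (g j) a b (I j)) ->
  is_rs_integral f (fun u => c + \sum_(0 <= j < n) v j * g j u) a b
    (\sum_(0 <= j < n) v j * I j).
Proof.
elim: n => [|n IH] H.
  rewrite big_geq//; apply: eq_is_rs_integral (is_rs_integral_cst f c a b) => //.
  by move=> u _; rewrite big_geq// addr0.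
have A := IH (fun j jn => H j (ltnW jn)).
rewrite big_nat_recr//=.
apply: eq_is_rs_integral (is_rs_integral_linear (v n) A (H n _)) => // u _.
by rewrite big_nat_recr//= addrA.
Qed.

(** Left-tagged sums satisfy the bound and approximate the integral; an integral
    that does not exist is 0 by convention. *)
Lemma rs_integral_le f g a b (C L : R) : a <= b ->
  (forall u, a <= u <= b -> `|f u| <= C) ->
  (forall s, itv_partition a b s -> \sum_(0 <= j < size s)
      `|g (nth b (a :: s) j.+1) - g (nth b (a :: s) j)| <= L) ->
  `|rs_integral f g a b| <= C * L.
Proof.
move=> ab fC gL.
have C0 : 0 <= C by apply: le_trans (fC a _) => //; rewrite lexx ab.
have L0 : 0 <= L.
  have [s abs _] := fine_partition_exists ab ltr01.
  by apply: le_trans (gL s abs); apply: sumr_ge0.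
rewrite /rs_integral; case: xgetP => [I _ HI|_]; last by rewrite normr0 mulr_ge0.
apply/ler_addgt0Pr => eps eps0.
have [eta eta0 He] := is_rs_integral_left ab HI eps0.
have [s abs mesh] := fine_partition_exists ab eta0.
have := He s abs mesh; set S := \sum_(0 <= j < size s) _ => /ltW HS.
rewrite -(subrK S I) addrC (le_trans (ler_normD _ _))// lerD//; last first.
  by rewrite distrC.
apply: le_trans (ler_norm_sum _ _ _) _; apply: (@le_trans _ _
  (C * \sum_(0 <= j < size s) `|g (nth b (a :: s) j.+1) - g (nth b (a :: s) j)|)).
  rewrite mulr_sumr; apply: ler_sum_nat => j /andP[_ js]; rewrite normrM.
  rewrite ler_wpM2r//; apply: fC.
  by rewrite itv_partition_nth_ge ?itv_partition_nth_le// ltnW.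
by rewrite ler_wpM2l// gL.
Qed.

Lemma antiderivative_exists (phi : R -> R) a b : continuous phi -> a <= b ->
  exists Phi : R -> R, forall x, a <= x <= b -> is_derive x 1 Phi (phi x).
Proof.
move=> cphi ab.
exists (fun x => \int[lebesgue_measure]_(t in [set` `[a - 1, x]]) phi t)%R.
move=> x /andP[ax xb].
have xb1 : x < b + 1 by rewrite (le_lt_trans xb)// ltrDl.
have phii : (@lebesgue_measure R).-integrable [set` `[a - 1, b + 1]] (EFin \o phi).
  apply: continuous_compact_integrable; first exact: segment_compact.
  exact: continuous_subspaceT.
have ax1 : a - 1 < x by rewrite (lt_le_trans _ ax)// ltrBlDr ltrDl.
have [dF FE] := continuous_FTC1_closed xb1 phii ax1 (cphi x).
by rewrite -FE derive1E; exact/derivableP.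
Qed.

Definition clamp c e (u : R) : R := Num.max c (Num.min u e).

Lemma clamp_continuous c e : continuous (clamp c e).
Proof.
move=> u; rewrite (_ : clamp c e = (fun=> c) \max (id \min (fun=> e)))//.
apply: (@continuous_max _ _ (fun=> c) _ u); first exact: cst_continuous.
by apply: (@continuous_min _ _ id _ u) => //; exact: cst_continuous.
Qed.

Lemma clamp_itv c e u : c <= e -> c <= clamp c e u <= e.
Proof.
by move=> ce; rewrite /clamp le_max lexx/= ge_max ce ge_min lexx orbT.
Qed.

Lemma clamp_id c e u : c <= u <= e -> clamp c e u = u.
Proof. by move=> /andP[cu ue]; rewrite /clamp (min_idPl ue) (max_idPr cu). Qed.

Lemma clamp_le c e u : c <= e -> u <= c -> clamp c e u = c.
Proof.
by move=> ce uc; rewrite /clamp; apply/max_idPl; rewrite ge_min uc.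
Qed.

Lemma clamp_ge c e u : c <= e -> e <= u -> clamp c e u = e.
Proof.
by move=> ce eu; rewrite /clamp (min_idPr eu); apply/max_idPr.
Qed.

Lemma clamp_mono c e u v : c <= e -> u <= v ->
  0 <= clamp c e v - clamp c e u <= v - u.
Proof.
move=> ce uv.
case: (leP u c) => [uc|/ltW cu]; case: (leP v e) => [ve|/ltW ev].
- rewrite (clamp_le ce uc); case: (leP v c) => [vc|/ltW cv].
    by rewrite (clamp_le ce vc); lra.
  by rewrite clamp_id ?cv//; lra.
- by rewrite (clamp_le ce uc) (clamp_ge ce ev); lra.
- by rewrite !clamp_id ?cu ?ve ?(le_trans uv)// ?(le_trans cu)//; lra.
- rewrite (clamp_ge ce ev); case: (leP u e) => [ue|/ltW eu].
    by rewrite clamp_id ?cu//; lra.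
  by rewrite (clamp_ge ce eu); lra.
Qed.

(** Wherever the clamped path moves it coincides with the identity, so the
    intermediate point of the mean value theorem stays in [[u, v]]. *)
Lemma clamp_mean_value (phi Phi : R -> R) c e u v : c <= e -> u <= v ->
  (forall x, c <= x <= e -> is_derive x 1 Phi (phi x)) ->
  exists2 xi, u <= xi <= v &
    Phi (clamp c e v) - Phi (clamp c e u) =
      phi xi * (clamp c e v - clamp c e u).
Proof.
move=> ce uv dPhi; have /andP[cc _] := clamp_mono ce uv; rewrite subr_ge0 in cc.
have /andP[cu ue] := clamp_itv u ce; have /andP[cv ve] := clamp_itv v ce.
move: cc; rewrite le_eqVlt => /predU1P[->|uv'].
  by exists u; rewrite ?lexx ?uv// !subrr mulr0.
have d x : x \in `[clamp c e u, clamp c e v] -> is_derive x 1 Phi (phi x).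
  rewrite in_itv/= => /andP[x1 x2]; apply: dPhi.
  by rewrite (le_trans cu x1) (le_trans x2 ve).
have d0 x : x \in `]clamp c e u, clamp c e v[ -> is_derive x 1 Phi (phi x).
  by move=> xI; apply: d; apply: subset_itv_oo_cc xI.
have cPhi : {within `[clamp c e u, clamp c e v], continuous Phi}.
  by apply: derivable_within_continuous => x /d [].
have [xi] := @MVT_segment R Phi phi _ _ (ltW uv') d0 cPhi.
rewrite in_itv/= => /andP[x1 x2] E; exists xi => //; apply/andP; split.
- apply: le_trans x1; case: (leP u e) => [ue'|/ltW eu].
    by rewrite /clamp (min_idPl ue') le_max lexx orbT.
  by move: uv'; rewrite !clamp_ge ?ltxx// (le_trans eu).
- apply: le_trans x2 _; case: (leP c v) => [cv'|/ltW vc].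
    by rewrite /clamp ge_max cv' ge_min lexx.
  by move: uv'; rewrite !clamp_le ?ltxx// (le_trans uv).
Qed.

(** The mean value theorem writes each increment of [Phi] along the clamped path
    as a term of a Riemann sum with its own tag, and uniform continuity of [phi]
    compares the two tags. *)
Lemma is_rs_integral_clamp (phi Phi : R -> R) c e a b :
  continuous phi -> c <= e -> a <= b ->
  (forall x, c <= x <= e -> is_derive x 1 Phi (phi x)) ->
  is_rs_integral phi (clamp c e) a b (Phi (clamp c e b) - Phi (clamp c e a)).
Proof.
move=> cphi ce ab dPhi eps eps0.
have ba1 : 0 < b - a + 1 by rewrite ltr_wpDl// subr_ge0.
have e1 : 0 < eps / (b - a + 1) by rewrite divr_gt0.
have [eta eta0 He] := @uniformly_continuous_itv phi a b _ cphi e1.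
exists eta => // s tag abs mesh; pose t := nth b (a :: s).
have -> : Phi (clamp c e b) - Phi (clamp c e a) =
    \sum_(0 <= j < size s) (Phi (clamp c e (t j.+1)) - Phi (clamp c e (t j))).
  rewrite telescope_sumr//.
  by rewrite /t (itv_partition_nth_size _ abs).
rewrite -sumrB.
apply: (@le_lt_trans _ _ (\sum_(0 <= j < size s)
    eps / (b - a + 1) * (t j.+1 - t j))).
  apply: le_trans (ler_norm_sum _ _ _) _.
  apply: ler_sum_nat => j /andP[_ js].
  have [tt /andP[tj jt]] := mesh j js.
  have tm := le_trans tj jt.
  have [xi /andP[x1 x2] ->] := clamp_mean_value ce tm dPhi.
  rewrite -mulrBl normrM.
  have /andP[d0 d1] := clamp_mono ce tm.
  rewrite (ger0_norm d0); apply: ler_pM => //; apply: ltW.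
  have A := @itv_partition_nth_ge _ _ a b s j (ltnW js) abs.
  have B := @itv_partition_nth_le _ _ a b s j.+1 js abs.
  apply: He.
    by rewrite (le_trans A tj) (le_trans jt B).
  by move: tt tj jt x1 x2; rewrite ltr_norml /=; move: (nth _ _ _) => *; lra.
rewrite -mulr_sumr telescope_sumr// /t (itv_partition_nth_size _ abs)/=.
by rewrite mulrAC ltr_pdivrMr// ltr_pM2l// ltrDl.
Qed.

End riemann_stieltjes.

Lemma continuous_sum_nat {R : realType} (n : nat) (f : nat -> R -> R) :
  (forall j, (j < n)%N -> continuous (f j)) ->
  continuous (fun u => \sum_(0 <= j < n) f j u).
Proof.
elim: n => [|n IH] H.
  rewrite (_ : (fun _ => _) = fun=> 0); first exact: cst_continuous.
  by apply/funext => u; rewrite big_geq.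
rewrite (_ : (fun _ => _) = (fun u => \sum_(0 <= j < n) f j u + f n u)).
  by move=> u; apply: cvgD; [apply: IH => j jn; apply/H/ltnW|exact: H].
by apply/funext => u; rewrite big_nat_recr.
Qed.

(** * Signatures of interpolated paths *)

Section bv_signature.
Context {R : realType} {d : nat}.
Implicit Types (x : R -> 'rV[R]_d) (w : seq 'I_d).

Lemma norm_coord_le_euclid (v : 'rV[R]_d) i : `|v ord0 i| <= euclid_norm v.
Proof.
rewrite -sqrtr_sqr; apply: ler_wsqrtr.
by rewrite (bigD1 i)//= lerDl sumr_ge0// => j _; exact: sqr_ge0.
Qed.

Lemma euclid_norm_ge0 (v : 'rV[R]_d) : 0 <= euclid_norm v.
Proof. exact: sqrtr_ge0. Qed.

(** By induction on the word, the last integration being against a coordinate of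
    variation at most [L]. *)
Lemma bv_signature_le x a b (L : R) w u :
  (path_length x a b <= L%:E)%E -> a <= u <= b ->
  `|bv_signature_rev x a w u| <= L ^+ size w.
Proof.
move=> xL; elim: w u => [|i w IH] u /andP[au ub] /=; first by rewrite normr1 expr0.
rewrite exprSr; apply: rs_integral_le => // [r /andP[ar ru]|s aus].
  by apply: IH; rewrite ar (le_trans ru ub).
rewrite -lee_fin; apply: le_trans xL.
apply: (@le_trans _ _ (path_length x a u)); last first.
  by apply: partition_sup_sub => // r t; rewrite lee_fin euclid_norm_ge0.
apply: le_trans (partition_sup_ubound _ aus).
rewrite -sumEFin; apply: lee_sum => j _; rewrite lee_fin.
apply: le_trans (norm_coord_le_euclid _ i).
by rewrite !mxE.
Qed.

Definition knot (a delta : R) (j : nat) : R := a + j%:R * delta.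

Lemma knotS a delta j : knot a delta j + delta = knot a delta j.+1.
Proof. by rewrite /knot -natr1; ring. Qed.

Lemma knot_le a delta i j : 0 <= delta -> (i <= j)%N ->
  knot a delta i <= knot a delta j.
Proof. by move=> d0 ij; rewrite lerD2l ler_wpM2r// ler_nat. Qed.

(** A piecewise-linear path is a constant plus a combination of the paths that
    run through one mesh interval and rest elsewhere. *)
Lemma interpolationE x a delta n u i : (2 <= n)%N -> 0 < delta ->
  a <= u <= knot a delta n.-1 ->
  interpolation x a delta n u ord0 i = x a ord0 i +
    \sum_(0 <= j < n.-1)
      (x (knot a delta j.+1) ord0 i - x (knot a delta j) ord0 i) / delta *
      (clamp (knot a delta j) (knot a delta j.+1) u - knot a delta j).
Proof.
move=> n2 d0 /andP[au ub]; rewrite /interpolation.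
set J := minn _ _; rewrite -/(knot a delta J) knotS.
have ua0 : 0 <= (u - a) / delta by rewrite divr_ge0 ?subr_ge0// ltW.
have /andP[T1 T2] := truncn_itv ua0.
have Jn : (J <= n - 2)%N by rewrite /J geq_minr.
have J1 : knot a delta J <= u.
  rewrite /knot -lerBrDl -ler_pdivlMr//; apply: le_trans T1.
  by rewrite ler_nat geq_minl.
have J2 : u <= knot a delta J.+1.
  rewrite /J; case: leqP => _.
    by rewrite /knot -lerBlDl -ler_pdivrMr// ltW.
  by rewrite (_ : (n - 2).+1 = n.-1)//; lia.
rewrite (@big_cat_nat _ _ _ J.+1)//=; last by lia.
rewrite [X in _ + (_ + X)]big_nat_cond [X in _ + (_ + X)]big1 ?addr0; last first.
  move=> j /andP[/andP[Jj _] _]; rewrite clamp_le ?subrr ?mulr0//.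
    by rewrite knot_le// ltW.
  by rewrite (le_trans J2)// knot_le// ltW.
rewrite big_nat_recr//= clamp_id ?J1//.
rewrite (eq_big_nat _ _ (F2 := fun j =>
   x (knot a delta j.+1) ord0 i - x (knot a delta j) ord0 i)); last first.
  move=> j /andP[_ jJ]; rewrite clamp_ge; last 2 first.
  - by rewrite knot_le// ltW.
  - by rewrite (le_trans _ J1)// knot_le// ltW.
  by rewrite -knotS [_ + delta]addrC addrK divfK// gt_eqF.
rewrite (telescope_sumr (fun j => x (knot a delta j) ord0 i))// !mxE.
by rewrite /knot mul0r addr0; field; rewrite gt_eqF.
Qed.

(** The integral against each clamped path is an increment of an antiderivative,
    and a continuous function of the upper bound. Continuity is what lets the
    next integral be taken. *)
Lemma is_rs_integral_interpolation x a delta n (phi : R -> R) i :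
  (2 <= n)%N -> 0 < delta -> continuous phi ->
  exists2 psi : R -> R, continuous psi & forall u, a <= u <= knot a delta n.-1 ->
    is_rs_integral phi (fun u => interpolation x a delta n u ord0 i) a u (psi u).
Proof.
move=> n2 d0 cphi.
have kk j : knot a delta j <= knot a delta j.+1 by rewrite knot_le// ltW.
have ak : a <= knot a delta n.-1 by rewrite /knot lerDl mulr_ge0// ltW.
have [Phi dPhi] := antiderivative_exists cphi ak.
pose c j := clamp (knot a delta j) (knot a delta j.+1).
pose v j := (x (knot a delta j.+1) ord0 i - x (knot a delta j) ord0 i) / delta.
have kn j z : (j < n.-1)%N -> knot a delta j <= z <= knot a delta j.+1 ->
    a <= z <= knot a delta n.-1.
  move=> jn /andP[z1 z2]; apply/andP; split.
    by apply: le_trans z1; rewrite /knot lerDl mulr_ge0// ltW.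
  by apply: le_trans z2 _; rewrite knot_le// ltW.
exists (fun u => \sum_(0 <= j < n.-1) v j * (Phi (c j u) - Phi (c j a))).
  apply: continuous_sum_nat => j jn u.
  apply: cvgM; first exact: cvg_cst.
  apply: cvgB; last exact: cvg_cst.
  apply: (@continuous_comp _ _ _ (c j) Phi u); first exact: clamp_continuous.
  have := clamp_itv u (kk j) => /(kn _ _ jn) /dPhi [+ _].
  by move=> /derivable1_diffP/differentiable_continuous.
move=> u /andP[au ub].
pose c0 := x a ord0 i - \sum_(0 <= j < n.-1) v j * knot a delta j.
have H j : (j < n.-1)%N ->
    is_rs_integral phi (c j) a u (Phi (c j u) - Phi (c j a)).
  by move=> jn; apply: is_rs_integral_clamp => // z /(kn _ _ jn); exact: dPhi.
apply: eq_is_rs_integral (is_rs_integral_sum v c0 H) => // r /andP[ar ru].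
rewrite interpolationE// ?ar ?(le_trans ru)// /c0 -addrA; congr (_ + _).
by rewrite -sumrN -big_split; apply: eq_bigr => j _ /=; rewrite /c /v; ring.
Qed.

Lemma bv_signature_interpolation x a delta n w :
  (2 <= n)%N -> 0 < delta ->
  exists2 phi : R -> R, continuous phi & forall u, a <= u <= knot a delta n.-1 ->
    bv_signature_rev (interpolation x a delta n) a w u = phi u.
Proof.
move=> n2 d0; elim: w => [|i w [phi cphi IH]].
  by exists (fun=> 1) => //; exact: cst_continuous.
have [psi cpsi H] := is_rs_integral_interpolation x a i n2 d0 cphi.
exists psi => // u /andP[au ub] /=; apply: rs_integralE => //.
apply: eq_is_rs_integral (H u _) => //; last by rewrite au ub.
by move=> r /andP[ar ru]; rewrite IH// ar (le_trans ru ub).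
Qed.

Lemma bv_signature_interpolation_cvg x a delta n i w u :
  (2 <= n)%N -> 0 < delta -> a <= u <= knot a delta n.-1 ->
  let y := interpolation x a delta n in
  (\sum_(0 <= j < k.+1) bv_signature_rev y a w (unif_time a u k.+1 j) *
     (y (unif_time a u k.+1 j.+1) ord0 i - y (unif_time a u k.+1 j) ord0 i))
    @[k --> \oo] --> bv_signature_rev y a (i :: w) u.
Proof.
move=> n2 d0 /andP[au ub] y.
have [phi cphi Hphi] := bv_signature_interpolation x a w n2 d0.
have [psi cpsi H] := is_rs_integral_interpolation x a i n2 d0 cphi.
have HI : is_rs_integral (bv_signature_rev y a w) (fun r => y r ord0 i) a u (psi u).
  apply: eq_is_rs_integral (H u _) => //; last by rewrite au ub.
  by move=> r /andP[ar ru]; rewrite Hphi// ar (le_trans ru ub).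
by rewrite /= (rs_integralE au HI); exact: is_rs_integral_cvg HI.
Qed.

End bv_signature.

(** * Young's argument for almost additive functions *)

Section young.
Context {R : realType}.
Implicit Types (F om : R -> R -> R) (t : nat -> R).

(** The part of the notion of a control that Young's argument uses. *)
Definition superadditive om : Prop :=
  (forall s u, 0 <= s -> s <= u -> 0 <= om s u) /\
  forall s u v, 0 <= s -> s <= u -> u <= v -> om s u + om u v <= om s v.

Lemma superadditive_le om s u v r : superadditive om ->
  0 <= s -> s <= u -> u <= v -> v <= r -> om u v <= om s r.
Proof.
move=> [om0 omD] s0 su uv vr; have u0 := le_trans s0 su.
have := omD s u v s0 su uv; have := omD s v r s0 (le_trans su uv) vr.
have := om0 s u s0 su; have := om0 v r (le_trans u0 uv) vr; lra.
Qed.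

(** The intervals with even index are disjoint, and so are those with odd index;
    the induction keeps both chains at once. *)
Lemma sum_overlapping_le om t n : superadditive om ->
  0 <= t 0%N -> {homo t : i j / (i <= j)%N >-> i <= j} ->
  \sum_(0 <= l < n) om (t l) (t l.+2) <=
    om (t 0%N) (t n) + om (t 0%N) (t n.+1).
Proof.
move=> omS t0 tm; have [om0 omD] := omS; elim: n => [|n IH].
  by rewrite big_geq// addr_ge0// om0// tm.
rewrite big_nat_recr//=; apply: le_trans (lerD IH (lexx _)) _.
have tn : t n <= t n.+2 by apply: tm; lia.
by have := omD (t 0%N) (t n) (t n.+2) t0 (tm _ _ (leq0n _)) tn; lra.
Qed.

(** The average of the [om (t l) (t l.+2)] bounds the least of them. *)
Lemma removable_point om t n : superadditive om ->
  0 <= t 0%N -> {homo t : i j / (i <= j)%N >-> i <= j} ->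
  exists2 l, (l < n.+1)%N &
    om (t l) (t l.+2) <= 2 / n.+1%:R * om (t 0%N) (t n.+2).
Proof.
move=> omS t0 tm; apply: contrapT => H.
have : \sum_(0 <= l < n.+1) (2 / n.+1%:R * om (t 0%N) (t n.+2)) <
       \sum_(0 <= l < n.+1) om (t l) (t l.+2).
  apply: ltr_sum_nat => // l ln.
  by rewrite ltNge; apply/negP => C; apply: H; exists l.
rewrite big_const_nat iter_addr_0 subn0 -[_ *+ n.+1]mulr_natl mulrA mulrCA.
rewrite divff// mulr1.
move=> /lt_le_trans /(_ (sum_overlapping_le n.+1 omS t0 tm)).
have tn : t n.+1 <= t n.+2 by apply: tm; lia.
have := superadditive_le omS t0 (lexx _) (tm _ _ (leq0n n.+1)) tn; lra.
Qed.

Lemma sum_remove_point F t n l : (l < n.+1)%N ->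
  \sum_(0 <= j < n.+2) F (t j) (t j.+1) =
  \sum_(0 <= j < n.+1) F (t (bump l.+1 j)) (t (bump l.+1 j.+1)) +
    (F (t l) (t l.+1) + F (t l.+1) (t l.+2) - F (t l) (t l.+2)).
Proof.
move=> ln.
rewrite (@big_cat_nat _ _ _ l.+2)//= [in RHS](@big_cat_nat _ _ _ l.+1)//=.
rewrite [in LHS]big_nat_recr//= [in LHS]big_nat_recr//=.
rewrite [in RHS]big_nat_recr//=.
rewrite -(addn1 l.+1) -(addn1 n.+1) big_addn addnK.
have -> : \sum_(0 <= i < l) F (t (bump l.+1 i)) (t (bump l.+1 i.+1)) =
          \sum_(0 <= i < l) F (t i) (t i.+1).
  apply: eq_big_nat => i /andP[_ il]; rewrite /bump.
  by rewrite [(_ < i)%N]ltnNge (ltnW il) ltnS leqNgt il.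
have -> : \sum_(l.+1 <= i < n.+1) F (t (bump l.+1 i)) (t (bump l.+1 i.+1)) =
          \sum_(l.+1 <= i < n.+1) F (t (i + 1)%N) (t (i + 1).+1%N).
  apply: eq_big_nat => i /andP[li _]; rewrite /bump li ltnS (ltnW li).
  by rewrite !add1n !addn1.
rewrite /bump ltnn leqnn add0n add1n addn1; ring.
Qed.

(** Points are removed one by one, each time one over which [om] is at most
    twice the average; the errors sum up to a convergent series because
    [th > 1]. *)
Lemma young_partition_bound F om (D th : R) : superadditive om -> 1 < th ->
  0 <= D ->
  (forall s u v, 0 <= s -> s <= u -> u <= v ->
     `|F s v - F s u - F u v| <= D * om s v `^ th) ->
  forall n t, 0 <= t 0%N -> {homo t : i j / (i <= j)%N >-> i <= j} ->
  `|F (t 0%N) (t n.+1) - \sum_(0 <= j < n.+1) F (t j) (t j.+1)| <=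
    D * (2 `^ th * (1 + (th - 1)^-1)) * om (t 0%N) (t n.+1) `^ th.
Proof.
move=> omS th1 D0 HF n t t0 tm; have [om0 _] := omS.
have th0 : 0 <= th by lra.
suff : `|F (t 0%N) (t n.+1) - \sum_(0 <= j < n.+1) F (t j) (t j.+1)| <=
    D * (2 `^ th * \sum_(1 <= r < n.+1) r%:R `^ (- th)) *
      om (t 0%N) (t n.+1) `^ th.
  move=> /le_trans; apply; apply: ler_wpM2r; first exact: powR_ge0.
  by apply: ler_wpM2l => //; rewrite ler_wpM2l ?powR_ge0// sum_powRN_gt1.
elim: n t t0 tm => [|n IH] t t0 tm.
  by rewrite big_nat1 subrr normr0 big_geq// !mulr0 mul0r.
have [l ln oml] := removable_point n omS t0 tm.
rewrite (sum_remove_point F t ln) [in leRHS]big_nat_recr//= mulrDr mulrDr mulrDl.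
pose t' j := t (bump l.+1 j).
have t'0 : t' 0%N = t 0%N by [].
have t'n : t' n.+1 = t n.+2 by rewrite /t' /bump ln.
have t'm : {homo t' : i j / (i <= j)%N >-> i <= j}.
  by move=> i j ij; apply: tm; rewrite leq_bump2.
rewrite opprD addrA; apply: le_trans (ler_normD _ _) _; apply: lerD.
  by have := IH t'; rewrite t'0 t'n; apply.
have tl : 0 <= t l by apply: le_trans t0 (tm _ _ _).
rewrite [X in `|X|](_ : _ = F (t l) (t l.+2) - F (t l) (t l.+1) - F (t l.+1) (t l.+2));
  last by ring.
have tl1 : t l <= t l.+1 by apply: tm.
have tl2 : t l.+1 <= t l.+2 by apply: tm.
have tn : 0 <= om (t 0%N) (t n.+2) by rewrite om0// tm.
apply: le_trans (HF _ _ _ tl tl1 tl2) _; rewrite -mulrA ler_wpM2l//.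
have n0 : (0 : R) <= n.+1%:R^-1 by rewrite invr_ge0.
apply: (@le_trans _ _ ((2 / n.+1%:R * om (t 0%N) (t n.+2)) `^ th)).
  apply: ge0_ler_powR => //; rewrite nnegrE ?mulr_ge0//.
  by rewrite om0// (le_trans tl1).
rewrite powRM ?mulr_ge0// powRM// ler_wpM2r ?powR_ge0// ler_wpM2l ?powR_ge0//.
by rewrite -powR_inv1// -powRrM mulN1r.
Qed.

End young.

(** * Lyons extensions as limits *)

Section lyons_extensions.
Context {R : realType} {d : nat}.
Implicit Types (A S : R -> R -> tensor R d) (w : seq 'I_d) (p : R).

(** What Chen's identity at [w] involves besides [w] itself. *)
Definition chen_middle S w (s u t : R) : R :=
  \sum_(1 <= i < size w) S s u (take i w) * S u t (drop i w).

Lemma chenE N S w s u t : Defs.multiplicative N S -> (0 < size w <= N)%N ->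
  0 <= s -> s <= u -> u <= t ->
  S s t w = S s u w + S u t w + chen_middle S w s u t.
Proof.
move=> [S1 SM] /andP[w0 wN] s0 su ut; rewrite (SM s u t w)// /tensor_mul.
rewrite -(big_mkord xpredT (fun i => S s u (take i w) * S u t (drop i w))).
rewrite big_ltn// big_nat_recr//= take0 drop0 take_size drop_size.
rewrite (S1 s u)// (S1 u t)// ?(le_trans s0)// mul1r mulr1.
by rewrite /chen_middle; ring.
Qed.

(** Chen's identity at [s = u = t] reads [x = 2 x] once the lower degrees are
    known to vanish. *)
Lemma multiplicative_diag S w s : (forall N, Defs.multiplicative N S) -> 0 <= s ->
  w != [::] -> S s s w = 0.
Proof.
move=> SM s0; move: {2}(size w) (leqnn (size w)) => n.
elim: n w => [|n IH] w wn w0; first by move: w0 wn; case: w.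
have sw : (0 < size w)%N by rewrite lt0n size_eq0.
have := @chenE (size w) S w s s s (SM _).
rewrite sw leqnn => /(_ isT s0 (lexx _) (lexx _)).
have -> : chen_middle S w s s s = 0.
  rewrite /chen_middle big_nat_cond big1// => i /andP[/andP[i0 iw] _].
  rewrite IH ?mul0r// ?size_take ?iw; first by lia.
  by rewrite -size_eq0 size_take iw -lt0n.
by rewrite addr0; lra.
Qed.

(** Chen's identity telescopes along the partition when its starting point
    [s] is kept fixed. *)
Lemma sum_chen_middle S w s t k : (forall N, Defs.multiplicative N S) ->
  w != [::] -> 0 <= s -> s <= t -> (0 < k)%N ->
  S s t w = \sum_(0 <= j < k)
      chen_middle S w s (unif_time s t k j) (unif_time s t k j.+1) +
    \sum_(0 <= j < k) S (unif_time s t k j) (unif_time s t k j.+1) w.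
Proof.
move=> SM w0 s0 st k0.
have sw : (0 < size w)%N by rewrite lt0n size_eq0.
have -> : S s t w = S s (unif_time s t k k) w - S s (unif_time s t k 0) w.
  by rewrite unif_timen// unif_time0 multiplicative_diag// subr0.
rewrite -big_split/= -(telescope_sumr (fun j => S s (unif_time s t k j) w))//.
apply: eq_big_nat => j /andP[_ jk].
rewrite (@chenE (size w) S w s (unif_time s t k j) (unif_time s t k j.+1) (SM _)).
- by ring.
- by rewrite sw leqnn.
- by [].
- exact: unif_time_ge.
- exact: unif_time_le.
Qed.

Lemma level_dot_ge0 m (a : tensor R d) : 0 <= level_dot m a a.
Proof. by apply: sumr_ge0 => w _; rewrite -expr2 sqr_ge0. Qed.

Lemma coord_le_level_norm (a : tensor R d) w :
  `|a w| <= level_norm (size w) a.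
Proof.
rewrite -sqrtr_sqr; apply: ler_wsqrtr; rewrite /level_dot.
rewrite (bigD1 (in_tuple w))//= -expr2 lerDl sumr_ge0// => v _.
by rewrite -expr2 sqr_ge0.
Qed.

(** Continuity on the simplex and vanishing on the diagonal, uniformly over the
    compact set of starting points. *)
Lemma near_diagonal p S w s t (eps : R) :
  (forall N, finite_pvar_functional p N S) -> w != [::] ->
  0 <= s -> 0 < eps ->
  \forall eta \near 0^'+, forall u v, s <= u <= t -> u <= v <= u + eta ->
    `|S u v w| < eps.
Proof.
move=> SF w0 s0 eps0.
have SM N : Defs.multiplicative N S by case: (SF N).
have [_ /(_ w (leqnn _)) cS _] := SF (size w).
have /compact_near_coveringP cpt := @segment_compact R s t.
have := cpt R (0^'+)
  (fun e u => 0 <= u -> forall v, u <= v <= u + e -> `|S u v w| < eps) _ _.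
case.
  move=> x; rewrite /= in_itv/= => /andP[sx xt].
  have x0 := le_trans s0 sx.
  have xs : simplex (x, x) by split => /=.
  have H0 : \forall z \near within simplex (nbhs (x, x)),
      `|S x x w - S z.1 z.2 w| < eps.
    by move/subspace_continuousP : cS => /(_ (x, x) xs)/cvgrPdist_lt/(_ eps eps0).
  move: H0; rewrite multiplicative_diag// => -[[U1 U2]] /= [].
  move=> /nbhs_ballP[r1 /= r10 H1] /nbhs_ballP[r2 /= r20 H2] H.
  have r1' : 0 < r2 / 2 by rewrite divr_gt0.
  near=> z e => z0 v /andP[zv vz].
  have xz1 : `|x - z| < r1 by near: z; apply/nbhs_ballP; exists r1.
  have xz2 : `|x - z| < r2 / 2 by near: z; apply/nbhs_ballP; exists (r2 / 2).
  have er : e < r2 / 2 by near: e; apply: nbhs_right_lt.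
  have := H (z, v); rewrite /= sub0r normrN; apply; last by split.
  split => /=; first exact: H1.
  apply: H2; rewrite /ball/= -(subrK z x) -addrA (splitr r2).
  apply: le_lt_trans (ler_normD _ _) _; rewrite ltrD//.
  by move: zv vz => /= zv vz; rewrite ltr_norml; apply/andP; split; lra.
move=> r /= r0 H; exists r => // e /= er e0 u v /andP[su ut] uv.
by apply: (H e er e0 u) => //=; rewrite ?in_itv/= ?su//; exact: le_trans su.
Unshelve. all: by end_near. Qed.

(** With [q = p / |w| < 1], each term is the product of its power [1 - q], small
    near the diagonal, and of its power [q], whose sums are bounded by the
    variation of order [q]. *)
Lemma sum_high_level_cvg0 p S w s t : 1 <= p ->
  (forall N, finite_pvar_functional p N S) -> p < (size w)%:R ->
  0 <= s -> s <= t ->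
  (\sum_(0 <= j < k.+1) S (unif_time s t k.+1 j) (unif_time s t k.+1 j.+1) w)
    @[k --> \oo] --> (0 : R).
Proof.
move=> p1 SF pw s0 st.
have SM N : Defs.multiplicative N S by case: (SF N).
have w0 : w != [::].
  by apply: contraTneq pw => ->; rewrite -leNgt (le_trans _ p1).
have m0 : (0 : R) < (size w)%:R by apply: lt_trans pw; lra.
move: st; rewrite le_eqVlt => /predU1P[<-|st].
  rewrite (_ : (fun k => _) = fun=> 0); first exact: cvg_cst.
  apply/funext => k; rewrite big1// => j _.
  by rewrite !unif_timexx multiplicative_diag.
set q := p / (size w)%:R.
have q0 : 0 < q by rewrite divr_gt0//; lra.
have q1 : 0 < 1 - q by rewrite subr_gt0 ltr_pdivrMr// mul1r.
have t0 : 0 < t := le_lt_trans s0 st.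
have [_ _ /(_ t (size w) t0)] := SF (size w).
have sw : (0 < size w)%N by rewrite lt0n size_eq0.
rewrite sw leqnn => /(_ isT); rewrite -/q.
set F := (fun u v : R => _).
have F0 u v : (0 <= F u v)%E by rewrite lee_fin powR_ge0.
have F1 : (partition_sup F s t <= partition_sup F 0%R t)%E.
  by apply: partition_sup_sub => //; exact: ltW.
have := partition_sup_ge0 F0 (ltW t0).
case: (partition_sup F 0%R t) F1 => // B FB; rewrite lee_fin => B0 _.
have B1 : 0 < B + 1 by rewrite ltr_wpDl.
apply/cvgrPdist_lt => eps eps0.
(* Where [|a| <= e], one has [|a| <= (eps / (B + 1)) |a|^q]. *)
set e := (eps / (B + 1)) `^ (1 - q)^-1.
have e0 : 0 < e by apply: powR_gt0; rewrite divr_gt0.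
have eE : e `^ (1 - q) = eps / (B + 1).
  by rewrite -powRrM mulVf ?gt_eqF// powRr1// ltW// divr_gt0.
have := @near_diagonal p S w s t e SF w0 s0 e0.
move=> [r /= r0 Hr].
have r2 : 0 < r / 2 by rewrite divr_gt0.
have := unif_partition_mesh s t r2; apply: filterS => k mk.
rewrite sub0r normrN; apply: le_lt_trans (ler_norm_sum _ _ _) _.
apply: (@le_lt_trans _ _ (\sum_(0 <= j < k.+1) eps / (B + 1) *
    level_norm (size w) (S (unif_time s t k.+1 j) (unif_time s t k.+1 j.+1)) `^ q)).
  apply: ler_sum_nat => j /andP[_ jk].
  set a := S _ _ w.
  apply: (@le_trans _ _ (`|a| `^ (1 - q) * `|a| `^ q)).
    by rewrite -powRD ?subrK ?powRr1// oner_eq0.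
  rewrite -eE; apply: ler_pM; rewrite ?powR_ge0//.
    apply: ge0_ler_powR; rewrite ?nnegrE ?(ltW q1) ?(ltW e0)//; apply: ltW.
    apply: (Hr (r / 2)) => //=.
    - by rewrite sub0r normrN gtr0_norm// ltr_pdivrMr// ltr_pMr// ltr1n.
    - by rewrite (unif_time_ge _ _ (ltW st)) (unif_time_leb (ltW st) (ltnW jk)).
    - by rewrite (unif_time_le _ (ltW st))//= -lerBlDl unif_time_step ltW.
  apply: ge0_ler_powR; rewrite ?nnegrE ?(ltW q0) ?sqrtr_ge0//.
  exact: coord_le_level_norm.
rewrite -mulr_sumr.
have : \sum_(0 <= j < k.+1)
    level_norm (size w) (S (unif_time s t k.+1 j) (unif_time s t k.+1 j.+1)) `^ q <= B.
  rewrite -lee_fin -sumEFin; apply: le_trans FB.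
  exact: (@partition_sup_unif_time _ F s t k.+1 st).
move=> /(ler_wpM2l (ltW (divr_gt0 eps0 B1))) /le_lt_trans; apply.
by rewrite mulrAC ltr_pdivrMr// ltr_pM2l// ltrDl.
Qed.

(** In the telescoped identity of Chen the terms in [w] itself vanish in the
    limit; the remaining ones are polynomials in components of lower degree. *)
Lemma lyons_extension_cvg p S w s t : 1 <= p ->
  (forall N, finite_pvar_functional p N S) -> p < (size w)%:R ->
  0 <= s -> s <= t ->
  (\sum_(0 <= j < k.+1)
     chen_middle S w s (unif_time s t k.+1 j) (unif_time s t k.+1 j.+1))
    @[k --> \oo] --> S s t w.
Proof.
move=> p1 SF pw s0 st.
have SM N : Defs.multiplicative N S by case: (SF N).
have w0 : w != [::].
  by apply: contraTneq pw => ->; rewrite -leNgt (le_trans _ p1).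
rewrite (_ : (fun k => _) = (fun k => S s t w -
    \sum_(0 <= j < k.+1) S (unif_time s t k.+1 j) (unif_time s t k.+1 j.+1) w)); last first.
  by apply/funext => k; rewrite {1}(sum_chen_middle SM w0 s0 st (ltn0Sn k)) addrK.
rewrite -[X in _ --> X]subr0; apply: cvgB; first exact: cvg_cst.
exact: sum_high_level_cvg0 p1 SF pw s0 st.
Qed.

End lyons_extensions.

(** * Bounds by the p-variation norm *)

Section pvariation_bounds.
Context {R : realType} {d : nat}.
Implicit Types (A S : R -> R -> tensor R d) (w : seq 'I_d) (p : R).

Lemma path_length_ge0 (x : R -> 'rV[R]_d) a b : a <= b ->
  (0 <= path_length x a b)%E.
Proof.
by move=> ab; apply: partition_sup_ge0 => // u v; rewrite lee_fin euclid_norm_ge0.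
Qed.

Lemma cc_norm_ge0 N (g : tensor R d) : (0 <= cc_norm N g)%E.
Proof.
by apply: le_ereal_inf_tmp => _ [x _ <-]; exact: path_length_ge0.
Qed.

(** An iterated integral of order [m] along a path of length [L] is at most
    [L ^ m]. *)
Lemma coord_le_cc_norm N (g : tensor R d) w : (0 < size w <= N)%N ->
  ((`|g w| `^ (size w)%:R^-1)%:E <= cc_norm N g)%E.
Proof.
move=> /andP[w0 wN]; apply: le_ereal_inf_tmp => _ [x [[_ xL] xg] <-].
have := path_length_ge0 x (@ler01 R).
case: (path_length x 0 1) xL (@bv_signature_le _ _ x 0 1) => [L| |]// _ H.
rewrite !lee_fin => L0; rewrite -(xg _ wN) /bv_signature.
have sw : ((size w)%:R : R) != 0 by rewrite pnatr_eq0 -lt0n.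
have := H L (rev w) 1 (lexx _); rewrite size_rev ler01 lexx => /(_ isT) {}H.
apply: (@le_trans _ _ ((L ^+ size w) `^ (size w)%:R^-1)).
  by apply: ge0_ler_powR; rewrite ?nnegrE ?invr_ge0 ?exprn_ge0.
by rewrite -powR_mulrn// -powRrM divff// powRr1.
Qed.

(** The p-th power of the p-variation norm, which unlike the norm itself is
    superadditive. *)
Definition pvar_control p A (s t : R) : R :=
  fine (partition_sup (fun u v => cc_norm (Num.truncn p) (A u v) `^ p)%E s t).

Section geometric.
Variables (p : R) (A : R -> R -> tensor R d).
Hypotheses (p1 : 1 <= p) (Ag : geometric_rough_path p A).

Let F u v := (cc_norm (Num.truncn p) (A u v) `^ p)%E.
Let F0 u v : (0 <= F u v)%E. Proof. exact: poweR_ge0. Qed.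
Let p0 : 0 < p. Proof. by apply: lt_le_trans p1. Qed.

Lemma pvar_control_fin s t : 0 <= s -> s <= t ->
  partition_sup F s t = (pvar_control p A s t)%:E.
Proof.
move=> s0 st; rewrite /pvar_control fineK// ge0_fin_numE ?partition_sup_ge0//.
have t1 : 0 < t + 1 by rewrite ltr_wpDl// (le_trans s0).
apply: (@le_lt_trans _ _ (partition_sup F 0 (t + 1))).
  by apply: partition_sup_sub => //; rewrite lerDl.
have [_ _ /(_ _ t1) H _] := Ag.
by apply: lty_poweRy H; rewrite invr_eq0 gt_eqF.
Qed.

Lemma pvar_normE s t : 0 <= s -> s <= t ->
  pvar_norm p A s t = (pvar_control p A s t `^ p^-1)%:E.
Proof. by move=> s0 st; rewrite /pvar_norm -/F pvar_control_fin. Qed.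

Lemma superadditive_pvar_control : superadditive (pvar_control p A).
Proof.
split=> [s u s0 su|s u v s0 su uv].
  by rewrite -lee_fin -pvar_control_fin// partition_sup_ge0.
rewrite -lee_fin EFinD -!pvar_control_fin ?(le_trans s0)// ?(le_trans su)//.
by apply: partition_sup_superadditive.
Qed.

(** The partition with the single interval [[s, t]] already bounds the
    Carnot-Caratheodory norm by the p-variation norm. *)
Lemma rough_path_bound S s t w : lyons_extension p A S ->
  0 <= s -> s <= t -> (0 < size w <= Num.truncn p)%N ->
  `|S s t w| <= pvar_control p A s t `^ ((size w)%:R / p).
Proof.
move=> [SF SA] s0 st /andP[w0 wp].
move: st; rewrite le_eqVlt => /predU1P[<-|st].
  rewrite (@multiplicative_diag _ _ S w s)//; last by rewrite -size_eq0 -lt0n.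
    by rewrite normr0 powR_ge0.
  by move=> N; case: (SF N).
rewrite SA ?(ltW st)//.
have sw : ((size w)%:R : R) != 0 by rewrite pnatr_eq0 -lt0n.
have H1 : (`|A s t w| `^ (size w)%:R^-1) `^ p <= pvar_control p A s t.
  rewrite -lee_fin -pvar_control_fin ?(ltW st)//.
  apply: le_trans (partition_sup1 F st).
  rewrite -poweR_EFin; apply: gt0_ler_poweR; rewrite ?(ltW p0)//.
  - by rewrite in_itv/= leey andbT lee_fin powR_ge0.
  - by rewrite in_itv/= leey andbT cc_norm_ge0.
  - by apply: coord_le_cc_norm; rewrite w0.
have q0 : 0 <= (size w)%:R / p by rewrite divr_ge0// ltW.
have om0 : 0 <= pvar_control p A s t.
  by have [om0 _] := superadditive_pvar_control; rewrite om0// ltW.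
have := ge0_ler_powR q0 _ _ H1; rewrite !nnegrE powR_ge0 => /(_ isT om0).
rewrite -!powRrM (_ : _ * _ = 1) ?powRr1//.
by field; rewrite sw gt_eqF.
Qed.

End geometric.

Lemma powR_mul_le (x y z a b : R) : 0 <= x <= z -> 0 <= y <= z ->
  0 <= a -> 0 <= b -> 0 < a + b -> x `^ a * y `^ b <= z `^ (a + b).
Proof.
move=> /andP[x0 xz] /andP[y0 yz] a0 b0 ab.
have z0 := le_trans x0 xz.
rewrite powRD ?(gt_eqF ab)//.
by apply: ler_pM; [exact: powR_ge0|exact: powR_ge0| |];
  apply: ge0_ler_powR; rewrite ?nnegrE.
Qed.

(** Young's argument lifts the bound from the degrees below to degree
    [n > p], since the exponent [n / p] exceeds 1. *)
Lemma lyons_extension_bound p (n : nat) : 1 <= p ->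
  exists2 C : R, 0 <= C & forall A S s t w,
    geometric_rough_path p A -> lyons_extension p A S ->
    0 <= s -> s <= t -> (size w <= n)%N ->
    `|S s t w| <= C * pvar_control p A s t `^ ((size w)%:R / p).
Proof.
move=> p1; have p0 : 0 < p by apply: lt_le_trans p1.
elim: n => [|n [C C0 IH]].
  exists 1 => // A S s t w _ [SF _] s0 st; rewrite leqn0 size_eq0 => /eqP ->.
  have [[S1 _] _ _] := SF 0%N.
  by rewrite S1//= mul0r powRr0 normr1 mulr1.
set th := n.+1%:R / p.
pose D := n.+1%:R * (C * C); pose K := 2 `^ th * (1 + (th - 1)^-1).
(* The three summands serve the degrees below [n + 1], degree [n + 1] when it is
   at most [p], and degree [n + 1] when it exceeds [p]. *)
exists (C + 1 + `|D * K|) => [|A S s t w Ag SA s0 st].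
  by rewrite !addr_ge0.
have omS := superadditive_pvar_control p1 Ag.
have [om0 omD] := omS.
rewrite leq_eqVlt => /predU1P[wn|]; last first.
  rewrite ltnS => wn; apply: le_trans (IH A S s t w Ag SA s0 st wn) _.
  by rewrite ler_wpM2r ?powR_ge0// -addrA lerDl addr_ge0.
have [SF _] := SA; have SM N : Defs.multiplicative N S by case: (SF N).
rewrite wn; case: (leqP n.+1 (Num.truncn p)) => np.
  apply: le_trans (rough_path_bound p1 Ag SA s0 st _) _; first by rewrite wn.
  rewrite wn -[leLHS]mul1r ler_wpM2r ?powR_ge0// addrAC lerDr addr_ge0//.
have pn : p < (size w)%:R.
  by rewrite wn; apply: lt_le_trans (truncnS_gt _) _; rewrite ler_nat.
have th1 : 1 < th by rewrite /th -wn ltr_pdivlMr// mul1r.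
have D0 : 0 <= D by rewrite !mulr_ge0.
have HF a u b : 0 <= a -> a <= u -> u <= b ->
    `|S a b w - S a u w - S u b w| <= D * pvar_control p A a b `^ th.
  move=> a0 au ub.
  rewrite (@chenE _ _ (size w) S w a u b)//; last by rewrite wn leqnn.
  rewrite (_ : _ - _ - _ = chen_middle S w a u b); last by ring.
  apply: le_trans (ler_norm_sum _ _ _) _.
  apply: (@le_trans _ _
    (\sum_(1 <= i < size w) C * C * pvar_control p A a b `^ th)); last first.
    rewrite sumr_const_nat wn -mulr_natl mulrA ler_wpM2r ?powR_ge0//.
    by rewrite ler_wpM2r ?mulr_ge0// ler_nat leq_subr.
  apply: ler_sum_nat => i /andP[i1 iw]; rewrite normrM.
  have si : size (take i w) = i by rewrite size_take iw.
  have sd : size (drop i w) = (size w - i)%N by rewrite size_drop.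
  have B1 := IH A S a u (take i w) Ag SA a0 au.
  have B2 := IH A S u b (drop i w) Ag SA (le_trans a0 au) ub.
  have i_n : (i <= n)%N by rewrite -ltnS -wn.
  have wi_n : (size w - i <= n)%N by rewrite wn leq_subLR addnC -addn1 leq_add2l.
  rewrite si in B1; rewrite sd in B2.
  have {}B1 := B1 i_n; have {}B2 := B2 wi_n.
  apply: le_trans (ler_pM (normr_ge0 _) (normr_ge0 _) B1 B2) _.
  have omab : 0 <= pvar_control p A a b by rewrite om0// (le_trans au).
  rewrite mulrACA ler_wpM2l ?mulr_ge0//.
  have E : th = i%:R / p + (size w - i)%:R / p.
    by rewrite -mulrDl -natrD subnKC ?wn// -wn ltnW.
  have P (m : nat) : (0 : R) <= m%:R / p by rewrite divr_ge0// ltW.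
  have om1 : 0 <= pvar_control p A a u <= pvar_control p A a b.
    by rewrite om0// (superadditive_le omS a0 (lexx a) au ub).
  have om2 : 0 <= pvar_control p A u b <= pvar_control p A a b.
    by rewrite om0 ?(le_trans a0 au)// (superadditive_le omS a0 au ub (lexx b)).
  rewrite E; apply: powR_mul_le => //.
  by rewrite -E; exact: lt_trans ltr01 th1.
have H k := @young_partition_bound _ (fun a b => S a b w) _ D th omS th1 D0 HF k
  (unif_time s t k.+1).
have {}H k : `|S s t w - \sum_(0 <= j < k.+1)
    S (unif_time s t k.+1 j) (unif_time s t k.+1 j.+1) w| <=
    D * K * pvar_control p A s t `^ th.
  have := H k; rewrite unif_time0 unif_timen//; apply => // i j; exact: unif_time_le.
have L : `|S s t w - \sum_(0 <= j < k.+1)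
    S (unif_time s t k.+1 j) (unif_time s t k.+1 j.+1) w| @[k --> \oo] --> `|S s t w - 0|.
  apply: cvg_norm; apply: cvgB; first exact: cvg_cst.
  exact: sum_high_level_cvg0 p1 SF pn s0 st.
apply: (@le_trans _ _ (D * K * pvar_control p A s t `^ th)).
  rewrite subr0 in L; rewrite -(cvg_lim _ L)//.
  apply: limr_le; first by apply/cvg_ex; exists `|S s t w|.
  by near=> k; exact: H.
rewrite ler_wpM2r ?powR_ge0// (le_trans (ler_norm _))// lerDr addr_ge0//.
Unshelve. all: by end_near. Qed.

End pvariation_bounds.

(** * Cylinder sigma-algebras and laws *)

Section cylinders.
Context {R : realType} {I : Type}.
Implicit Types (J : set I).

Definition cylinders J : set (set (I -> R)) :=
  [set E | exists (n : nat) (j : 'I_n -> I) (B : 'I_n -> set R),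
     (forall k, J (j k) /\ measurable (B k)) /\
     E = [set a | forall k, B k (a (j k))]].

(** Only the coordinates in [J] are measurable: the law of a rough path is
    controlled only on the simplex and up to a certain degree. *)
Definition families J := g_sigma_algebraType (cylinders J).

Lemma cylinders_setI J : setI_closed (cylinders J).
Proof.
move=> _ _ [n1 [j1 [B1 [H1 ->]]]] [n2 [j2 [B2 [H2 ->]]]].
exists (n1 + n2)%N.
exists (fun k => match fintype.split k with inl a => j1 a | inr b => j2 b end).
exists (fun k => match fintype.split k with inl a => B1 a | inr b => B2 b end).
split=> [k|]; first by case: fintype.split.
apply/seteqP; split => a /=; first by move=> [A1 A2] k; case: fintype.split.
move=> A; split=> k.
  by have := A (unsplit (inl k)); rewrite unsplitK.
by have := A (unsplit (inr k)); rewrite unsplitK.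
Qed.

Lemma cylindersT J : cylinders J setT.
Proof.
have j0 (k : 'I_0) : I by case: k.
exists 0%N; exists j0; exists (fun k => setT); split=> [[]//|].
by apply/seteqP; split.
Qed.

Lemma coordinate_measurable J j : J j ->
  measurable_fun setT (fun a : families J => a j).
Proof.
move=> Jj _ B mB; rewrite setTI; apply: sub_sigma_algebra.
exists 1%N; exists (fun=> j); exists (fun=> B); split => //.
by apply/seteqP; split => [a /= ? ?|a /= /(_ ord0)].
Qed.

(** Intersections of coordinate events are events of every sigma-algebra that
    contains the latter. *)
Lemma cylinder_preimage (Omega : pointedType) (G : set (set Omega)) J
    (U : Omega -> I -> R) :
  sigma_algebra setT G ->
  (forall j B, J j -> measurable B -> G ((fun o => U o j) @^-1` B)) ->
  forall E, <<s cylinders J >> E -> G (U @^-1` E).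
Proof.
move=> sG GU.
have GE : @measurable _ (g_sigma_algebraType G) = G.
  exact: measurable_g_measurableTypeE.
apply: smallest_sub.
  split => /=.
  - by rewrite preimage_set0 -GE; exact: measurable0.
  - move=> A GA; rewrite setTD preimage_setC -GE.
    by apply: measurableC; rewrite GE.
  - move=> A GA; rewrite preimage_bigcup -GE.
    by apply: bigcupT_measurable => n; rewrite GE.
move=> _ [n [j [B [H ->]]]] /=.
rewrite (_ : _ @^-1` _ = \bigcap_(k in [set: 'I_n]) ((fun o => U o (j k)) @^-1` B k)).
  rewrite -GE; apply: fin_bigcap_measurable => // k _; rewrite GE.
  by have [] := H k; exact: GU.
by apply/seteqP; split => o /= Ho k; [move=> _; exact: Ho|exact: Ho].
Qed.

End cylinders.

Section laws.
Context {R : realType} {disp : measure_display} {Omega : measurableType disp}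
        (P : probability Omega R) {I : Type} (J : set I).
Implicit Types U V : Omega -> I -> R.

Lemma family_measurable U :
  (forall j, J j -> measurable_fun setT (fun o => U o j)) ->
  measurable_fun setT (U : Omega -> families J).
Proof.
move=> mU _ E mE; rewrite setTI.
apply: (@cylinder_preimage _ _ Omega measurable J U) mE.
  exact: sigma_algebra_measurable.
by move=> j B Jj mB; rewrite -[X in measurable X]setTI; exact: mU.
Qed.

(** Cylinders form a pi-system, so equal finite-dimensional distributions extend
    to the generated sigma-algebra. *)
Lemma same_law_measure U V :
  (forall j, J j -> measurable_fun setT (fun o => U o j)) ->
  (forall j, J j -> measurable_fun setT (fun o => V o j)) ->
  same_law P J (fun j o => U o j) (fun j o => V o j) ->
  forall E, <<s cylinders J >> E -> P (U @^-1` E) = P (V @^-1` E).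
Proof.
move=> mU mV UV E mE.
pose fU : {mfun Omega >-> families J} :=
  HB.pack U (isMeasurableFun.Build _ _ _ _ (U : Omega -> families J)
               (family_measurable mU)).
pose fV : {mfun Omega >-> families J} :=
  HB.pack V (isMeasurableFun.Build _ _ _ _ (V : Omega -> families J)
               (family_measurable mV)).
have := @measure_unique _ R (families J) (cylinders J) (fun=> setT) erefl
  (@cylinders_setI _ _ J) (fun=> @cylindersT _ _ J) _
  (pushforward P fU) (pushforward P fV).
apply => //.
- by apply/seteqP; split => // a _; exists 0%N.
- move=> _ [n [j [B [H ->]]]]; exact: UV.
- by move=> k; change (P setT < +oo)%E; rewrite probability_setT ltry.
Qed.

Lemma same_law_expectation U V (F : families J -> R) :
  (forall j, J j -> measurable_fun setT (fun o => U o j)) ->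
  (forall j, J j -> measurable_fun setT (fun o => V o j)) ->
  same_law P J (fun j o => U o j) (fun j o => V o j) ->
  measurable_fun setT F ->
  (\int[P]_o (F (U o))%:E = \int[P]_o (F (V o))%:E)%E.
Proof.
move=> mU mV UV mF.
have nonneg (f : families J -> \bar R) : measurable_fun [set: families J] f ->
    (forall a, 0 <= f a)%E -> (\int[P]_o f (U o) = \int[P]_o f (V o))%E.
  move=> mf f0.
  have := @ge0_integral_pushforward _ _ Omega (families J) R U
    (family_measurable mU) P setT f measurableT mf (fun a _ => f0 a).
  rewrite preimage_setT => <-.
  have := @ge0_integral_pushforward _ _ Omega (families J) R V
    (family_measurable mV) P setT f measurableT mf (fun a _ => f0 a).
  rewrite preimage_setT => <-.
  apply: (@eq_measure_integral _ (families J) R setT _ _ f).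
  - exact: family_measurable.
  - exact: family_measurable.
  - by move=> hV hU A mA _; exact: same_law_measure mA.
have mFE : measurable_fun setT (fun a => (F a)%:E) by apply/measurable_EFinP.
rewrite integralE [RHS]integralE; congr (_ - _)%E.
- have H := nonneg _ (measurable_funepos mFE) (fun a => funepos_ge0 _ _).
  by apply: etrans (etrans _ H) _; apply: eq_integral => o _; rewrite !funeposE.
- have H := nonneg _ (measurable_funeneg mFE) (fun a => funeneg_ge0 _ _).
  by apply: etrans (etrans _ H) _; apply: eq_integral => o _; rewrite !funenegE.
Qed.

End laws.

(** * Signatures as measurable functionals *)

Section limit_functionals.
Context {R : realType} {disp : measure_display} {T : measurableType disp}.

Lemma measurable_limsup (u : nat -> T -> R) :
  (forall k, measurable_fun setT (u k)) ->
  measurable_fun setT (fun x => fine (limn_esup (fun k => (u k x)%:E))).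
Proof.
move=> mu; apply: measurableT_comp; first exact: fine_measurable.
by apply: measurable_fun_limn_esup => k; exact/measurable_EFinP.
Qed.

Lemma fine_limsup_cvg (u : nat -> R) (l : R) : u k @[k --> \oo] --> l ->
  fine (limn_esup (fun k => (u k)%:E)) = l.
Proof.
move=> ul; have H : (u k)%:E @[k --> \oo] --> l%:E by apply: cvg_EFin => //; exact: nearW.
rewrite is_cvg_limn_esupE; last by apply/cvg_ex; exists l%:E.
by rewrite (cvg_lim _ H).
Qed.

Lemma measurable_sum_nat (m n : nat) (f : nat -> T -> R) :
  (forall j, (m <= j < n)%N -> measurable_fun setT (f j)) ->
  measurable_fun setT (fun x => \sum_(m <= j < n) f j x).
Proof.
move=> mf; pose g j := if (m <= j < n)%N then f j else fun=> 0.
rewrite (_ : (fun x => _) = fun x => \sum_(j <- index_iota m n) g j x).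
  apply: measurable_sum => j; rewrite /g; case: ifPn => [/mf//|_].
  exact: measurable_cst.
by apply/funext => x; apply: eq_big_nat => j jn; rewrite /g jn.
Qed.

End limit_functionals.

Section signature_functionals.
Context {R : realType} {d : nat}.
Implicit Types (A S : R -> R -> tensor R d) (w : seq 'I_d).

Definition increment : Type := ((R * R) * seq 'I_d)%type.

Definition increments_within (q : nat) (s t : R) : set increment :=
  [set z | [/\ s <= z.1.1, z.1.1 <= z.1.2, z.1.2 <= t & (size z.2 <= q)%N]].

(** The Lyons extension as a function of the components up to degree [q] of the
    rough path; [n] bounds the degree of the components that are computed.
    A limit superior stands for the limit, in order to be defined everywhere. *)
Fixpoint lyons_functional (q n : nat) (a : increment -> R) (s t : R)
    : tensor R d :=
  fun w => if n is n'.+1 then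
    if (size w <= q)%N then a ((s, t), w) else
    fine (limn_esup (fun k => (\sum_(0 <= j < k.+1)
      chen_middle (lyons_functional q n' a) w s
        (unif_time s t k.+1 j) (unif_time s t k.+1 j.+1))%:E))
  else a ((s, t), w).

Lemma lyons_functional_measurable q n (J : set increment) s t w : s <= t ->
  increments_within q s t `<=` J -> (size w <= n)%N ->
  measurable_fun setT (fun a : @families R increment J => lyons_functional q n a s t w).
Proof.
have base s' t' w' : s' <= t' -> increments_within q s' t' `<=` J ->
    (size w' <= q)%N -> measurable_fun setT (fun a : @families R increment J => a ((s', t'), w')).
  by move=> st' sub wq; apply: coordinate_measurable; apply: sub; split => /=.
elim: n s t w => [|n IH] s t w st sub /=.
  by rewrite leqn0 => w0; apply: base => //; rewrite (eqP w0).
case: (boolP (size w <= q)%N) => [wq _|wq wn]; first exact: base.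
apply: measurable_limsup => k; apply: measurable_sum_nat => j /andP[_ jk].
apply: measurable_sum_nat => i /andP[i0 iw].
have sj : s <= unif_time s t k.+1 j by exact: unif_time_ge.
have jt : unif_time s t k.+1 j.+1 <= t by exact: unif_time_leb.
have jj : unif_time s t k.+1 j <= unif_time s t k.+1 j.+1 by exact: unif_time_le.
apply: measurable_funM; apply: IH => //.
- apply: subset_trans sub => -[[u v] w'] [/= su uv vj w'q]; split => //=.
  by rewrite (le_trans vj)// (le_trans jj).
- by rewrite size_take iw; lia.
- apply: subset_trans sub => -[[u v] w'] [/= su uv vj w'q]; split => //=.
    exact: le_trans su.
  exact: le_trans jt.
- by rewrite size_drop; lia.
Qed.

(** The functional is evaluated on a rough path restarted at [tau]. *)
Lemma lyons_functionalE p A S (tau : R) (a : increment -> R) :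
  1 <= p -> lyons_extension p A S -> 0 <= tau ->
  (forall s t w, 0 <= s -> s <= t -> (size w <= Num.truncn p)%N ->
     a ((s, t), w) = A (tau + s) (tau + t) w) ->
  forall n s t w, 0 <= s -> s <= t -> (size w <= n)%N ->
    lyons_functional (Num.truncn p) n a s t w = S (tau + s) (tau + t) w.
Proof.
move=> p1 [SF SA] tau0 aA.
have base s t w : 0 <= s -> s <= t -> (size w <= Num.truncn p)%N ->
    a ((s, t), w) = S (tau + s) (tau + t) w.
  by move=> s0 st wp; rewrite SA ?lerD2l ?addr_ge0// aA.
elim=> [|n IH] s t w s0 st /=.
  by rewrite leqn0 => w0; apply: base => //; rewrite (eqP w0).
case: ifPn => [wq _|]; first exact: base.
rewrite -ltnNge => wq wn; apply: fine_limsup_cvg.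
have pw : p < (size w)%:R.
  by apply: lt_le_trans (truncnS_gt _) _; rewrite ler_nat.
have := @lyons_extension_cvg _ _ p S w (tau + s) (tau + t) p1 SF pw
  (addr_ge0 tau0 s0).
rewrite lerD2l => /(_ st).
rewrite (_ : (fun k => _) = (fun k => \sum_(0 <= j < k.+1)
   chen_middle (lyons_functional (Num.truncn p) n a) w s (unif_time s t k.+1 j)
     (unif_time s t k.+1 j.+1)))//.
apply/funext => k; apply: eq_big_nat => j /andP[_ jk].
apply: eq_big_nat => i /andP[i0 iw]; rewrite !unif_time_shift.
have sj : s <= unif_time s t k.+1 j by exact: unif_time_ge.
rewrite !IH//.
- exact: le_trans sj.
- exact: unif_time_le.
- by rewrite size_drop; lia.
- by rewrite size_take iw; lia.
Qed.

Definition increments (q : nat) : set increment :=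
  [set z | simplex z.1 /\ (size z.2 <= q)%N].

Lemma increments_within_sub q s t : 0 <= s ->
  increments_within q s t `<=` increments q.
Proof.
by move=> s0 [[u v] w] [/= su uv _ wq]; split => //; split => //=; exact: le_trans su.
Qed.

Definition increment_path (a : increment -> R) (u : R) : 'rV[R]_d :=
  \row_i a ((0, u), [:: i]).

(** The signature of the interpolation as a function of the increments of the
    path. *)
Fixpoint interpolation_functional (delta : R) (n : nat) w
    (a : increment -> R) (u : R) : R :=
  if w is i :: w' then
    let y v := interpolation (increment_path a) 0 delta n v ord0 i in
    fine (limn_esup (fun k => (\sum_(0 <= j < k.+1)
      interpolation_functional delta n w' a (unif_time 0 u k.+1 j) *
        (y (unif_time 0 u k.+1 j.+1) - y (unif_time 0 u k.+1 j)))%:E))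
  else 1.

Lemma interpolation_functional_measurable delta n q w u :
  0 <= delta -> (1 <= q)%N ->
  measurable_fun setT (fun a : @families R increment (increments q) =>
    interpolation_functional delta n w a u).
Proof.
move=> d0 q1; elim: w u => [|i w IH] u /=; first exact: measurable_cst.
have my v : measurable_fun setT (fun a : @families R increment (increments q) =>
    interpolation (increment_path a) 0 delta n v ord0 i).
  have ma (z : R) : 0 <= z -> measurable_fun setT
      (fun a : @families R increment (increments q) => a ((0, z), [:: i])).
    by move=> z0; apply: coordinate_measurable; split => //; split => /=.
  rewrite /interpolation; set j := minn _ _.
  have t0 : 0 <= 0 + j%:R * delta by rewrite add0r mulr_ge0.
  set t := 0 + j%:R * delta in t0 *.
  rewrite (_ : (fun a => _) = (fun a : increment -> R => a ((0, t), [:: i]) +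
      (v - t) / delta * (a ((0, t + delta), [:: i]) - a ((0, t), [:: i])))).
    apply: measurable_funD; first exact: ma.
    apply: measurable_funM; first exact: measurable_cst.
    by apply: measurable_funB; apply: ma => //; exact: addr_ge0.
  by apply/funext => a; rewrite !mxE.
apply: measurable_limsup => k; apply: measurable_sum_nat => j _.
by apply: measurable_funM; [exact: IH|exact: measurable_funB].
Qed.

Lemma interpolation_functionalE (x : R -> 'rV[R]_d) (tau delta : R) n
    (a : increment -> R) w u :
  (2 <= n)%N -> 0 < delta ->
  (forall v i, 0 <= v -> a ((0, v), [:: i]) = x (tau + v) ord0 i - x tau ord0 i) ->
  0 <= u <= n.-1%:R * delta ->
  interpolation_functional delta n w a u =
    bv_signature_rev (interpolation x tau delta n) tau w (tau + u).
Proof.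
move=> n2 d0 ax; elim: w u => [//|i w IH] u /andP[u0 un].
have yE v : interpolation (increment_path a) 0 delta n v ord0 i =
    interpolation x tau delta n (tau + v) ord0 i - x tau ord0 i.
  rewrite /interpolation (_ : tau + v - tau = v); last by ring.
  rewrite subr0 add0r; set j := minn _ _.
  have j0 : 0 <= j%:R * delta by rewrite mulr_ge0// ltW.
  have jd : 0 <= j%:R * delta + delta by rewrite addr_ge0// ltW.
  rewrite !mxE !ax// addrA.
  rewrite (_ : tau + v - (tau + j%:R * delta) = v - j%:R * delta); last by ring.
  by ring.
rewrite [LHS]/=; apply: fine_limsup_cvg.
have un' : tau <= tau + u <= knot tau delta n.-1 by rewrite /knot lerDl u0 lerD2l.
have := @bv_signature_interpolation_cvg R d x tau delta n i w (tau + u) n2 d0 un'.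
move=> /=; set S := (fun k => _) => HS; set S' := (fun k => _).
rewrite (_ : S' = S)//; apply/funext => k; apply: eq_big_nat => j /andP[_ jk].
have uptE l : unif_time tau (tau + u) k.+1 l = tau + unif_time 0 u k.+1 l.
  by rewrite -unif_time_shift addr0.
rewrite !uptE !yE IH; last first.
  by rewrite unif_time_ge// (le_trans _ un)// unif_time_leb// ltnW.
by congr (_ * _); ring.
Qed.

End signature_functionals.

(** * Integrals of nonnegative functions *)

Section nonnegative_integrals.
Context {R : realType} {disp : measure_display} {T : measurableType disp}
        (mu : {measure set T -> \bar R}).

(** The integral of a nonnegative function is the supremum of the integrals of
    the simple functions below it, hence monotone on arbitrary functions. It is
    applied to the p-variation norm, a supremum over uncountably many
    partitions. *)
Lemma ge0_le_integral_nonmeasurable (f g : T -> \bar R) :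
  (forall x, 0 <= f x)%E -> (forall x, f x <= g x)%E ->
  (\int[mu]_x f x <= \int[mu]_x g x)%E.
Proof.
move=> f0 fg; rewrite !ge0_integralTE//; last by move=> x; exact: le_trans (fg x).
apply: ereal_sup_le => _ [h hf <-]; exists h => //= x.
exact: le_trans (hf x) (fg x).
Qed.

Lemma ge0_integralD_real (u v : T -> R) :
  measurable_fun setT u -> measurable_fun setT v ->
  (forall x, 0 <= u x) -> (forall x, 0 <= v x) ->
  (\int[mu]_x (u x + v x)%:E = \int[mu]_x (u x)%:E + \int[mu]_x (v x)%:E)%E.
Proof.
move=> mu' mv u0 v0; under eq_integral do rewrite EFinD.
by rewrite ge0_integralD//; try (by move=> x _; rewrite lee_fin);
  apply/measurable_EFinP.
Qed.

Lemma ge0_integralZl_real (c : R) (u : T -> R) :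
  measurable_fun setT u -> 0 <= c -> (forall x, 0 <= u x) ->
  (\int[mu]_x (c * u x)%:E = c%:E * \int[mu]_x (u x)%:E)%E.
Proof.
move=> mu' c0 u0; under eq_integral do rewrite EFinM.
rewrite ge0_integralZl_EFin//; first by move=> x _; rewrite lee_fin.
exact/measurable_EFinP.
Qed.

Lemma ge0_integral_sum_real (I : Type) (r : seq I) (F : I -> T -> R) :
  (forall i, measurable_fun setT (F i)) -> (forall i x, 0 <= F i x) ->
  (\int[mu]_x (\sum_(i <- r) F i x)%:E =
   \sum_(i <- r) \int[mu]_x (F i x)%:E)%E.
Proof.
move=> mF F0; elim: r => [|i r IH].
  rewrite big_nil; under eq_integral do rewrite big_nil.
  by rewrite integral0_eq.
under eq_integral do rewrite big_cons.
rewrite ge0_integralD_real ?IH ?big_cons//.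
- exact: measurable_sum.
- by move=> x; apply: sumr_ge0.
Qed.

End nonnegative_integrals.

(** * Random variables with moments of all orders *)

Section all_moments.
Context {R : realType} {disp : measure_display} {Omega : measurableType disp}
        (P : probability Omega R).
Implicit Types (f g : Omega -> R) (n : nat).

(** Closed under the algebraic operations, so that integrability is never an
    issue below. *)
Definition all_moments f : Prop := measurable_fun setT f /\
  forall n, (\int[P]_o (`|f o| ^+ n)%:E < +oo)%E.

Definition mean f : R := fine 'E_P[f].

Lemma measurable_normX f n : measurable_fun setT f ->
  measurable_fun setT (fun o => `|f o| ^+ n).
Proof.
by move=> mf; apply: measurable_funX; apply: measurableT_comp.
Qed.

Lemma all_moments_le f g : measurable_fun setT f -> all_moments g ->
  (forall o, `|f o| <= `|g o|) -> all_moments f.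
Proof.
move=> mf [mg gn] fg; split => // n; apply: le_lt_trans (gn n).
apply: ge0_le_integral_nonmeasurable => o; first by rewrite lee_fin exprn_ge0.
by rewrite lee_fin lerXn2r// nnegrE.
Qed.

Lemma all_moments_cst (c : R) : all_moments (fun=> c).
Proof.
split=> [|n]; first exact: measurable_cst.
rewrite (_ : (fun o => _) = cst (`|c| ^+ n)%:E)//.
by rewrite integral_cst//= probability_setT mule1 ltry.
Qed.

Lemma exprD_le (x y : R) n : 0 <= x -> 0 <= y ->
  (x + y) ^+ n <= 2 ^+ n * (x ^+ n + y ^+ n).
Proof.
move=> x0 y0; wlog xy : x y x0 y0 / x <= y => [H|].
  by have [xy|/ltW yx] := leP x y; [|rewrite addrC [X in _ * X]addrC]; exact: H.
apply: (@le_trans _ _ ((2 * y) ^+ n)).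
  rewrite lerXn2r// ?nnegrE ?addr_ge0 ?mulr_ge0//.
  by rewrite mulr_natl mulr2n lerD2r.
by rewrite exprMn ler_wpM2l ?exprn_ge0// lerDr exprn_ge0.
Qed.

Lemma all_momentsD f g : all_moments f -> all_moments g ->
  all_moments (fun o => f o + g o).
Proof.
move=> [mf fn] [mg gn]; split=> [|n]; first exact: measurable_funD.
apply: (@le_lt_trans _ _
  (\int[P]_o (2 ^+ n * (`|f o| ^+ n + `|g o| ^+ n))%:E)%E).
  apply: ge0_le_integral_nonmeasurable => o; first by rewrite lee_fin exprn_ge0.
  rewrite lee_fin; apply: le_trans (exprD_le _ _ _) => //.
  by rewrite lerXn2r ?nnegrE ?addr_ge0// ler_normD.
have mfn := measurable_normX n mf; have mgn := measurable_normX n mg.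
rewrite ge0_integralZl_real//; last exact: measurable_funD.
rewrite ge0_integralD_real//.
by rewrite lte_mul_pinfty ?lee_fin ?exprn_ge0// lte_add_pinfty.
Qed.

Lemma mulr_le_sqr (x y : R) : 0 <= x -> 0 <= y -> x * y <= x ^+ 2 + y ^+ 2.
Proof. by move=> x0 y0; nra. Qed.

Lemma all_momentsM f g : all_moments f -> all_moments g ->
  all_moments (fun o => f o * g o).
Proof.
move=> [mf fn] [mg gn]; split=> [|n]; first exact: measurable_funM.
apply: (@le_lt_trans _ _
  (\int[P]_o (`|f o| ^+ (n * 2) + `|g o| ^+ (n * 2))%:E)%E).
  apply: ge0_le_integral_nonmeasurable => o; first by rewrite lee_fin exprn_ge0.
  by rewrite lee_fin normrM exprMn !exprM mulr_le_sqr// exprn_ge0.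
have mfn := measurable_normX (n * 2) mf; have mgn := measurable_normX (n * 2) mg.
by rewrite ge0_integralD_real//; exact: lte_add_pinfty.
Qed.

Lemma all_momentsZ (c : R) f : all_moments f -> all_moments (fun o => c * f o).
Proof. by move=> hf; apply: all_momentsM => //; exact: all_moments_cst. Qed.

Lemma all_momentsN f : all_moments f -> all_moments (fun o => - f o).
Proof.
move=> [mf fn]; split=> [|n]; first exact: measurableT_comp.
by under eq_integral do rewrite normrN.
Qed.

Lemma all_momentsB f g : all_moments f -> all_moments g ->
  all_moments (fun o => f o - g o).
Proof. by move=> hf hg; apply: all_momentsD => //; exact: all_momentsN. Qed.

Lemma all_moments_norm f : all_moments f -> all_moments (fun o => `|f o|).
Proof.
move=> hf; apply: (all_moments_le _ hf) => [|o]; last by rewrite normr_id.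
by case: hf => mf _; exact: measurableT_comp.
Qed.

Lemma all_momentsX f n : all_moments f -> all_moments (fun o => f o ^+ n).
Proof.
move=> hf; elim: n => [|n IH].
  by under eq_fun do rewrite expr0; exact: all_moments_cst.
by under eq_fun do rewrite exprS; exact: all_momentsM.
Qed.

Lemma all_moments_sum (I : Type) (r : seq I) (F : I -> Omega -> R) :
  (forall i, all_moments (F i)) -> all_moments (fun o => \sum_(i <- r) F i o).
Proof.
move=> hF; elim: r => [|i r IH].
  by under eq_fun do rewrite big_nil; exact: all_moments_cst.
by under eq_fun do rewrite big_cons; exact: all_momentsD.
Qed.

Lemma all_moments_bounded f (c : R) : measurable_fun setT f ->
  (forall o, `|f o| <= c) -> all_moments f.
Proof.
move=> mf fc; apply: (all_moments_le mf (all_moments_cst c)) => o.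
exact: le_trans (fc o) (ler_norm _).
Qed.

Lemma all_moments_integrable f : all_moments f ->
  P.-integrable setT (EFin \o f).
Proof.
move=> [mf fn]; apply/integrableP; split; first exact/measurable_EFinP.
by apply: le_lt_trans (fn 1%N); apply: ge0_le_integral_nonmeasurable => o /=.
Qed.

Lemma meanE f : mean f = fine (\int[P]_o (f o)%:E).
Proof. by rewrite /mean unlock. Qed.

Lemma expectationE f : all_moments f -> ('E_P[f] = (mean f)%:E)%E.
Proof.
move=> /all_moments_integrable hf; rewrite /mean fineK// unlock.
exact: integrable_fin_num.
Qed.

Lemma mean_cst (c : R) : mean (fun=> c) = c.
Proof. by rewrite /mean expectation_cst. Qed.

Lemma mean_indic (A : set Omega) : measurable A -> mean (\1_A) = fine (P A).
Proof. by move=> mA; rewrite /mean expectation_indic. Qed.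

Lemma meanD f g : all_moments f -> all_moments g ->
  mean (fun o => f o + g o) = mean f + mean g.
Proof.
move=> /all_moments_integrable hf /all_moments_integrable hg.
by rewrite !meanE; exact: RintegralD.
Qed.

Lemma meanZ (c : R) f : all_moments f -> mean (fun o => c * f o) = c * mean f.
Proof.
by move=> /all_moments_integrable hf; rewrite !meanE; exact: RintegralZl.
Qed.

Lemma mean_sum (I : Type) (r : seq I) (F : I -> Omega -> R) :
  (forall i, all_moments (F i)) ->
  mean (fun o => \sum_(i <- r) F i o) = \sum_(i <- r) mean (F i).
Proof.
move=> hF; elim: r => [|i r IH].
  by under eq_fun do rewrite big_nil; rewrite big_nil mean_cst.
under eq_fun do rewrite big_cons.
by rewrite big_cons meanD ?IH//; exact: all_moments_sum.
Qed.

Lemma ler_mean f g : all_moments f -> all_moments g ->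
  (forall o, f o <= g o) -> mean f <= mean g.
Proof.
move=> /all_moments_integrable hf /all_moments_integrable hg fg.
by rewrite !meanE; exact: le_Rintegral.
Qed.

Lemma mean_ge0 f : all_moments f -> (forall o, 0 <= f o) -> 0 <= mean f.
Proof.
by move=> hf f0; rewrite -(mean_cst 0) ler_mean//; exact: all_moments_cst.
Qed.

Lemma ler_norm_mean f : all_moments f -> `|mean f| <= mean (fun o => `|f o|).
Proof.
move=> /all_moments_integrable hf.
by rewrite !meanE; exact: le_normr_Rintegral.
Qed.

End all_moments.

(** * Covariances under strong mixing *)

Section covariance_inequality.
Context {R : realType} {disp : measure_display} {Omega : measurableType disp}
        (P : probability Omega R).
Implicit Types (f g : Omega -> R) (n : nat).

Notation mean := (mean P).
Notation all_moments := (all_moments P).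

Definition cov f g : R := mean (fun o => f o * g o) - mean f * mean g.

Lemma covC f g : cov f g = cov g f.
Proof.
rewrite /cov mulrC; congr (mean _ - _).
by apply/funext => o; rewrite mulrC.
Qed.

Lemma covDl f f' g : all_moments f -> all_moments f' -> all_moments g ->
  cov (fun o => f o + f' o) g = cov f g + cov f' g.
Proof.
move=> hf hf' hg; rewrite /cov meanD//.
rewrite (_ : (fun o => (f o + f' o) * g o) = (fun o => f o * g o + f' o * g o)).
  by rewrite meanD; [ring|exact: all_momentsM|exact: all_momentsM].
by apply/funext => o; rewrite mulrDl.
Qed.

Lemma covDr f g g' : all_moments f -> all_moments g -> all_moments g' ->
  cov f (fun o => g o + g' o) = cov f g + cov f g'.
Proof. by move=> hf hg hg'; rewrite covC covDl// covC [cov g' f]covC. Qed.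

Lemma covZl (c : R) f g : all_moments f -> all_moments g ->
  cov (fun o => c * f o) g = c * cov f g.
Proof.
move=> hf hg; rewrite /cov meanZ//.
under [X in mean X]eq_fun do rewrite -mulrA.
by rewrite meanZ; [ring|exact: all_momentsM].
Qed.

Lemma covZr (c : R) f g : all_moments f -> all_moments g ->
  cov f (fun o => c * g o) = c * cov f g.
Proof. by move=> hf hg; rewrite covC covZl// covC. Qed.

Lemma cov_cstl (c : R) g : all_moments g -> cov (fun=> c) g = 0.
Proof. by move=> hg; rewrite /cov mean_cst meanZ// subrr. Qed.

Lemma cov_suml (I : Type) (r : seq I) (F : I -> Omega -> R) g :
  (forall i, all_moments (F i)) -> all_moments g ->
  cov (fun o => \sum_(i <- r) F i o) g = \sum_(i <- r) cov (F i) g.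
Proof.
move=> hF hg; elim: r => [|i r IH].
  by under eq_fun do rewrite big_nil; rewrite big_nil cov_cstl.
under eq_fun do rewrite big_cons.
by rewrite big_cons covDl ?IH//; exact: all_moments_sum.
Qed.

Lemma cov_sumr (I : Type) (r : seq I) (F : I -> Omega -> R) f :
  (forall i, all_moments (F i)) -> all_moments f ->
  cov f (fun o => \sum_(i <- r) F i o) = \sum_(i <- r) cov f (F i).
Proof.
move=> hF hf; rewrite covC cov_suml//.
by apply: eq_bigr => i _; rewrite covC.
Qed.

Lemma norm_cov_le f g : all_moments f -> all_moments g ->
  `|cov f g| <= mean (fun o => `|f o| * `|g o|) +
    mean (fun o => `|f o|) * mean (fun o => `|g o|).
Proof.
move=> hf hg; apply: le_trans (ler_normB _ _) _; rewrite normrM.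
apply: lerD; last by rewrite ler_pM// ler_norm_mean.
under [X in _ <= mean X]eq_fun do rewrite -normrM.
by apply: ler_norm_mean; exact: all_momentsM.
Qed.

Lemma all_moments_indic (A : set Omega) : measurable A -> all_moments (\1_A).
Proof.
move=> mA; apply: (@all_moments_bounded _ _ _ P _ 1) => [|o].
  exact: measurable_indic.
by rewrite indicE normr_nat lern1; case: (_ \in _).
Qed.

Lemma cov_indic (A B : set Omega) : measurable A -> measurable B ->
  cov (\1_A) (\1_B) = fine (P (A `&` B)) - fine (P A) * fine (P B).
Proof.
move=> mA mB; rewrite /cov !mean_indic//; congr (_ - _).
rewrite -(mean_indic P (measurableI _ _ mA mB)).
by rewrite (_ : (fun o => \1_A o * \1_B o) = \1_(A `&` B))// indicI.
Qed.

Lemma sum_indicator_le_nat (x : R) (k : nat) : 0 <= x -> x <= k%:R ->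
  \sum_(1 <= i < k.+1) ((i%:R <= x)%R : nat)%:R = (Num.truncn x)%:R :> R.
Proof.
move=> x0 xk; set n := Num.truncn x.
have nk : (n <= k)%N.
  by rewrite /n -(ler_nat R); apply: le_trans xk; rewrite truncn_le.
rewrite (@big_cat_nat _ _ _ n.+1)//= [X in _ + X]big_nat_cond.
rewrite [X in _ + X]big1 ?addr0; last first.
  move=> i /andP[/andP[ni _] _].
  by rewrite -truncn_ge_nat// leqNgt ni.
rewrite (eq_big_nat _ _ (F2 := fun=> 1)).
  by rewrite sumr_const_nat subn1.
move=> i /andP[_ ni]; rewrite -truncn_ge_nat//.
by move: ni; rewrite ltnS => ->.
Qed.

Definition level_set f (t : R) : set Omega := [set o | t <= f o].

Definition step_approx f (k : nat) (o : Omega) : R :=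
  k%:R^-1 * \sum_(1 <= i < k.+1) \1_(level_set f (i%:R / k%:R)) o.

(** [step_approx f k] is [f] rounded down to a multiple of [1 / k]: the number
    of level sets containing a point is the integer part of [k f]. *)
Lemma step_approx_near f k o : (0 < k)%N -> 0 <= f o <= 1 ->
  0 <= f o - step_approx f k o <= k%:R^-1.
Proof.
move=> k0 /andP[f0 f1]; have kR : (0 : R) < k%:R by rewrite ltr0n.
rewrite /step_approx.
have -> : \sum_(1 <= i < k.+1) \1_(level_set f (i%:R / k%:R)) o =
    (Num.truncn (k%:R * f o))%:R :> R.
  rewrite -(@sum_indicator_le_nat _ k) ?mulr_ge0//; last first.
    by rewrite -[leRHS]mulr1 ler_wpM2l.
  apply: eq_bigr => i _; rewrite indicE; congr (_ %:R); congr nat_of_bool.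
  rewrite [X in _ = (_ <= X)]mulrC -ler_pdivrMr//.
  by apply/idP/idP => [/set_mem//|H]; exact: mem_set.
have x0 : 0 <= k%:R * f o by rewrite mulr_ge0.
have /andP[] := truncn_itv x0; set N := Num.truncn _; rewrite -natr1 => N1 N2.
have -> : f o - k%:R^-1 * N%:R = k%:R^-1 * (k%:R * f o - N%:R).
  by rewrite mulrBr mulrA mulVf ?mul1r// gt_eqF.
apply/andP; split; first by rewrite mulr_ge0 ?invr_ge0// subr_ge0.
by rewrite -[leRHS]mulr1 ler_wpM2l ?invr_ge0// lerBlDl ltW.
Qed.

Lemma measurable_level_set f t : measurable_fun setT f ->
  measurable (level_set f t).
Proof.
move=> mf; rewrite (_ : level_set f t = f @^-1` `[t, +oo[).
  by rewrite -[X in measurable X]setTI; exact: mf.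
by apply/seteqP; split => o /=; rewrite in_itv/= andbT.
Qed.

Lemma all_moments_step_approx f k : measurable_fun setT f ->
  all_moments (step_approx f k).
Proof.
move=> mf; apply: all_momentsZ; apply: all_moments_sum => i.
exact/all_moments_indic/measurable_level_set.
Qed.

Lemma norm_average_le (F : nat -> R) (k : nat) (a : R) : (0 < k)%N ->
  (forall i, `|F i| <= a) -> `|k%:R^-1 * \sum_(1 <= i < k.+1) F i| <= a.
Proof.
move=> k0 Fa; have kR : (0 : R) < k%:R by rewrite ltr0n.
rewrite normrM ger0_norm ?invr_ge0 ?(ltW kR)// mulrC ler_pdivrMr//.
apply: le_trans (ler_norm_sum _ _ _) _.
apply: le_trans (ler_sum _ (fun i _ => Fa i)) _.
by rewrite sumr_const_nat subn1 mulr_natr.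
Qed.

(** The two functions are averages of indicators of level sets up to [1 / k],
    so their covariance is an average of the covariances of events. *)
Lemma cov_le_unit f g (alpha : R) :
  measurable_fun setT f -> measurable_fun setT g ->
  (forall o, 0 <= f o <= 1) -> (forall o, 0 <= g o <= 1) ->
  (forall s t, `|fine (P (level_set f s `&` level_set g t)) -
     fine (P (level_set f s)) * fine (P (level_set g t))| <= alpha) ->
  `|cov f g| <= alpha.
Proof.
move=> mf mg f01 g01 H.
have bnd (h : Omega -> R) : (forall o, 0 <= h o <= 1) -> forall o, `|h o| <= 1.
  by move=> h01 o; have /andP[h0 h1] := h01 o; rewrite ger0_norm.
have hf := all_moments_bounded P mf (bnd _ f01).
have hg := all_moments_bounded P mg (bnd _ g01).
(* Each of the two step approximations costs [2 / k]. *)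
suff K k : (0 < k)%N -> `|cov f g| <= alpha + 4 * k%:R^-1.
  apply/ler_addgt0Pr => eps eps0.
  have [n _ Hn] := near_infty_natSinv_lt (PosNum (divr_gt0 eps0 (ltr0n R 4))).
  apply: le_trans (K n.+1 isT) _; rewrite lerD2l mulrC -ler_pdivlMr//.
  by have /ltW := Hn n (leqnn n).
move=> k0; have kR : (0 : R) < k%:R by rewrite ltr0n.
have k0' : (0 : R) <= k%:R^-1 by rewrite invr_ge0 ltW.
have sf := all_moments_step_approx k mf; have sg := all_moments_step_approx k mg.
set F := step_approx f k in sf *; set G := step_approx g k in sg *.
have nearf o : `|f o - F o| <= k%:R^-1.
  by have /andP[a b] := step_approx_near k0 (f01 o); rewrite ger0_norm.
have nearg o : `|g o - G o| <= k%:R^-1.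
  by have /andP[a b] := step_approx_near k0 (g01 o); rewrite ger0_norm.
have F1 o : `|F o| <= 1.
  rewrite ger0_norm; last first.
    by rewrite mulr_ge0// sumr_ge0.
  have /andP[+ _] := step_approx_near k0 (f01 o); rewrite subr_ge0.
  by move=> /le_trans; apply; case/andP: (f01 o).
have small u v : all_moments u -> all_moments v ->
    (forall o, `|u o| <= k%:R^-1) -> (forall o, `|v o| <= 1) ->
    `|cov u v| <= 2 * k%:R^-1.
  move=> hu hv uk v1; apply: le_trans (norm_cov_le hu hv) _.
  have hu' := all_moments_norm hu; have hv' := all_moments_norm hv.
  rewrite mulr_natl mulr2n; apply: lerD.
    rewrite -[leRHS](@mean_cst _ _ _ P); apply: ler_mean => [||o].
    - exact: all_momentsM.
    - exact: all_moments_cst.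
    - by rewrite -[leRHS]mulr1 ler_pM.
  rewrite -[leRHS]mulr1; apply: ler_pM.
  - exact: mean_ge0.
  - exact: mean_ge0.
  - rewrite -[leRHS](@mean_cst _ _ _ P); apply: ler_mean => //.
    exact: all_moments_cst.
  - rewrite -[leRHS](@mean_cst _ _ _ P); apply: ler_mean => //.
    exact: all_moments_cst.
have dF := all_momentsB hf sf; have dG := all_momentsB hg sg.
have -> : cov f g = cov F G + cov F (fun o => g o - G o) + cov (fun o => f o - F o) g.
  rewrite -covDr//.
  rewrite (_ : (fun o => G o + (g o - G o)) = g); last first.
    by apply/funext => o; rewrite addrC subrK.
  rewrite -covDl//; congr cov.
  by apply/funext => o; rewrite addrC subrK.
have HFG : `|cov F G| <= alpha.
  have mi i h : measurable_fun setT h ->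
      all_moments (\1_(level_set h (i%:R / k%:R))).
    by move=> mh; exact/all_moments_indic/measurable_level_set.
  rewrite covZl; [|by apply: all_moments_sum => i; exact: mi|by []].
  rewrite cov_suml; [|by move=> i; exact: mi|by []].
  apply: norm_average_le => // i.
  rewrite covZr; [|exact: mi|by apply: all_moments_sum => j; exact: mi].
  rewrite cov_sumr; [|by move=> j; exact: mi|exact: mi].
  apply: norm_average_le => // j.
  by rewrite cov_indic//; exact: measurable_level_set.
have H2 : `|cov F (fun o => g o - G o)| <= 2 * k%:R^-1.
  by rewrite covC; apply: small.
have H3 : `|cov (fun o => f o - F o) g| <= 2 * k%:R^-1.
  by apply: small => //; exact: bnd.
move: HFG H2 H3; move: (cov (fun o => f o - F o) g).
move: (cov F (fun o => g o - G o)) (cov F G) => b a c Ha Hb Hc.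
rewrite (_ : 4 * _ = 2 * k%:R^-1 + 2 * k%:R^-1) ?addrA; last by ring.
apply: le_trans (ler_normD _ _) _; apply: lerD => //.
by apply: le_trans (ler_normD _ _) _; apply: lerD.
Qed.

(** The strong mixing coefficient of the sigma-algebras generated by [f] and
    [g] is at most [alpha]. *)
Definition dependence_le f g (alpha : R) : Prop :=
  forall B1 B2 : set R, measurable B1 -> measurable B2 ->
    `|fine (P (f @^-1` B1 `&` g @^-1` B2)) -
      fine (P (f @^-1` B1)) * fine (P (g @^-1` B2))| <= alpha.

Lemma dependence_le_comp (phi psi : R -> R) f g alpha :
  measurable_fun setT phi -> measurable_fun setT psi ->
  dependence_le f g alpha -> dependence_le (phi \o f) (psi \o g) alpha.
Proof.
move=> mphi mpsi H B1 B2 mB1 mB2; apply: (H (phi @^-1` B1) (psi @^-1` B2)).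
- by rewrite -[X in measurable X]setTI; exact: mphi.
- by rewrite -[X in measurable X]setTI; exact: mpsi.
Qed.

Lemma cov_affine (a b : R) f g : all_moments f -> all_moments g ->
  cov (fun o => a * f o + b) (fun o => a * g o + b) = a ^+ 2 * cov f g.
Proof.
move=> hf hg; have hb := all_moments_cst P b.
have haf := all_momentsZ a hf; have hag := all_momentsZ a hg.
rewrite covDl//; last exact: all_momentsD.
rewrite cov_cstl ?addr0; last exact: all_momentsD.
rewrite covDr// [X in _ + X]covC cov_cstl// addr0.
by rewrite covZl// covZr// mulrA.
Qed.

(** By an affine rescaling to values in [[0, 1]]. *)
Lemma cov_le_bounded f g (alpha A : R) :
  measurable_fun setT f -> measurable_fun setT g -> 0 < A ->
  (forall o, `|f o| <= A) -> (forall o, `|g o| <= A) ->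
  dependence_le f g alpha -> `|cov f g| <= 4 * (A ^+ 2 * alpha).
Proof.
move=> mf mg A0 fA gA H.
pose phi (x : R) := (2 * A)^-1 * (x + A).
have mphi : measurable_fun setT phi.
  apply: measurable_funM; first exact: measurable_cst.
  by apply: measurable_funD => //; exact: measurable_cst.
have A2 : 0 < 2 * A by rewrite mulr_gt0.
have phi01 (x : R) : `|x| <= A -> 0 <= phi x <= 1.
  rewrite ler_norml => /andP[x1 x2]; apply/andP; split.
    by rewrite mulr_ge0 ?invr_ge0 ?(ltW A2)//; lra.
  by rewrite /phi mulrC ler_pdivrMr// mul1r; lra.
have mphif : measurable_fun setT (phi \o f) by exact: measurableT_comp.
have mphig : measurable_fun setT (phi \o g) by exact: measurableT_comp.
have lev (h : Omega -> R) t : level_set h t = h @^-1` `[t, +oo[.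
  by apply/seteqP; split => o /=; rewrite in_itv/= andbT.
have K : `|cov (phi \o f) (phi \o g)| <= alpha.
  apply: cov_le_unit => //.
  - by move=> o; exact: phi01.
  - by move=> o; exact: phi01.
  - by move=> s t; rewrite !lev; exact: (dependence_le_comp mphi mphi H).
have bnd (h : Omega -> R) : measurable_fun setT h -> (forall o, `|h o| <= A) ->
    all_moments (phi \o h) /\ h = (fun o => 2 * A * (phi \o h) o + (- A)).
  move=> mh hA; split.
    apply: (@all_moments_bounded _ _ _ P _ 1) => [|o]; first exact: measurableT_comp.
    by have /andP[h0 h1] := phi01 _ (hA o); rewrite ger0_norm.
  by apply/funext => o; rewrite /phi /= mulrA divff ?mul1r ?addrK// gt_eqF.
have [hf fE] := bnd _ mf fA; have [hg gE] := bnd _ mg gA.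
rewrite {1}fE {1}gE cov_affine// normrM ger0_norm ?exprn_ge0 ?(ltW A2)//.
apply: le_trans (ler_wpM2l _ K) _; first by rewrite exprn_ge0// ltW.
by rewrite exprMn -mulrA -natrX.
Qed.

Definition moment f n : R := mean (fun o => `|f o| ^+ n).

Lemma all_moments_normX f n : all_moments f ->
  all_moments (fun o => `|f o| ^+ n).
Proof. by move=> hf; apply: all_momentsX; exact: all_moments_norm. Qed.

Lemma moment_ge0 f n : all_moments f -> 0 <= moment f n.
Proof.
by move=> hf; apply: mean_ge0 => [|o]; [exact: all_moments_normX|exact: exprn_ge0].
Qed.

(** For products of a function dominated by [f] and of a tail dominated by a
    power of [g]; the form of the bound is chosen so that only moments of [f] and
    [g] appear. *)
Lemma cov_le_tail f g u h q (a : R) : all_moments f -> all_moments g ->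
  all_moments u -> all_moments h -> 0 <= a ->
  (forall o, `|u o| <= `|f o|) -> (forall o, `|h o| <= a * `|g o| ^+ q) ->
  `|cov u h| <= a * (2 * ((1 + moment f 2) * (1 + moment g (q * 2)))).
Proof.
move=> hf hg hu hh a0 uf hq; apply: le_trans (norm_cov_le hu hh) _.
have m1 := moment_ge0 2 hf; have m2 := moment_ge0 (q * 2) hg.
have nf := all_moments_norm hf; have nu := all_moments_norm hu.
have nh := all_moments_norm hh; have gq := all_moments_normX q hg.
have g2 := all_moments_normX (q * 2) hg; have f2 := all_moments_normX 2 hf.
have agq : all_moments (fun o => a * `|g o| ^+ q) by exact: all_momentsZ.
have one := all_moments_cst P 1.
rewrite (_ : 2 * _ = (1 + moment f 2) * (1 + moment g (q * 2)) +
   (1 + moment f 2) * (1 + moment g (q * 2))); last by ring.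
rewrite mulrDr; apply: lerD.
  apply: (@le_trans _ _ (mean (fun o => a * (`|f o| ^+ 2 + `|g o| ^+ (q * 2))))).
    apply: ler_mean => [||o].
    - exact: all_momentsM.
    - by apply: all_momentsZ; exact: all_momentsD.
    - apply: le_trans (ler_pM _ _ (uf o) (hq o)) _ => //.
      by rewrite mulrCA ler_wpM2l// exprM mulr_le_sqr// exprn_ge0.
  rewrite meanZ ?meanD//; last exact: all_momentsD.
  rewrite ler_wpM2l// -/(moment f 2) -/(moment g (q * 2)); nra.
have B1 : mean (fun o => `|u o|) <= 1 + moment f 2.
  rewrite -[X in X + _](mean_cst P) -meanD//; apply: ler_mean => [//||o].
    exact: all_momentsD.
  by apply: le_trans (uf o) _; have := normr_ge0 (f o); nra.
have B2 : mean (fun o => `|h o|) <= a * (1 + moment g (q * 2)).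
  rewrite -[X in X + _](mean_cst P) -meanD// -meanZ; last exact: all_momentsD.
  apply: ler_mean => [//||o]; first by apply: all_momentsZ; exact: all_momentsD.
  apply: le_trans (hq o) _; rewrite ler_wpM2l// exprM.
  by have := exprn_ge0 q (normr_ge0 (g o)); nra.
rewrite mulrCA; apply: ler_pM => //; exact: mean_ge0.
Qed.

Lemma clamp_tail (A x : R) q : 0 < A ->
  `|x - clamp (- A) A x| <= A ^- q * `|x| ^+ q.+1.
Proof.
move=> A0; have AA : - A <= A by lra.
have [xA|Ax] := leP `|x| A.
  rewrite clamp_id -?ler_norml// subrr normr0.
  by rewrite mulr_ge0 ?invr_ge0 ?exprn_ge0// ltW.
apply: (@le_trans _ _ `|x|); last first.
  rewrite exprSr mulrA -exprVn -exprMn ler_peMl//.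
  by rewrite exprn_ege1// mulrC ler_pdivlMr// mul1r ltW.
move: Ax; rewrite lter_normr => /orP[Ax|Ax].
  by rewrite clamp_ge ?(ltW Ax)// !ger0_norm; lra.
rewrite clamp_le//; last by lra.
by rewrite !ler0_norm; lra.
Qed.

Lemma norm_clamp_le (A x : R) : 0 < A -> `|clamp (- A) A x| <= `|x|.
Proof.
move=> A0; have AA : - A <= A by lra.
have [xA|Ax] := leP `|x| A; first by rewrite clamp_id -?ler_norml.
apply: le_trans (ltW Ax); rewrite ler_norml; exact: clamp_itv.
Qed.

Lemma measurable_clamp (c e : R) : measurable_fun setT (clamp c e).
Proof. by apply: continuous_measurable_fun; exact: clamp_continuous. Qed.

(** Davydov's inequality up to the constant. Both functions are truncated at
    the level [A = alpha^(- 1 / (q + 2))], for which the covariance of the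
    truncated functions, [A^2 alpha], is of the order of the tails,
    [A^(- q)]. *)
Lemma davydov f g q (alpha : R) : all_moments f -> all_moments g ->
  0 < alpha -> dependence_le f g alpha ->
  `|cov f g| <= (4 + 2 * ((1 + moment f 2) * (1 + moment g (q.+1 * 2))) +
                     2 * ((1 + moment g 2) * (1 + moment f (q.+1 * 2)))) *
     alpha `^ (q%:R / q.+2%:R).
Proof.
move=> hf hg a0 H; set r : R := alpha `^ _.
pose A := alpha `^ (- q.+2%:R^-1).
have A0 : 0 < A by exact: powR_gt0.
have q0 : (q.+2%:R : R) != 0 by rewrite pnatr_eq0.
have Aq : A ^- q = r.
  rewrite -powR_mulrn ?ltW// -powRrM -powRN; congr (_ `^ _).
  by rewrite mulNr opprK mulrC.
have A2 : A ^+ 2 * alpha = r.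
  rewrite -powR_mulrn ?ltW// -powRrM -[X in _ * X](powRr1 (ltW a0)).
  rewrite -powRD; last by rewrite (gt_eqF a0) implybT.
  by congr (_ `^ _); rewrite -[q.+2]addn2 natrD in q0 *; field.
pose t := clamp (- A) A.
have mt : measurable_fun setT t by exact: measurable_clamp.
have [mf _] := hf; have [mg _] := hg.
have tf : all_moments (t \o f).
  apply: all_moments_le hf _; first exact: measurableT_comp.
  by move=> o; exact: norm_clamp_le.
have tg : all_moments (t \o g).
  apply: all_moments_le hg _; first exact: measurableT_comp.
  by move=> o; exact: norm_clamp_le.
have tA (h : Omega -> R) o : `|(t \o h) o| <= A.
  by rewrite ler_norml; apply: clamp_itv; lra.
have df : all_moments (fun o => f o - (t \o f) o) by exact: all_momentsB.
have dg : all_moments (fun o => g o - (t \o g) o) by exact: all_momentsB.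
have -> : cov f g = cov (t \o f) (t \o g) +
    cov (t \o f) (fun o => g o - (t \o g) o) + cov (fun o => f o - (t \o f) o) g.
  rewrite -covDr//.
  rewrite (_ : (fun o => (t \o g) o + (g o - (t \o g) o)) = g); last first.
    by apply/funext => o; rewrite addrC subrK.
  rewrite -covDl//; congr cov.
  by apply/funext => o; rewrite addrC subrK.
have H1 : `|cov (t \o f) (t \o g)| <= 4 * r.
  rewrite -A2; apply: cov_le_bounded => //; [exact: measurableT_comp..|].
  exact: dependence_le_comp.
have r0 : 0 <= r by exact: powR_ge0.
have H2 := @cov_le_tail f g _ _ q.+1 r hf hg tf dg r0.
have {}H2 := H2 (fun o => norm_clamp_le _ A0).
have {}H2 : `|cov (t \o f) (fun o => g o - (t \o g) o)| <=
    r * (2 * ((1 + moment f 2) * (1 + moment g (q.+1 * 2)))).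
  by apply: H2 => o; rewrite -Aq; exact: clamp_tail.
have H3 : `|cov (fun o => f o - (t \o f) o) g| <=
    r * (2 * ((1 + moment g 2) * (1 + moment f (q.+1 * 2)))).
  by rewrite covC; apply: cov_le_tail => // o; rewrite -Aq; exact: clamp_tail.
move: H1 H2 H3; move: (cov (fun o => f o - (t \o f) o) g).
move: (cov (t \o f) (fun o => g o - (t \o g) o)) (cov (t \o f) (t \o g)).
move=> b a c H1 H2 H3; rewrite (mulrDl (4 + _)) (mulrDl 4).
rewrite ![_ * r]mulrC; rewrite mulrC in H1.
apply: le_trans (ler_normD _ _) _; apply: lerD => //.
by apply: le_trans (ler_normD _ _) _; apply: lerD.
Qed.

End covariance_inequality.

(** * The Gamma function and summable rates *)

Section real_lemmas.
Context {R : realType}.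
Implicit Types (a b x y t : R) (n : nat).

(** [1 + t <= 2 n exp (t / (2 n))], raised to the power [n >= a]. *)
Lemma powR_le_expR a : 0 <= a -> exists2 C, 0 < C &
  forall t, 0 <= t -> t `^ a <= C * expR (2^-1 * t).
Proof.
move=> a0; pose n := (Num.truncn a).+1.
have n0 : (0 : R) < n%:R by rewrite ltr0n.
have an : a <= n%:R by apply/ltW/truncnS_gt.
exists ((2 * n%:R) ^+ n) => [|t t0]; first by rewrite exprn_gt0// mulr_gt0.
have t1 : 1 <= 1 + t by rewrite lerDl.
apply: (@le_trans _ _ ((1 + t) `^ a)).
  by rewrite ge0_ler_powR// ?nnegrE ?addr_ge0// lerDr.
apply: (le_trans (ler_powR t1 an)); rewrite powR_mulrn ?addr_ge0//.
have -> : 2^-1 * t = n%:R * (t / (2 * n%:R)) by field; rewrite gt_eqF.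
rewrite expRM_natl -exprMn lerXn2r ?nnegrE ?addr_ge0 ?mulr_ge0 ?expR_ge0//.
apply: (@le_trans _ _ (2 * n%:R * (1 + t / (2 * n%:R)))); last first.
  by rewrite ler_pM2l ?mulr_gt0// expR_ge1Dx.
rewrite mulrDr mulr1 [_ * (t / _)]mulrC divfK ?mulf_neq0 ?gt_eqF// lerD2r -natrM.
by rewrite ler1n.
Qed.

(** The integrand of the Gamma function is dominated by a multiple of the
    density of an exponential law, and is bounded below on ]1, 2[. *)
Lemma rfact_gt0 a : 0 <= a -> 0 < rfact a.
Proof.
move=> a0; rewrite /rfact /Gamma /Rintegral addrK.
set I := (\int[_]_(t in _) _)%E.
pose D : set R := `]0, +oo[%classic.
pose f : R -> \bar R := (fun t => (t `^ a * expR (- t))%:E) \_ D.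
have IE : I = (\int[lebesgue_measure]_t f t)%E by rewrite /I integral_mkcond.
have fE t : f t = if 0 < t then (t `^ a * expR (- t))%:E else 0%E.
  rewrite /f patchE (_ : (t \in D) = (0 < t))//.
  by apply/idP/idP; rewrite inE /D /= in_itv/= andbT.
have f0 t : (0 <= f t)%E.
  by rewrite fE; case: ifP => // _; rewrite lee_fin mulr_ge0 ?powR_ge0 ?expR_ge0.
have [C C0 HC] := powR_le_expR a0.
apply: fine_gt0; apply/andP; split.
  apply: (@lt_le_trans _ _ (\int[lebesgue_measure]_t
      (expR (- 2) * (\1_(`]1, 2[%classic : set R) t : R))%:E)%E).
    have mu12 : lebesgue_measure (`]1, 2[%classic : set R) = 1%E.
      rewrite lebesgue_measure_itv/= lte_fin ltr1n -EFinD; congr EFin; by ring.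
    rewrite ge0_integralZl_real ?expR_ge0// integral_indic// setIT.
    by rewrite [X in (_ < _ * X)%E]mu12 mule1 lte_fin expR_gt0.
  rewrite IE; apply: ge0_le_integral_nonmeasurable => t.
    by rewrite lee_fin mulr_ge0 ?expR_ge0.
  rewrite indicE; have [|_] := boolP (t \in _); last by rewrite mulr0.
  rewrite inE/= in_itv/= => /andP[t1 t2]; rewrite mulr1 fE (lt_trans ltr01 t1).
  rewrite lee_fin -[leLHS]mul1r ler_pM ?expR_ge0//.
    by rewrite -(powRr0 t) ler_powR// ltW.
  by rewrite ler_expR lerN2 ltW.
rewrite IE; apply: (@le_lt_trans _ _ (\int[lebesgue_measure]_t
    (C * 2 * exponential_pdf (2^-1) t)%:E)%E).
  (* The density carries its rate [1 / 2] as a factor, whence the [2]. *)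
  apply: ge0_le_integral_nonmeasurable => // t; rewrite fE.
  case: ltP => [t0|_]; last first.
    by rewrite lee_fin mulr_ge0 ?exponential_pdf_ge0// ?mulr_ge0// ltW.
  rewrite exponential_pdfE ?(ltW t0)// lee_fin.
  rewrite (_ : C * 2 * _ = C * expR (2^-1 * t) * expR (- t)).
    by rewrite ler_pM2r ?expR_gt0// HC// ltW.
  rewrite -[RHS]mulrA -expRD (_ : 2^-1 * t + - t = - 2^-1 * t); last by field.
  by field.
rewrite ge0_integralZl_real ?integral_exponential_pdf//.
- by rewrite mule1 ltry.
- exact: measurable_exponential_pdf.
- by rewrite mulr_ge0// ltW.
- by move=> t; rewrite exponential_pdf_ge0.
Qed.

(** From [1 + (l t)^2 / 2 <= exp (l t)] and [(1 + t)^2 <= 2 + 2 t^2]. *)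
Lemma expRN_le_powR l t : 0 < l -> 0 <= t ->
  expR (- (l * t)) <= (2 + 4 / l ^+ 2) * (1 + t) `^ (- 2).
Proof.
move=> l0 t0; have t1 : 0 < 1 + t by rewrite ltr_wpDr.
rewrite powRN expRN (_ : (1 + t) `^ 2 = (1 + t) ^+ 2); last first.
  by rewrite -powR_mulrn// ltW.
rewrite ler_pdivlMr ?exprn_gt0// ler_pdivrMl ?expR_gt0//.
have lt0 : 0 <= l * t by rewrite mulr_ge0// ltW.
have := expR_ge1Dxn 1 lt0; rewrite (_ : 2`!%:R = 2 :> R)// exprMn => He.
have H1 : 1 <= expR (l * t).
  by apply: le_trans He; rewrite lerDl divr_ge0// mulr_ge0 ?exprn_ge0// ltW.
have H2 : t ^+ 2 <= 2 / l ^+ 2 * expR (l * t).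
  rewrite -ler_pdivrMl ?divr_gt0 ?exprn_gt0//; apply: le_trans He.
  by rewrite invf_div mulrAC lerDr.
apply: (@le_trans _ _ (2 * 1 + 2 * t ^+ 2)).
  by rewrite -subr_ge0 (_ : _ - _ = (1 - t) ^+ 2) ?sqr_ge0//; ring.
rewrite mulrDr; apply: lerD; first by rewrite mulrC ler_pM2r.
by rewrite (_ : expR _ * _ = 2 * (2 / l ^+ 2 * expR (l * t))) ?ler_pM2l//; ring.
Qed.

Lemma nneseries_le_real (u : nat -> R) B : (forall h, 0 <= u h) ->
  (forall K, \sum_(1 <= h < K) u h <= B) -> (\sum_(1 <= h <oo) (u h)%:E <= B%:E)%E.
Proof.
move=> u0 H; apply: lime_le; first by apply: is_cvg_nneseries => h _ _; rewrite lee_fin.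
by apply: nearW => K; rewrite sumEFin lee_fin.
Qed.

Lemma sum_powRN_le nu K : 1 < nu ->
  \sum_(1 <= h < K) (1 + h%:R : R) `^ (- nu) <= 1 + (nu - 1)^-1.
Proof.
move=> nu1; have [->|K1] := posnP K.
  by rewrite big_geq// addr_ge0// invr_ge0 subr_ge0 ltW.
apply: le_trans (sum_powRN_gt1 K nu1).
rewrite [leRHS]big_ltn// big_add1/=.
apply: le_trans (_ : \sum_(1 <= h < K) (h.+1%:R : R) `^ (- nu) <= _).
  by apply: ler_sum => h _; rewrite -natr1 addrC.
by rewrite lerDr powR_ge0.
Qed.

End real_lemmas.

(** * Random signatures: measurability and moments *)

Section random_signatures.
Context {R : realType} {disp : measure_display} {Omega : measurableType disp}
        (P : probability Omega R) {d : nat}.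
Variables (p beta : R) (X : Omega -> R -> 'rV[R]_d)
          (XX SX : Omega -> R -> R -> tensor R d).
Hypotheses (p1 : 1 <= p) (hX : continuous_process X)
           (hXX : random_geometric_rough_path p X XX)
           (hS : forall o, lyons_extension p (XX o) (SX o))
           (hmoment : moment_control P p beta X XX)
           (hstat : stationarity P p X XX).
Implicit Types (w : seq 'I_d) (s t tau : R).

Let q := Num.truncn p.

Let q1 : (1 <= q)%N.
Proof. by rewrite /q truncn_gt0. Qed.

Lemma sigma_of_sigma_algebra (D : set R) : sigma_algebra setT (sigma_of X D).
Proof. exact: smallest_sigma_algebra. Qed.

Lemma sigma_of_measurable (D : set R) : D `<=` [set u | 0 <= u] ->
  sigma_of X D `<=` measurable.
Proof.
move=> D0; apply: smallest_sub; first exact: sigma_algebra_measurable.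
move=> _ [u [i [B [Du mB ->]]]]; rewrite -[X in measurable X]setTI.
by have [+ _] := hX; move/(_ u i (D0 u Du)); apply.
Qed.

Lemma sigma_of_sub (D D' : set R) : D `<=` D' -> sigma_of X D `<=` sigma_of X D'.
Proof.
move=> DD; apply: smallest_sub; first exact: smallest_sigma_algebra.
move=> _ [u [i [B [Du mB ->]]]]; apply: sub_sigma_algebra.
by exists u, i, B; split => //; exact: DD.
Qed.

(** The rough path restarted at time [tau]. Signatures and interpolations over
    blocks that begin at [tau] are functions of it, and its law does not depend
    on [tau]. *)
Definition shifted_increments tau (o : Omega) : increment -> R :=
  fun z => XX o (tau + z.1.1) (tau + z.1.2) z.2.

Lemma shifted_increments_measurable tau z : 0 <= tau -> increments q z ->
  measurable_fun setT (fun o => shifted_increments tau o z).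
Proof.
move=> tau0 [[/= z0 z12] zq] _ B mB; rewrite setTI.
have [_ _ H] := hXX.
have s0 : 0 <= tau + z.1.1 by rewrite addr_ge0.
have st : tau + z.1.1 <= tau + z.1.2 by rewrite lerD2l.
have := H _ _ z.2 B s0 st zq mB; apply: sigma_of_measurable.
by move=> u /= /andP[su _]; exact: le_trans su.
Qed.

Lemma shifted_increments_law tau : 0 <= tau ->
  same_law P (increments q) (fun z o => shifted_increments tau o z)
    (fun z o => shifted_increments 0 o z).
Proof.
move=> tau0 n j B H; have [_ HS] := hstat tau0.
rewrite /shifted_increments; under [in RHS]eq_set do
  under eq_forall do rewrite !add0r.
exact: HS.
Qed.

Lemma shifted_expectation tau (F : @families R increment (increments q) -> R) :
  0 <= tau -> measurable_fun setT F ->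
  (\int[P]_o (F (shifted_increments tau o))%:E =
   \int[P]_o (F (shifted_increments 0 o))%:E)%E.
Proof.
move=> tau0 mF; apply: (same_law_expectation _ _ (shifted_increments_law tau0)) => //.
- by move=> z; exact: shifted_increments_measurable.
- by move=> z; exact: shifted_increments_measurable.
Qed.

Lemma signature_functionalE tau o s t w : 0 <= tau -> 0 <= s -> s <= t ->
  SX o (tau + s) (tau + t) w =
    lyons_functional q (size w) (shifted_increments tau o) s t w.
Proof.
by move=> tau0 s0 st; rewrite (lyons_functionalE p1 (hS o) tau0).
Qed.

Lemma signature_measurable s t w : 0 <= s -> s <= t ->
  measurable_fun setT (fun o => SX o s t w).
Proof.
move=> s0 st.
rewrite (_ : (fun o => _) = (fun a : @families R increment (increments q) =>
    lyons_functional q (size w) a s t w) \o shifted_increments 0).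
  apply: measurableT_comp.
    by apply: lyons_functional_measurable => //; exact: increments_within_sub.
  by apply: family_measurable => z; exact: shifted_increments_measurable.
by apply/funext => o /=; rewrite -signature_functionalE// !add0r.
Qed.

(** The functional that computes the signature uses times in [[s, t]] only. *)
Lemma signature_sigma_of s t w (B : set R) : 0 <= s -> s <= t ->
  measurable B -> sigma_of X [set u | s <= u <= t] ((fun o => SX o s t w) @^-1` B).
Proof.
move=> s0 st mB; pose J := increments_within q s t : set (@increment R d).
rewrite (_ : _ @^-1` _ = shifted_increments 0 @^-1`
    ((fun a : @families R increment J =>
        lyons_functional q (size w) a s t w) @^-1` B)); last first.
  by apply/seteqP; split => o /=; rewrite -signature_functionalE// !add0r.
apply: (@cylinder_preimage _ _ Omega _ J).
- exact: sigma_of_sigma_algebra.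
- move=> [[u v] w'] B' [/= su uv vt w'q] mB'.
  rewrite /shifted_increments/= !add0r.
  have [_ _ H] := hXX.
  apply: sigma_of_sub (H u v w' B' (le_trans s0 su) uv w'q mB').
  by move=> r /= /andP[ur rv]; rewrite (le_trans su ur) (le_trans rv vt).
- rewrite -[X in <<s _ >> X]setTI.
  by apply: (@lyons_functional_measurable R d q (size w) J s t w).
Qed.

(** The [n]-th moment of a coordinate of degree [m] is controlled by the moment
    of order [n m] of the p-variation norm. *)
Lemma signature_all_moments s t w : 0 <= s -> s <= t ->
  all_moments P (fun o => SX o s t w).
Proof.
move=> s0 st; split; first exact: signature_measurable.
move=> n; have [/eqP|nw] := eqVneq (n * size w)%N 0%N.
  rewrite muln_eq0 => n0; rewrite (_ : (fun o => _) = cst 1%E).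
    by rewrite integral_cst//= probability_setT mule1 ltry.
  apply/funext => o; move: n0 => /orP[/eqP ->//|]; rewrite size_eq0 => /eqP ->.
  have [SF _] := hS o; have [[S1 _] _ _] := SF 0%N.
  by rewrite S1// normr1 expr1n.
have [C C0 HC] := lyons_extension_bound (d := d) (size w) p1.
have C1 : 0 < C + 1 by rewrite ltr_wpDl.
have t1 : 0 < t + 1 by rewrite ltr_wpDl// (le_trans s0).
have r1 : 1 <= (n * size w)%:R :> R by rewrite ler1n lt0n.
have [+ _] := hmoment; move=> /(_ _ _ r1 t1) [K HK].
have {}HK := HK s t s0 st; rewrite lerDl ler01 in HK; have {}HK := HK isT.
have mS := signature_measurable w s0 st.
(* Normalized by [C + 1], positive unlike [C], the integrand is below a power
   of the p-variation norm. *)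
rewrite (_ : (fun o => _) = (fun o => ((C + 1) ^+ n *
    (`|SX o s t w| ^+ n / (C + 1) ^+ n))%:E)); last first.
  by apply/funext => o; rewrite mulrC divfK// expf_neq0// gt_eqF.
rewrite ge0_integralZl_real; last 3 first.
- apply: measurable_funM; last exact: measurable_cst.
  exact: measurable_normX.
- by rewrite exprn_ge0// ltW.
- by move=> o; rewrite divr_ge0// exprn_ge0// ltW.
rewrite lte_mul_pinfty ?lee_fin ?exprn_ge0// ?(ltW C1)//.
apply: (@le_lt_trans _ _ (K * (t - s) `^ ((n * size w)%:R * beta))%:E);
  last by rewrite ltry.
apply: le_trans HK; apply: ge0_le_integral_nonmeasurable => o.
  by rewrite lee_fin divr_ge0// exprn_ge0// ltW.
have [Ag _ _] := hXX; rewrite (pvar_normE p1 (Ag o) s0 st) poweR_EFin lee_fin.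
rewrite ler_pdivrMr ?exprn_gt0//.
have om0 : 0 <= pvar_control p (XX o) s t.
  by have [H _] := superadditive_pvar_control p1 (Ag o); exact: H.
have := HC (XX o) (SX o) s t w (Ag o) (hS o) s0 st (leqnn _).
have -> : pvar_control p (XX o) s t `^ ((size w)%:R / p) =
    (pvar_control p (XX o) s t `^ p^-1) ^+ size w.
  by rewrite -powR_mulrn ?powR_ge0// -powRrM mulrC.
set z := pvar_control p (XX o) s t `^ p^-1 => H.
have z0 : 0 <= z by exact: powR_ge0.
rewrite powR_mulrn// mulnC exprM -exprMn lerXn2r//.
- by rewrite nnegrE mulr_ge0 ?exprn_ge0// ltW.
- by rewrite mulrC; apply: le_trans H _; rewrite ler_wpM2r ?exprn_ge0// lerDl.
Qed.

(** * Stationarity of the blocks *)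

Section blocks.
Variables (Delta : R).
Hypothesis (Delta0 : 0 < Delta).
Implicit Types (h k l m K n : nat).

Notation Z := (Zblock Delta SX).

Let D0 : 0 <= Delta. Proof. exact: ltW. Qed.

Let nD0 k : 0 <= k%:R * Delta. Proof. by rewrite mulr_ge0. Qed.

Let nDS k : k%:R * Delta <= k.+1%:R * Delta.
Proof. by rewrite ler_wpM2r// ler_nat. Qed.

Lemma block_start_ge0 k : 0 <= block_start Delta k.
Proof. exact: nD0. Qed.

Lemma block_start_le_end k : block_start Delta k <= block_end Delta k.
Proof. by rewrite /block_start /block_end ler_wpM2r// ler_nat leq_pred. Qed.

Lemma Zblock_all_moments k w : all_moments P (fun o => Z k o w).
Proof.
by apply: signature_all_moments; [exact: block_start_ge0|exact: block_start_le_end].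
Qed.

Definition block_functional h w (a : @families R (@increment R d) (increments q)) : R :=
  lyons_functional q (size w) a (h%:R * Delta) (h.+1%:R * Delta) w.

Lemma block_functional_measurable h w :
  measurable_fun setT (block_functional h w).
Proof.
by apply: lyons_functional_measurable => //; exact: increments_within_sub.
Qed.

(** Two blocks at distance [h] see the same functionals of a rough path restarted
    at the beginning of the first; hence moments and covariances of blocks depend
    on [h] only. *)
Lemma block_functionalE k h w o :
  Z (k.+1 + h) o w = block_functional h w (shifted_increments (k%:R * Delta) o).
Proof.
rewrite /block_functional -signature_functionalE//; congr (SX o _ _ w).
- by rewrite /block_start addSn/= natrD mulrDl.
- by rewrite /block_end addSnnS natrD mulrDl.
Qed.

Lemma mean_shifted k (F : @families R (@increment R d) (increments q) -> R) :
  measurable_fun setT F ->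
  mean P (fun o => F (shifted_increments (k%:R * Delta) o)) =
  mean P (fun o => F (shifted_increments (0%:R * Delta) o)).
Proof.
move=> mF; rewrite !meanE mul0r; congr fine.
exact: shifted_expectation.
Qed.

Lemma mean_block k w :
  mean P (fun o => Z k.+1 o w) = mean P (fun o => Z 1 o w).
Proof.
have := mean_shifted k (block_functional_measurable 0 w).
under eq_fun do rewrite -block_functionalE addn0.
by under [in RHS]eq_fun do rewrite -block_functionalE.
Qed.

Lemma moment_block k w n :
  moment P (fun o => Z k.+1 o w) n = moment P (fun o => Z 1 o w) n.
Proof.
have mF : measurable_fun setT
    (fun a : @families R (@increment R d) (increments q) =>
       `|block_functional 0 w a| ^+ n).
  by apply: measurable_normX; exact: block_functional_measurable.
have := mean_shifted k mF.
under eq_fun do rewrite -block_functionalE addn0.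
by under [in RHS]eq_fun do rewrite -block_functionalE.
Qed.

Lemma cov_block k h w :
  cov P (fun o => Z k.+1 o w) (fun o => Z (k.+1 + h) o w) =
  cov P (fun o => Z 1 o w) (fun o => Z h.+1 o w).
Proof.
rewrite /cov; congr (_ - _); last first.
  by rewrite addSn mean_block (mean_block (k + h)) [in RHS](mean_block h).
have mF : measurable_fun setT
    (fun a : @families R (@increment R d) (increments q) =>
       block_functional 0 w a * block_functional h w a).
  by apply: measurable_funM; exact: block_functional_measurable.
have := mean_shifted k mF.
under eq_fun do rewrite -!block_functionalE addn0.
by under [in RHS]eq_fun do rewrite -!block_functionalE.
Qed.

Lemma mean_mul_centered (f g : Omega -> R) : all_moments P f -> all_moments P g ->
  mean P (fun o => (f o - mean P f) * (g o - mean P g)) = cov P f g.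
Proof.
move=> hf hg; have cf := all_moments_cst P (mean P f).
have cg := all_moments_cst P (mean P g).
have fg := all_momentsM hf hg.
rewrite (_ : (fun o => _) = (fun o => f o * g o +
   (- mean P g * f o + (- mean P f * g o + mean P f * mean P g)))); last first.
  by apply/funext => o; ring.
have h1 := all_momentsZ (- mean P g) hf; have h2 := all_momentsZ (- mean P f) hg.
have h3 := all_moments_cst P (mean P f * mean P g).
have h4 := all_momentsD h2 h3.
rewrite meanD ?meanD ?meanZ ?mean_cst//; last exact: all_momentsD.
by rewrite /cov; ring.
Qed.

Notation W k := (centered P (Z k)).

Lemma centeredE k o w : W k o w = Z k o w - mean P (fun o => Z k o w).
Proof. by []. Qed.

Lemma centered_all_moments k w : all_moments P (fun o => W k o w).
Proof.
by apply: all_momentsB; [exact: Zblock_all_moments|exact: all_moments_cst].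
Qed.

Lemma mean_centered_mul k l w :
  mean P (fun o => W k o w * W l o w) =
  cov P (fun o => Z k o w) (fun o => Z l o w).
Proof.
by rewrite -mean_mul_centered//; exact: Zblock_all_moments.
Qed.

Lemma block_covE h m : block_cov P Delta SX h m =
  \sum_(w : m.-tuple 'I_d) cov P (fun o => Z 1 o w) (fun o => Z h.+1 o w).
Proof.
rewrite /block_cov -/(mean P _) /level_dot mean_sum.
  by apply: eq_bigr => w _; rewrite mean_centered_mul.
by move=> w; apply: all_momentsM; exact: centered_all_moments.
Qed.

Lemma block_cov0_ge0 m : 0 <= block_cov P Delta SX 0 m.
Proof.
rewrite block_covE; apply: sumr_ge0 => w _; rewrite -mean_centered_mul.
apply: mean_ge0 => [|o]; last by rewrite -expr2 sqr_ge0.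
by apply: all_momentsM; exact: centered_all_moments.
Qed.

Lemma sum_cov_blocks k l m : (k <= l)%N ->
  \sum_(w : m.-tuple 'I_d) cov P (fun o => Z k.+1 o w) (fun o => Z l.+1 o w) =
  block_cov P Delta SX (l - k) m.
Proof.
move=> kl; rewrite block_covE; apply: eq_bigr => w _.
by rewrite -(cov_block k) addSn subnKC.
Qed.

(** In a row of a Toeplitz matrix every nonzero lag occurs at most twice. *)
Lemma sum_distances_le (a : nat -> R) k K : (k < K)%N -> (forall h, 0 <= a h) ->
  \sum_(0 <= l < K) a (if (k <= l)%N then l - k else k - l)%N <=
  a 0%N + 2 * \sum_(1 <= h < K) a h.
Proof.
move=> kK a0; rewrite (@big_cat_nat _ _ _ k)//= ?(ltnW kK)//.
rewrite [X in _ + X]big_ltn// leqnn subnn addrCA lerD2l mulr_natl mulr2n.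
have sub n : (n <= K)%N -> \sum_(1 <= h < n) a h <= \sum_(1 <= h < K) a h.
  move=> nK; case: n nK => [|n] nK; first by rewrite big_geq// sumr_ge0.
  by rewrite [leRHS](@big_cat_nat _ _ _ n.+1)//= lerDl sumr_ge0.
apply: lerD.
  rewrite big_nat_rev/= add0n.
  apply: le_trans (sub k.+1 kK); rewrite big_add1/=.
  apply: ler_sum_nat => i /andP[_ ik].
  by rewrite leqNgt (_ : (k - i.+1 < k)%N) ?subKn//; lia.
apply: le_trans (sub (K - k)%N (leq_subr _ _)).
rewrite -{1}(add1n k) big_addn; apply: ler_sum_nat => i /andP[i1 _].
by rewrite leq_addl addnK.
Qed.

(** The double sum over pairs of blocks is at most [K] times the sum over the
    lags. *)
Lemma level_variance_le m K : (1 <= K)%N ->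
  mean P (fun o => level_norm m
    (block_average (fun k => centered P (Z k)) K o) ^+ 2) <=
  K%:R^-1 * VlevelK P Delta SX m K.
Proof.
move=> K1; have KR : (0 : R) < K%:R by rewrite ltr0n.
pose A w o := \sum_(1 <= k < K.+1) W k o w.
have hA w : all_moments P (A w).
  by apply: all_moments_sum => k; exact: centered_all_moments.
rewrite (_ : (fun o => _) = (fun o => K%:R^-1 ^+ 2 *
    \sum_(w : m.-tuple 'I_d) A w o * A w o)); last first.
  apply/funext => o; rewrite sqr_sqrtr ?level_dot_ge0// mulr_sumr.
  by apply: eq_bigr => w _; rewrite /block_average -/(A w o); ring.
have hAA w : all_moments P (fun o => A w o * A w o) by exact: all_momentsM.
rewrite meanZ; last by apply: all_moments_sum => w; exact: hAA.
rewrite expr2 -mulrA ler_pM2l ?invr_gt0// ler_pdivrMl//.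
rewrite mean_sum; last by move=> w; exact: hAA.
have EA w : mean P (fun o => A w o * A w o) = \sum_(1 <= k < K.+1)
    \sum_(1 <= l < K.+1) cov P (fun o => Z k o w) (fun o => Z l o w).
  rewrite (_ : (fun o => _) = (fun o => \sum_(1 <= k < K.+1)
      \sum_(1 <= l < K.+1) W k o w * W l o w)); last first.
    by apply/funext => o; rewrite /A mulr_suml; apply: eq_bigr => k _;
      rewrite mulr_sumr.
  have hW k l : all_moments P (fun o => W k o w * W l o w).
    by apply: all_momentsM; exact: centered_all_moments.
  rewrite mean_sum; last by move=> k; apply: all_moments_sum.
  apply: eq_bigr => k _; rewrite mean_sum//.
  by apply: eq_bigr => l _; rewrite mean_centered_mul.
under eq_bigr do rewrite EA.
rewrite exchange_big/=; under eq_bigr do rewrite exchange_big/=.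
apply: (@le_trans _ _ (\sum_(0 <= k < K) VlevelK P Delta SX m K)); last first.
  by rewrite sumr_const_nat subn0 mulr_natl.
rewrite big_add1/=; apply: ler_sum_nat => k /andP[_ kK].
rewrite big_add1/= /VlevelK -{1}(ger0_norm (block_cov0_ge0 m)).
apply: le_trans (sum_distances_le (a := fun h => `|block_cov P Delta SX h m|) kK _) => //.
apply: ler_sum_nat => l _; case: leqP => [kl|/ltnW lk].
  by rewrite sum_cov_blocks// ler_norm.
under eq_bigr do rewrite covC.
by rewrite sum_cov_blocks// ler_norm.
Qed.

(** * Degrees 0 and 1 *)

Lemma Zblock_nil k o : Z k o [::] = 1.
Proof.
have [SF _] := hS o; have [[S1 _] _ _] := SF 0%N.
by rewrite /Zblock S1 ?block_start_ge0 ?block_start_le_end.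
Qed.

Lemma centered_nil k o : W k o [::] = 0.
Proof.
rewrite centeredE Zblock_nil.
by under eq_fun do rewrite Zblock_nil; rewrite mean_cst subrr.
Qed.

Lemma signature_letter s t i o : 0 <= s -> s <= t ->
  SX o s t [:: i] = X o t ord0 i - X o s ord0 i.
Proof.
move=> s0 st; have [_ SA] := hS o; have [_ XA _] := hXX.
by rewrite SA ?XA.
Qed.

Lemma increment_all_moments t i : 0 <= t ->
  all_moments P (fun o => X o t ord0 i - X o 0 ord0 i).
Proof.
move=> t0; rewrite (_ : (fun o => _) = fun o => SX o 0 t [:: i]).
  exact: signature_all_moments.
by apply/funext => o; rewrite signature_letter.
Qed.

Definition level_variance m K : R := mean P (fun o =>
  level_norm m (block_average (fun k => W k) K o) ^+ 2).

Lemma level_norm_sqr m (a : tensor R d) :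
  level_norm m a ^+ 2 = \sum_(w : m.-tuple 'I_d) a w ^+ 2.
Proof.
rewrite sqr_sqrtr ?level_dot_ge0//; by apply: eq_bigr => w _; rewrite expr2.
Qed.

Lemma hs_norm_sqr M (a : tensor R d) :
  hs_norm M a ^+ 2 = \sum_(m < M.+1) level_norm m a ^+ 2.
Proof. by rewrite sqr_sqrtr// sumr_ge0// => m _; rewrite sqr_ge0. Qed.

Lemma average_all_moments K w :
  all_moments P (fun o => block_average (fun k => W k) K o w).
Proof.
apply: all_momentsZ; apply: all_moments_sum => k; exact: centered_all_moments.
Qed.

Lemma level_all_moments m K :
  all_moments P (fun o => level_norm m (block_average (fun k => W k) K o) ^+ 2).
Proof.
rewrite (_ : (fun o => _) = fun o => \sum_(w : m.-tuple 'I_d)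
    block_average (fun k => W k) K o w ^+ 2).
  apply: all_moments_sum => w; apply: all_momentsX.
  exact: average_all_moments.
by apply/funext => o; rewrite level_norm_sqr.
Qed.

Lemma variance_termE M K :
  variance_term P Delta M SX K = (\sum_(m < M.+1) level_variance m K)%:E.
Proof.
rewrite /variance_term; under eq_fun do rewrite hs_norm_sqr.
rewrite expectationE; last by apply: all_moments_sum => m; exact: level_all_moments.
by rewrite mean_sum// => m; exact: level_all_moments.
Qed.

Lemma level_variance0 K : level_variance 0 K = 0.
Proof.
rewrite /level_variance (_ : (fun o => _) = fun=> 0) ?mean_cst//.
apply/funext => o; rewrite level_norm_sqr big1// => w _.
rewrite tuple0/= /block_average big1 ?mulr0 ?expr0n//.
by move=> k _; exact: centered_nil.
Qed.

Lemma big_tuple1 (f : seq 'I_d -> R) :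
  \sum_(w : 1.-tuple 'I_d) f w = \sum_(i < d) f [:: i].
Proof.
rewrite (reindex (fun i : 'I_d => [tuple i]))//=.
exists (fun w : 1.-tuple 'I_d => thead w) => [i _|w _]; first exact: theadE.
apply: val_inj; case: (tupleP w) => i w'; rewrite theadE/=.
by rewrite (tuple0 w').
Qed.

(** In degree 1 the signature is additive, so the sum over consecutive blocks
    telescopes. *)
Lemma sum_centered_letter K o i : \sum_(1 <= k < K.+1) W k o [:: i] =
  X o (K%:R * Delta) ord0 i - X o 0 ord0 i -
  mean P (fun o => X o (K%:R * Delta) ord0 i - X o 0 ord0 i).
Proof.
have sumZ o' : \sum_(1 <= k < K.+1) Z k o' [:: i] =
    X o' (K%:R * Delta) ord0 i - X o' 0 ord0 i.
  have := @telescope_sumr R 0 K (fun k => X o' (k%:R * Delta) ord0 i) (leq0n K).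
  rewrite mul0r => <-; rewrite big_add1/=.
  by apply: eq_bigr => k _; rewrite /Zblock signature_letter ?block_start_ge0 ?block_start_le_end.
rewrite -sumZ (_ : (fun o => X o _ _ _ - _) =
    (fun o => \sum_(1 <= k < K.+1) Z k o [:: i])); last by apply/funext => o'; rewrite sumZ.
rewrite mean_sum; last by move=> k; exact: Zblock_all_moments.
by rewrite -sumrB.
Qed.

Lemma vector_varianceE t : 0 <= t ->
  vector_variance P (fun o => X o t - X o 0) = (\sum_(i < d)
    cov P (fun o => X o t ord0 i - X o 0 ord0 i)
          (fun o => X o t ord0 i - X o 0 ord0 i))%:E.
Proof.
move=> t0; have h i := increment_all_moments i t0.
rewrite /vector_variance (_ : (fun o => _) = fun o => \sum_(i < d)
   (X o t ord0 i - X o 0 ord0 i -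
     mean P (fun o => X o t ord0 i - X o 0 ord0 i)) *
   (X o t ord0 i - X o 0 ord0 i -
     mean P (fun o => X o t ord0 i - X o 0 ord0 i))); last first.
  apply/funext => o; rewrite sqr_sqrtr; last by rewrite sumr_ge0// => i _; rewrite sqr_ge0.
  apply: eq_bigr => i _; rewrite !mxE -expr2; congr ((_ - _) ^+ 2).
  by congr fine; congr expectation; apply/funext => o'; rewrite !mxE.
have h2 i : all_moments P (fun o => (X o t ord0 i - X o 0 ord0 i -
     mean P (fun o => X o t ord0 i - X o 0 ord0 i)) *
   (X o t ord0 i - X o 0 ord0 i -
     mean P (fun o => X o t ord0 i - X o 0 ord0 i))).
  by apply: all_momentsM; apply: all_momentsB; rewrite //; exact: all_moments_cst.
rewrite expectationE; last exact: all_moments_sum.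
by rewrite mean_sum//; congr EFin; apply: eq_bigr => i _; rewrite mean_mul_centered.
Qed.

Lemma level_variance1 K : (level_variance 1 K)%:E =
  ((K%:R ^- 2)%:E * vector_variance P (fun o => X o (K%:R * Delta)%R - X o 0)%R)%E.
Proof.
have h i := increment_all_moments i (nD0 K).
rewrite vector_varianceE// -EFinM; congr EFin.
rewrite /level_variance (_ : (fun o => _) = fun o => K%:R ^- 2 * \sum_(i < d)
   (X o (K%:R * Delta) ord0 i - X o 0 ord0 i -
     mean P (fun o => X o (K%:R * Delta) ord0 i - X o 0 ord0 i)) *
   (X o (K%:R * Delta) ord0 i - X o 0 ord0 i -
     mean P (fun o => X o (K%:R * Delta) ord0 i - X o 0 ord0 i))); last first.
  apply/funext => o; rewrite level_norm_sqr.
  rewrite (big_tuple1 (fun w => block_average (fun k => W k) K o w ^+ 2)) mulr_sumr.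
  apply: eq_bigr => i _; rewrite /block_average sum_centered_letter.
  by rewrite exprMn exprVn -expr2.
have h2 i : all_moments P (fun o => (X o (K%:R * Delta) ord0 i - X o 0 ord0 i -
     mean P (fun o => X o (K%:R * Delta) ord0 i - X o 0 ord0 i)) *
   (X o (K%:R * Delta) ord0 i - X o 0 ord0 i -
     mean P (fun o => X o (K%:R * Delta) ord0 i - X o 0 ord0 i))).
  by apply: all_momentsM; apply: all_momentsB; rewrite //; exact: all_moments_cst.
rewrite meanZ; last exact: all_moments_sum.
by rewrite mean_sum//; congr (_ * _); apply: eq_bigr => i _; rewrite mean_mul_centered.
Qed.

Lemma coordinate_measurable_at t i : 0 <= t ->
  measurable_fun setT (fun o => X o t ord0 i).
Proof. by move=> t0; have [+ _] := hX; apply. Qed.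

Lemma stationary_coordinate t i (f : R -> R) : 0 <= t -> measurable_fun setT f ->
  (\int[P]_o (f (X o t ord0 i))%:E = \int[P]_o (f (X o 0 ord0 i))%:E)%E.
Proof.
move=> t0 mf; pose J : set unit := setT.
have mX u : 0 <= u -> forall j : unit, J j ->
    measurable_fun setT (fun o => X o u ord0 i).
  by move=> u0 _ _; exact: coordinate_measurable_at.
apply: (@same_law_expectation _ _ _ P _ J (fun o _ => X o t ord0 i)
  (fun o _ => X o 0 ord0 i) (fun a : families J => f (a tt))).
- exact: mX.
- exact: mX.
- move=> n j B H; have [HX _] := hstat t0.
  have := HX n (fun=> (0, i)) B.
  by rewrite /= addr0; apply => k; split => //=; have [] := H k.
- by apply: measurableT_comp => //; exact: coordinate_measurable.
Qed.

Lemma variance_coordinate_fin i (mu : R) :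
  (\int[P]_o ((X o 0 ord0 i - mu) ^+ 2)%:E < +oo)%E.
Proof.
have mX := coordinate_measurable_at i (lexx 0).
have [_] := hmoment; rewrite unlock => H0.
have sq (x y : R) : (x - y) ^+ 2 <= 2 * x ^+ 2 + 2 * y ^+ 2.
  by have := sqr_ge0 (x + y); rewrite !expr2 => ?; lra.
apply: (@le_lt_trans _ _ (\int[P]_o (2 * X o 0 ord0 i ^+ 2 + 2 * mu ^+ 2)%:E)%E).
  apply: ge0_le_integral_nonmeasurable => o; rewrite lee_fin ?sqr_ge0//; exact: sq.
rewrite ge0_integralD_real//; last 3 first.
- by apply: measurable_funM; [exact: measurable_cst|exact: measurable_funX].
- by move=> o; rewrite mulr_ge0// sqr_ge0.
- by move=> o; rewrite mulr_ge0// sqr_ge0.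
rewrite lte_add_pinfty//; last first.
  by rewrite integral_cst//= probability_setT mule1 ltry.
rewrite ge0_integralZl_real//; [|exact: measurable_funX|by move=> o; rewrite sqr_ge0].
rewrite lte_mul_pinfty ?lee_fin//.
apply: le_lt_trans H0; apply: ge0_le_integral_nonmeasurable => o.
  by rewrite lee_fin sqr_ge0.
rewrite lee_fin sqr_sqrtr; last by rewrite sumr_ge0// => j _; rewrite sqr_ge0.
by rewrite (bigD1 i)//= lerDl sumr_ge0// => j _; rewrite sqr_ge0.
Qed.

(** The variance is at most the second moment. With [mu] the mean of [X_0],
    [X_t - X_0 = (X_t - mu) - (X_0 - mu)] is a difference of two variables with
    the same law. *)
Lemma vector_variance_le t : 0 <= t ->
  (vector_variance P (fun o => X o t - X o 0)%R <=
     (4 * \tr (cov_matrix P (fun o => X o 0%R)))%:E)%E.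
Proof.
move=> t0; rewrite vector_varianceE// lee_fin /mxtrace mulr_sumr.
apply: ler_sum => i _; rewrite mxE.
have hU := increment_all_moments i t0.
pose mu := fine 'E_P[fun o => X o 0 ord0 i].
have -> : covariance P (fun o => X o 0 ord0 i) (fun o => X o 0 ord0 i) =
    (\int[P]_o ((X o 0 ord0 i - mu) ^+ 2)%:E)%E.
  by rewrite covariance.unlock -/mu expectation.unlock.
set V := (\int[P]_o _)%E.
have VE : V = (fine V)%:E.
  rewrite fineK// ge0_fin_numE ?variance_coordinate_fin//.
  by apply: integral_ge0 => o _; rewrite lee_fin sqr_ge0.
have VtE : (\int[P]_o ((X o t ord0 i - mu) ^+ 2)%:E = V)%E.
  apply: (stationary_coordinate i (f := fun x => (x - mu) ^+ 2)) => //.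
  by apply: measurable_funX; apply: measurable_funB => //; exact: measurable_cst.
have mt u : 0 <= u -> measurable_fun setT (fun o => (X o u ord0 i - mu) ^+ 2).
  move=> u0; apply: measurable_funX; apply: measurable_funB; last exact: measurable_cst.
  exact: coordinate_measurable_at.
set U := fun o => _; apply: (@le_trans _ _ (mean P (fun o => U o * U o))).
  by rewrite /cov lerBlDr lerDl -expr2 sqr_ge0.
rewrite -lee_fin -expectationE; last exact: all_momentsM.
rewrite EFinM -VE unlock.
apply: (@le_trans _ _ (\int[P]_o (2 * (X o t ord0 i - mu) ^+ 2 +
                                   2 * (X o 0 ord0 i - mu) ^+ 2)%:E)%E).
  apply: ge0_le_integral_nonmeasurable => o; rewrite lee_fin /U -expr2 ?sqr_ge0//.
  by have := sqr_ge0 (X o t ord0 i - mu + (X o 0 ord0 i - mu)); rewrite !expr2 => ?; lra.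
rewrite ge0_integralD_real//; last 4 first.
- by apply: measurable_funM; [exact: measurable_cst|exact: mt].
- by apply: measurable_funM; [exact: measurable_cst|exact: mt].
- by move=> o; rewrite mulr_ge0// sqr_ge0.
- by move=> o; rewrite mulr_ge0// sqr_ge0.
rewrite !ge0_integralZl_real//; try (by move=> o; rewrite sqr_ge0); try exact: mt.
by rewrite VtE -/V VE -!EFinM -EFinD lee_fin -mulrDl; lra.
Qed.

Lemma V1_le : (V1 P X <= (4 * \tr (cov_matrix P (fun o => X o 0%R)))%:E)%E.
Proof.
by apply: ge_ereal_sup => _ [t /ltW t0 <-]; exact: vector_variance_le.
Qed.

Lemma level1_varianceE K : level1_variance P Delta SX K = (level_variance 1 K)%:E.
Proof. by rewrite /level1_variance expectationE//; exact: level_all_moments. Qed.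

Lemma vector_variance_le_V1 t : 0 < t ->
  (vector_variance P (fun o => X o t - X o 0)%R <= V1 P X)%E.
Proof. by move=> t0; apply: ereal_sup_ubound; exists t. Qed.

Lemma V1_fin : V1 P X = (fine (V1 P X))%:E /\ 0 <= fine (V1 P X).
Proof.
have V0 : (0 <= V1 P X)%E.
  apply: le_trans (vector_variance_le_V1 ltr01).
  rewrite /vector_variance unlock; apply: integral_ge0 => o _.
  by rewrite lee_fin sqr_ge0.
split; last exact: fine_ge0.
rewrite fineK// ge0_fin_numE//; apply: le_lt_trans V1_le _; exact: ltry.
Qed.

Lemma level_variance1_le K : (1 <= K)%N ->
  level_variance 1 K <= K%:R ^- 2 * fine (V1 P X).
Proof.
move=> K1; rewrite -lee_fin level_variance1 EFinM -(V1_fin.1).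
apply: lee_wpmul2l; first by rewrite lee_fin invr_ge0 exprn_ge0.
by apply: vector_variance_le_V1; rewrite mulr_gt0// ltr0n.
Qed.

Definition twice_variance M K : R := 2 * \sum_(m < M.+1) level_variance m K.

Lemma twice_variance_le M K : (1 <= M)%N -> (1 <= K)%N ->
  twice_variance M K <= 2 * (K%:R ^- 2 * fine (V1 P X)) +
    2 * (K%:R^-1 * \sum_(2 <= m < M.+1) VlevelK P Delta SX m K).
Proof.
move=> M1 K1; rewrite -mulrDr ler_pM2l//.
rewrite -(big_mkord xpredT (fun m => level_variance m K)).
rewrite big_ltn// level_variance0 add0r big_ltn//; apply: lerD.
  exact: level_variance1_le.
by rewrite mulr_sumr; apply: ler_sum => m _; exact: level_variance_le.
Qed.

Lemma variance_term_le M K : (2%:E * variance_term P Delta M SX K <=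
  (twice_variance M K)%:E)%E.
Proof. by rewrite variance_termE -EFinM. Qed.

(** * Mean square error *)

(** The squared discretization error over one block, as a function of the rough
    path restarted at the beginning of the block. *)
Definition approximation_functional M n
    (a : @families R (@increment R d) (increments q)) : R :=
  \sum_(m < M.+1) \sum_(w : m.-tuple 'I_d)
    (lyons_functional q (size w) a 0 Delta w -
     interpolation_functional (Delta / n.-1%:R) n (rev w) a Delta) ^+ 2.

Lemma approximation_functional_measurable M n :
  measurable_fun setT (approximation_functional M n).
Proof.
rewrite /approximation_functional; apply: measurable_sum => m.
apply: measurable_sum => w; apply: measurable_funX; apply: measurable_funB.
  by apply: lyons_functional_measurable => //; exact: increments_within_sub.
by apply: interpolation_functional_measurable => //; rewrite divr_ge0.
Qed.

Lemma approximation_functionalE M n k o : (2 <= n)%N ->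
  hs_norm M (tensor_sub (Z k.+1 o) (Yblock Delta X n k.+1 o)) ^+ 2 =
  approximation_functional M n (shifted_increments (k%:R * Delta) o).
Proof.
move=> n2; rewrite hs_norm_sqr; apply: eq_bigr => m _.
rewrite level_norm_sqr; apply: eq_bigr => w _; congr (_ ^+ 2).
have n0 : (0 : R) < n.-1%:R by rewrite ltr0n; case: n n2 => [|[]].
have endE : block_end Delta k.+1 = k%:R * Delta + Delta.
  by rewrite /block_end -natr1 mulrDl mul1r.
rewrite /tensor_sub -signature_functionalE// addr0; congr (_ - _).
  by rewrite /Zblock endE.
rewrite (@interpolation_functionalE _ _ (X o) (k%:R * Delta)) //.
- by rewrite /Yblock /bv_signature endE.
- by rewrite divr_gt0.
- move=> v i v0; rewrite /shifted_increments/= addr0.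
  have [_ H _] := hXX; apply: H; first exact: nD0.
  by rewrite lerDl.
- by rewrite mulrC divfK ?D0 ?lexx// gt_eqF.
Qed.

Lemma approximation_block_le M n k Capprox gamma : (2 <= n)%N ->
  discretization_rate P Delta M X SX Capprox gamma ->
  (\int[P]_o (approximation_functional M n (shifted_increments (k%:R * Delta) o))%:E
    <= (Capprox * (Delta `^ gamma / n.-1%:R `^ gamma))%:E)%E.
Proof.
move=> n2 [_ _ /(_ n n2)].
have mF := approximation_functional_measurable M n.
rewrite (shifted_expectation (nD0 k) mF) -(shifted_expectation (nD0 0) mF).
have -> : Delta `^ gamma / n.-1%:R `^ gamma = (Delta / n.-1%:R) `^ gamma :> R.
  by rewrite -powRN powRM ?D0 ?invr_ge0// -powR_inv1// -powRrM mulN1r.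
rewrite unlock /= => H; apply: (le_trans _ H).
apply: ge0_le_integral_nonmeasurable => o; rewrite lee_fin.
  by rewrite -approximation_functionalE// sqr_ge0.
rewrite -approximation_functionalE// /Zblock /Yblock /block_start /block_end/=.
by rewrite mul0r mul1r.
Qed.

Lemma sqr_average_le (a : nat -> R) K : (1 <= K)%N ->
  (K%:R^-1 * \sum_(0 <= k < K) a k) ^+ 2 <= K%:R^-1 * \sum_(0 <= k < K) a k ^+ 2.
Proof.
move=> K1; have K0 : (0 : R) < K%:R by rewrite ltr0n.
set av := K%:R^-1 * _; have S : \sum_(0 <= k < K) a k = K%:R * av.
  by rewrite /av mulrA divff ?mul1r// gt_eqF.
have : 0 <= \sum_(0 <= k < K) (a k - av) ^+ 2.
  by apply: sumr_ge0 => k _; rewrite sqr_ge0.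
under eq_bigr do rewrite sqrrB.
rewrite big_split/= sumrB sumr_const_nat subn0 sumrMnl -mulr_suml S => H.
rewrite ler_pdivlMl// -subr_ge0; apply: le_trans H _.
by rewrite -[X in _ + X]mulr_natl le_eqVlt; apply/orP; left; apply/eqP; ring.
Qed.

(** The average of the discretization errors is treated by Jensen's inequality,
    the centered average is kept as it is. *)
Lemma sqr_error_le n K w o : (1 <= K)%N ->
  (block_average (Yblock Delta X n) K o w - mean P (fun o => Z 1 o w)) ^+ 2 <=
  2 * (K%:R^-1 * \sum_(0 <= k < K) (Z k.+1 o w - Yblock Delta X n k.+1 o w) ^+ 2)
  + 2 * block_average (fun k => W k) K o w ^+ 2.
Proof.
move=> K1; have K0 : (0 : R) < K%:R by rewrite ltr0n.
have -> : block_average (Yblock Delta X n) K o w - mean P (fun o => Z 1 o w) =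
    block_average (fun k => W k) K o w -
    K%:R^-1 * \sum_(0 <= k < K) (Z k.+1 o w - Yblock Delta X n k.+1 o w).
  rewrite /block_average !big_add1/=.
  under [in RHS]eq_bigr do rewrite centeredE mean_block.
  have e (c : R) : K%:R^-1 * (c *+ K) = c.
    by rewrite -[c *+ K]mulr_natl mulrA mulVf ?gt_eqF// mul1r.
  by rewrite !sumrB sumr_const_nat subn0 !mulrBr e; ring.
apply: (@le_trans _ _ (2 * (K%:R^-1 * \sum_(0 <= k < K)
    (Z k.+1 o w - Yblock Delta X n k.+1 o w)) ^+ 2 +
    2 * block_average (fun k => W k) K o w ^+ 2)); last first.
  by rewrite lerD2r ler_pM2l//; exact: sqr_average_le.
move: (block_average _ _ _ _) (K%:R^-1 * _) => x y.
by rewrite -subr_ge0 (_ : _ - _ = (x + y) ^+ 2) ?sqr_ge0//; ring.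
Qed.

Lemma mse_le M n K Capprox gamma : (1 <= K)%N -> (2 <= n)%N ->
  discretization_rate P Delta M X SX Capprox gamma ->
  (mse P Delta M X SX K n <= (2 * Capprox * Delta `^ gamma / n.-1%:R `^ gamma +
     twice_variance M K)%:E)%E.
Proof.
move=> K1 n2 hdisc; have K0 : (0 : R) < K%:R by rewrite ltr0n.
have F0 k o : 0 <= approximation_functional M n (shifted_increments (k%:R * Delta) o).
  by rewrite -approximation_functionalE// sqr_ge0.
have mF k : measurable_fun setT (fun o =>
    approximation_functional M n (shifted_increments (k%:R * Delta) o)).
  have mU : measurable_fun setT (shifted_increments (k%:R * Delta) :
      Omega -> @families R increment (increments q)).
    by apply: family_measurable => z; exact: shifted_increments_measurable.
  exact: measurableT_comp (approximation_functional_measurable M n) mU.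
pose H o := hs_norm M (block_average (fun k => W k) K o) ^+ 2.
have mH : measurable_fun setT H.
  rewrite /H; under eq_fun do rewrite hs_norm_sqr.
  by have [] : all_moments P (fun o => \sum_(m < M.+1)
    level_norm m (block_average (fun k => W k) K o) ^+ 2)
    by apply: all_moments_sum => m; exact: level_all_moments.
have mS : measurable_fun setT (fun o => \sum_(0 <= k < K)
    approximation_functional M n (shifted_increments (k%:R * Delta) o)).
  exact: measurable_sum.
have S0 o : 0 <= \sum_(0 <= k < K)
    approximation_functional M n (shifted_increments (k%:R * Delta) o).
  by apply: sumr_ge0 => k _.
apply: (@le_trans _ _ (\int[P]_o (2 * K%:R^-1 * (\sum_(0 <= k < K)
    approximation_functional M n (shifted_increments (k%:R * Delta) o)) +
    2 * H o)%:E)%E).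
  rewrite /mse unlock; apply: ge0_le_integral_nonmeasurable => o.
    by rewrite lee_fin sqr_ge0.
  rewrite lee_fin /H !hs_norm_sqr.
  under [in leRHS]eq_bigr do rewrite -approximation_functionalE// hs_norm_sqr.
  rewrite exchange_big/= !mulr_sumr -big_split/=; apply: ler_sum => m _.
  under [in leRHS]eq_bigr do rewrite level_norm_sqr.
  rewrite !level_norm_sqr exchange_big/= !mulr_sumr -big_split/=.
  by apply: ler_sum => w _; rewrite -mulrA; exact: sqr_error_le.
have H0 o : 0 <= H o by rewrite sqr_ge0.
have K20 : 0 <= 2 * K%:R^-1 :> R by rewrite mulr_ge0// invr_ge0 ltW.
rewrite ge0_integralD_real; last 4 first.
- by apply: measurable_funM => //; exact: measurable_cst.
- by apply: measurable_funM => //; exact: measurable_cst.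
- by move=> o; rewrite mulr_ge0.
- by move=> o; rewrite mulr_ge0.
rewrite !ge0_integralZl_real// [leRHS]EFinD.
apply: leeD; last first.
  by have := variance_term_le M K; rewrite /variance_term unlock.
rewrite ge0_integral_sum_real//.
apply: (@le_trans _ _ ((2 * K%:R^-1)%:E * \sum_(0 <= k < K)
   (Capprox * (Delta `^ gamma / n.-1%:R `^ gamma))%:E)%E).
  apply: lee_wpmul2l; first by rewrite lee_fin.
  by apply: lee_sum => k _; exact: approximation_block_le.
rewrite sumEFin -EFinM lee_fin sumr_const_nat subn0 -[X in _ * X]mulr_natl.
by rewrite -!mulrA ler_pM2l// [leLHS]mulrA mulVf ?gt_eqF// mul1r.
Qed.

(** * Covariance decay under mixing *)

(** The time [h Delta] separates the end of block 1 from the beginning of block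
    [h + 2]. *)
Lemma block_dependence h w (a : R) :
  (alpha_mixing_coef P X (h%:R * Delta) <= a%:E)%E ->
  dependence_le P (fun o => Z 1 o w) (fun o => Z h.+2 o w) a.
Proof.
move=> Ha B1 B2 mB1 mB2.
have D2 : 0 <= block_start Delta h.+2 by exact: block_start_ge0.
have S1 : sigma_of X [set u | 0 <= u <= Delta] ((fun o => Z 1 o w) @^-1` B1).
  apply: (sigma_of_sub (D := [set u | block_start Delta 1 <= u <= block_end Delta 1])).
    by move=> u; rewrite /= /block_start /block_end/= mul0r mul1r.
  by apply: signature_sigma_of => //;
    [exact: block_start_ge0|exact: block_start_le_end].
have S2 : sigma_of X [set u | Delta + h%:R * Delta <= u]
    ((fun o => Z h.+2 o w) @^-1` B2).
  apply: (sigma_of_sub (D := [set u | block_start Delta h.+2 <= u <= block_end Delta h.+2])).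
    move=> u /= /andP[+ _]; apply: le_trans.
    by rewrite /block_start/= -natr1 mulrDl mul1r addrC.
  by apply: signature_sigma_of => //; exact: block_start_le_end.
have m1 : measurable ((fun o => Z 1 o w) @^-1` B1).
  by apply: sigma_of_measurable S1 => u /andP[].
have m2 : measurable ((fun o => Z h.+2 o w) @^-1` B2).
  apply: sigma_of_measurable S2 => u /=; apply: le_trans.
  by rewrite addr_ge0.
rewrite -lee_fin; apply: le_trans Ha; apply: ereal_sup_ubound.
exists Delta, ((fun o => Z 1 o w) @^-1` B1), ((fun o => Z h.+2 o w) @^-1` B2).
split => //.
rewrite -[LHS]/(`|(_ - _)%:E|%E) EFinB EFinM.
by rewrite !fineK//; apply: fin_num_measure => //; exact: measurableI.
Qed.

(** The constant of Davydov's inequality for a coordinate of two blocks. *)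
Definition block_moments r w : R :=
  4 + 2 * ((1 + moment P (fun o => Z 1 o w) 2) *
           (1 + moment P (fun o => Z 1 o w) (r.+1 * 2))) +
  2 * ((1 + moment P (fun o => Z 1 o w) 2) *
       (1 + moment P (fun o => Z 1 o w) (r.+1 * 2))).

Lemma block_moments_ge0 r w : 0 <= block_moments r w.
Proof.
have h n : 0 <= 1 + moment P (fun o => Z 1 o w) n.
  by rewrite addr_ge0// moment_ge0//; exact: Zblock_all_moments.
by rewrite !addr_ge0// !mulr_ge0.
Qed.

Lemma block_cov_mixing_le h m r (a : R) : 0 < a ->
  (alpha_mixing_coef P X (h%:R * Delta) <= a%:E)%E ->
  `|block_cov P Delta SX h.+1 m| <=
    (\sum_(w : m.-tuple 'I_d) block_moments r w) * a `^ (r%:R / r.+2%:R).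
Proof.
move=> a0 Ha; rewrite block_covE mulr_suml.
apply: le_trans (ler_norm_sum _ _ _) _; apply: ler_sum => w _.
have hZ k : all_moments P (fun o => Z k o w) by exact: Zblock_all_moments.
have := davydov r (hZ 1%N) (hZ h.+2) a0 (block_dependence w Ha).
by rewrite !(moment_block h.+1).
Qed.

Lemma mixing_exp_poly (CX l : R) : mixing_exp P X CX l ->
  mixing_poly P X (CX * (2 + 4 / l ^+ 2)) 2.
Proof.
move=> [C0 l0 H].
have c0 : 0 < 2 + 4 / l ^+ 2 by rewrite ltr_wpDr// divr_ge0// exprn_ge0// ltW.
split; [exact: mulr_gt0|by []|move=> t t0; apply: le_trans (H t t0) _].
by rewrite lee_fin -mulrA ler_pM2l// expRN_le_powR.
Qed.

Lemma powR_le_powRN (x y a b : R) : 0 < x -> 0 < y -> x * y <= a -> 0 <= b ->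
  a `^ (- b) <= x `^ (- b) * y `^ (- b).
Proof.
move=> x0 y0 xy b0; rewrite -powRM ?(ltW x0) ?(ltW y0)// !powRN.
have xy0 : 0 < x * y by exact: mulr_gt0.
rewrite lef_pV2 ?posrE ?powR_gt0 ?(lt_le_trans xy0)//.
by rewrite ge0_ler_powR// nnegrE ?(ltW xy0)// (le_trans _ xy)// ltW.
Qed.

(** Davydov's inequality costs a factor [r / (r + 2)] in the exponent of the
    mixing rate, which tends to 1 as the number of moments used grows. *)
Lemma mixing_covariance_decay CX nu nu' m : mixing_poly P X CX nu ->
  0 < nu' < nu -> exists2 D, 0 <= D &
  forall h, (1 <= h)%N -> `|block_cov P Delta SX h m| <= D * psi_poly nu' h.
Proof.
move=> [C0 nu0 H] /andP[nu'0 nu'nu].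
have nn0 : 0 < nu - nu' by rewrite subr_gt0.
(* Large enough for [nu r / (r + 2) >= nu']. *)
pose r := (Num.truncn (2 * nu' / (nu - nu'))).+1.
pose th : R := r%:R / r.+2%:R.
have th0 : 0 < th by rewrite divr_gt0.
have thnu : nu' <= nu * th.
  rewrite mulrA ler_pdivlMr// -addn2 natrD.
  have : 2 * nu' / (nu - nu') < r%:R by exact: truncnS_gt.
  by rewrite ltr_pdivrMr// => ?; lra.
(* The gap before block [h + 2] is [h Delta], and
   [1 + h Delta >= kap (2 + h)]. *)
pose kap : R := Num.min 2^-1 Delta.
have kap0 : 0 < kap by rewrite lt_min invr_gt0 ltr0n Delta0.
pose D := (\sum_(w : m.-tuple 'I_d) block_moments r w) *
  (CX `^ th * kap `^ (- (nu * th))).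
exists D.
  rewrite mulr_ge0 ?mulr_ge0 ?powR_ge0// sumr_ge0// => w _.
  exact: block_moments_ge0.
case=> // h _; have hD := nD0 h.
have b0 : 0 < 1 + h%:R * Delta by rewrite ltr_wpDr.
have a0 : 0 < CX * (1 + h%:R * Delta) `^ (- nu) by rewrite mulr_gt0// powR_gt0.
apply: le_trans (block_cov_mixing_le m r a0 (H _ hD)) _.
rewrite /D -[leRHS]mulrA; apply: ler_wpM2l.
  by rewrite sumr_ge0// => w _; exact: block_moments_ge0.
rewrite -/th powRM ?powR_ge0 ?(ltW C0)// -mulrA ler_wpM2l ?powR_ge0//.
rewrite -powRrM mulNr; have nth0 : 0 <= nu * th by rewrite mulr_ge0// ltW.
have h2 : 1 <= 1 + h.+1%:R :> R by rewrite lerDl.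
apply: le_trans (powR_le_powRN kap0 (lt_le_trans ltr01 h2) _ nth0) _.
  rewrite (_ : 1 + h.+1%:R = 2 + h%:R); last by rewrite -natr1; ring.
  rewrite mulrDr lerD//.
    by rewrite -ler_pdivlMr// mul1r ge_min lexx.
  by rewrite mulrC ler_wpM2l// ge_min lexx orbT.
by rewrite ler_wpM2l ?powR_ge0// /psi_poly ler_powR// lerN2.
Qed.

(** * Convergence rates *)

Section rates.
Variable (M : nat).
Hypothesis (M1 : (1 <= M)%N).

Lemma VlevelK_le m K (a : nat -> R) D :
  (forall h, (1 <= h)%N -> `|block_cov P Delta SX h m| <= D * a h) ->
  VlevelK P Delta SX m K <= block_cov P Delta SX 0 m +
    2 * (D * \sum_(1 <= h < K) a h).
Proof.
move=> H; rewrite lerD2l ler_pM2l// mulr_sumr.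
by apply: ler_sum_nat => h /andP[h1 _]; exact: H.
Qed.

Lemma VlevelK_ge0 m K : 0 <= VlevelK P Delta SX m K.
Proof. by rewrite addr_ge0 ?block_cov0_ge0// mulr_ge0// sumr_ge0. Qed.

Lemma Vlevel_le m (B : R) :
  (forall K, \sum_(1 <= h < K) `|block_cov P Delta SX h m| <= B) ->
  (Vlevel P Delta SX m <= (block_cov P Delta SX 0 m + 2 * B)%:E)%E.
Proof.
move=> H; rewrite EFinD EFinM leeD2l// lee_wpmul2l//.
exact: nneseries_le_real.
Qed.

Lemma VlevelK_le_Vlevel m K : ((VlevelK P Delta SX m K)%:E <= Vlevel P Delta SX m)%E.
Proof.
rewrite EFinD EFinM leeD2l// lee_wpmul2l// -sumEFin.
by apply: nneseries_lim_ge => h _ _; rewrite lee_fin.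
Qed.

(** The level-1 term decays as [K^-2], faster than needed. *)
Lemma summable_rateP : (forall m, (2 <= m <= M)%N -> (Vlevel P Delta SX m < +oo)%E) ->
  summable_rate P Delta M X SX (twice_variance M).
Proof.
move=> H; have [v1E v10] := V1_fin; set v1 := fine (V1 P X) in v1E v10.
have VE m : (2 <= m < M.+1)%N -> Vlevel P Delta SX m = (fine (Vlevel P Delta SX m))%:E.
  move=> mM; rewrite fineK// ge0_fin_numE ?H//.
  by apply: le_trans (VlevelK_le_Vlevel m 0); rewrite lee_fin VlevelK_ge0.
have VsE : Vsum P Delta M X SX = (2 * v1 + 2 * \sum_(2 <= m < M.+1) fine (Vlevel P Delta SX m))%:E.
  by rewrite /Vsum v1E (eq_big_nat _ _ VE) sumEFin -!EFinM -EFinD.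
split; [by rewrite VsE ltry| |exact: V1_le].
move=> K K1; rewrite VsE -EFinM lee_fin; apply: le_trans (twice_variance_le M1 K1) _.
have K0 : (0 : R) < K%:R by rewrite ltr0n.
have KR1 : (1 : R) <= K%:R by rewrite ler1n.
rewrite [leRHS]mulrDl; apply: lerD.
  rewrite -mulrA ler_pM2l// mulrC ler_wpM2l// lef_pV2 ?posrE ?exprn_gt0//.
  by rewrite expr2 ler_peMl// ltW.
rewrite -mulrA ler_pM2l// mulrC ler_pM2r ?invr_gt0//.
apply: ler_sum_nat => m mM; rewrite -lee_fin -VE//; exact: VlevelK_le_Vlevel.
Qed.

(** The normalizations [a] of interest satisfy [a K <= K], so that the level-1
    term, of order [K ^- 2], is absorbed. *)
Lemma Vsup_rate K0 (a : nat -> R) (B : R) : (1 <= K0)%N ->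
  (forall K, (K0 <= K)%N -> 0 < a K <= K%:R) ->
  (forall K, (K0 <= K)%N ->
     a K * \sum_(2 <= m < M.+1) VlevelK P Delta SX m K <= B) ->
  (Vsup P Delta M X SX K0 a < +oo)%E /\
  forall K, (K0 <= K)%N ->
    ((twice_variance M K)%:E <= Vsup P Delta M X SX K0 a * ((a K * K%:R)^-1)%:E)%E.
Proof.
move=> K01 aK HB; have [v1E v10] := V1_fin; set v1 := fine (V1 P X) in v1E v10.
rewrite /Vsup; set E := [set _ | _ in _].
have EB : (ereal_sup E <= B%:E)%E.
  by apply: ge_ereal_sup => _ [K /= KK0 <-]; rewrite lee_fin; exact: HB.
have Ege K : (K0 <= K)%N ->
    ((a K * \sum_(2 <= m < M.+1) VlevelK P Delta SX m K)%:E <= ereal_sup E)%E.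
  by move=> KK; apply: ereal_sup_ubound; exists K.
have Efin : ereal_sup E = (fine (ereal_sup E))%:E.
  rewrite fineK// fin_numE; apply/andP; split.
    by rewrite -ltNye; apply: lt_le_trans (Ege K0 (leqnn _)); rewrite ltNyr.
  by rewrite -ltey; apply: le_lt_trans EB _; rewrite ltry.
move: (fine _) Efin Ege => s -> Ege {EB}.
rewrite v1E -!EFinM -EFinD; split; first exact: ltry.
move=> K KK; rewrite -EFinM lee_fin.
have K1 : (1 <= K)%N by exact: leq_trans KK.
have KR : (0 : R) < K%:R by rewrite ltr0n.
have /andP[a0 aleK] := aK K KK.
apply: le_trans (twice_variance_le M1 K1) _.
rewrite [leRHS]mulrDl; apply: lerD.
  rewrite -mulrA ler_pM2l// mulrC ler_wpM2l// lef_pV2 ?posrE ?exprn_gt0 ?mulr_gt0//.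
  by rewrite expr2 ler_wpM2r// ltW.
rewrite -mulrA ler_pM2l// invfM mulrA mulrC ler_pM2r ?invr_gt0//.
by rewrite ler_pdivlMr// mulrC -lee_fin Ege.
Qed.

Lemma psi_poly_gt0 nu h : 0 < psi_poly nu h :> R.
Proof. by rewrite powR_gt0// ltr_wpDr. Qed.

Lemma decay_const_ge0 m (psi : nat -> R) D : 0 < psi 1%N ->
  (forall h, (1 <= h)%N -> `|block_cov P Delta SX h m| <= D * psi h) -> 0 <= D.
Proof.
by move=> psi0 /(_ 1%N isT) H; rewrite -(pmulr_lge0 _ psi0); exact: le_trans H.
Qed.

Lemma Vlevel_fin m (psi : nat -> R) B D : (forall h, 0 < psi h) ->
  (forall K, \sum_(1 <= h < K) psi h <= B) ->
  (forall h, (1 <= h)%N -> `|block_cov P Delta SX h m| <= D * psi h) ->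
  (Vlevel P Delta SX m < +oo)%E.
Proof.
move=> psi0 HB H; have Dge0 := decay_const_ge0 (psi0 1%N) H.
apply: (@le_lt_trans _ _ (block_cov P Delta SX 0 m + 2 * (D * B))%:E).
  apply: Vlevel_le => K; apply: (@le_trans _ _ (\sum_(1 <= h < K) D * psi h)).
    by apply: ler_sum_nat => h /andP[h1 _]; exact: H.
  by rewrite -mulr_sumr ler_wpM2l.
by rewrite ltry.
Qed.

Lemma decay_constants (psi : nat -> R) : (forall m, (2 <= m <= M)%N -> exists D,
    forall h, (1 <= h)%N -> `|block_cov P Delta SX h m| <= D * psi h) ->
  exists D : nat -> R, forall m, (2 <= m < M.+1)%N ->
    forall h, (1 <= h)%N -> `|block_cov P Delta SX h m| <= D m * psi h.
Proof.
move=> H; have /choice[D HD] : forall m, exists D, (2 <= m < M.+1)%N ->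
    forall h, (1 <= h)%N -> `|block_cov P Delta SX h m| <= D * psi h.
  move=> m; have [/H[D HD]|] := boolP (2 <= m <= M)%N; first by exists D.
  by move=> _; exists 0.
by exists D.
Qed.

(** The partial sums of the covariances grow as [K^(1 - nu)], which the
    normalization [K^(nu - 1)] compensates. *)
Lemma Vsup_poly nu : 0 < nu < 1 -> (forall m, (2 <= m <= M)%N -> exists D,
    forall h, (1 <= h)%N -> `|block_cov P Delta SX h m| <= D * psi_poly nu h) ->
  (Vpoly P Delta M X SX nu < +oo)%E /\
  forall K, (1 <= K)%N -> ((twice_variance M K)%:E <=
    Vpoly P Delta M X SX nu * (K%:R `^ (- nu))%:E)%E.
Proof.
move=> /andP[nu0 nu1] /decay_constants[D HD].
have n10 : 0 < 1 - nu by rewrite subr_gt0.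
have K1R K : (1 <= K)%N -> (1 : R) <= K%:R by rewrite ler1n.
have a1 K : (1 <= K)%N -> 0 < (K%:R : R) `^ (nu - 1) <= 1.
  move=> /K1R K1; rewrite powR_gt0 ?(lt_le_trans ltr01)//=.
  by rewrite -[leRHS](powRr0 (K%:R)) ler_powR// subr_le0 ltW.
have [||fin H] := @Vsup_rate 1 (fun K => K%:R `^ (nu - 1))
    (\sum_(2 <= m < M.+1) (block_cov P Delta SX 0 m + 2 * (D m * (2 / (1 - nu)))))
    isT.
- by move=> K K1; have /andP[-> /le_trans->//] := a1 K K1; exact: K1R.
- move=> K K1; rewrite mulr_sumr; apply: ler_sum_nat => m mM.
  have Dm0 := decay_const_ge0 (psi_poly_gt0 nu 1) (HD m mM).
  have /andP[a0 aK1] := a1 K K1.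
  apply: (@le_trans _ _ (K%:R `^ (nu - 1) * (block_cov P Delta SX 0 m +
      2 * (D m * (2 / (1 - nu) * K%:R `^ (1 - nu)))))).
    rewrite ler_pM2l//; apply: le_trans (VlevelK_le K (HD m mM)) _.
    rewrite lerD2l ler_pM2l// ler_wpM2l//.
    by apply: sum_powRN_lt1 => //; rewrite nu0.
  rewrite mulrDr; apply: lerD; first by rewrite ler_piMl ?block_cov0_ge0.
  have aa : (K%:R : R) `^ (nu - 1) * K%:R `^ (1 - nu) = 1.
    rewrite -powRD; first by rewrite -opprB addNr powRr0.
    by rewrite pnatr_eq0 -lt0n K1 implybT.
  rewrite (_ : _ * _ = 2 * (D m * (2 / (1 - nu))) *
      (K%:R `^ (nu - 1) * K%:R `^ (1 - nu))); last by ring.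
  by rewrite aa mulr1.
split=> // K K1; have := H K K1.
rewrite (_ : (K%:R `^ (nu - 1) * K%:R)^-1 = K%:R `^ (- nu))//.
rewrite -[X in _ * X]powRr1// -powRD; first by rewrite subrK powRN.
by rewrite pnatr_eq0 -lt0n K1 implybT.
Qed.

(** The harmonic sums grow as [ln K], which the normalization compensates for the
    covariances; for the variance term, [ln K >= 1 / 2] when [K >= 2]. *)
Lemma Vsup_log : (forall m, (2 <= m <= M)%N -> exists D,
    forall h, (1 <= h)%N -> `|block_cov P Delta SX h m| <= D * psi_poly 1 h) ->
  (Vlog P Delta M X SX < +oo)%E /\
  forall K, (2 <= K)%N -> ((twice_variance M K)%:E <=
    Vlog P Delta M X SX * (K%:R^-1 * ln K%:R)%:E)%E.
Proof.
move=> /decay_constants[D HD].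
have lnK K : (2 <= K)%N -> 2^-1 <= ln (K%:R : R).
  move=> K2; have K0 : (0 : R) < K%:R by rewrite ltr0n (leq_trans _ K2).
  apply: le_trans (ln_ge_1subV K0).
  have : K%:R^-1 <= 2^-1 :> R by rewrite lef_pV2 ?posrE// ler_nat.
  by move: (K%:R^-1) => x ?; lra.
have lnK0 K : (2 <= K)%N -> 0 < ln (K%:R : R).
  by move=> /lnK; apply: lt_le_trans; rewrite invr_gt0.
have lnV K : (2 <= K)%N -> (ln (K%:R : R))^-1 <= 2.
  by move=> K2; rewrite -[leRHS]invrK lef_pV2 ?posrE ?invr_gt0 ?lnK0 ?lnK.
have [||fin H] := @Vsup_rate 2 (fun K => (ln K%:R)^-1)
    (\sum_(2 <= m < M.+1) (2 * block_cov P Delta SX 0 m + 2 * D m)) isT.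
- move=> K K2; rewrite invr_gt0 lnK0//=; apply: le_trans (lnV K K2) _.
  by rewrite ler_nat.
- move=> K K2; rewrite mulr_sumr; apply: ler_sum_nat => m mM.
  have Dm0 := decay_const_ge0 (psi_poly_gt0 1 1) (HD m mM).
  apply: (@le_trans _ _ ((ln K%:R)^-1 * (block_cov P Delta SX 0 m +
      2 * (D m * ln K%:R)))).
    rewrite ler_pM2l ?invr_gt0 ?lnK0//; apply: le_trans (VlevelK_le K (HD m mM)) _.
    rewrite lerD2l ler_pM2l// ler_wpM2l//.
    under eq_bigr do rewrite /psi_poly powR_inv1 ?addr_ge0//.
    exact: sum_inv_le_ln (ltnW K2).
  rewrite mulrDr; apply: lerD; first by rewrite ler_wpM2r ?block_cov0_ge0 ?lnV.
  by rewrite mulrCA [D m * _]mulrC mulKf// gt_eqF ?lnK0.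
by split=> // K K2; have := H K K2; rewrite invfM invrK mulrC.
Qed.

End rates.

(** * Envelopes *)

Section envelopes.
Variables (M : nat) (Lambda : R).
Hypotheses (M1 : (1 <= M)%N) (Lambda0 : 0 < Lambda).

Notation env := (@envelope R d Delta p beta Lambda).

Lemma envelopeE m C : env m C = env m 1 * C.
Proof. by rewrite /envelope; ring. Qed.

Lemma envelope1_ge0 m : 0 <= env m 1.
Proof.
rewrite /envelope mulr1; apply: mulr_ge0; last exact: powR_ge0.
by rewrite divr_ge0 ?sqr_ge0 ?exprn_ge0.
Qed.

Lemma envelope1_gt0 m : (0 < d)%N -> 0 < env m 1.
Proof.
move=> d0; rewrite /envelope mulr1; apply: mulr_gt0; last exact: powR_gt0.
have mp : 0 <= m%:R / p by rewrite divr_ge0// (le_trans ler01).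
by rewrite divr_gt0 ?exprn_gt0 ?ltr0n// mulr_gt0// rfact_gt0.
Qed.

Lemma block_cov_dim0 h m : d = 0%N -> (1 <= m)%N -> block_cov P Delta SX h m = 0.
Proof.
move=> d0 m1; rewrite block_covE big1// => w _; exfalso.
by case: m m1 w => // m _ w; have := ltn_ord (thead w); rewrite [X in (_ < X)%N]d0.
Qed.

(** The envelope is linear in its constant with a positive slope, except in
    dimension 0, where there is nothing to dominate. *)
Lemma exists_envelope m c v : (d = 0%N -> v <= 0) ->
  exists C, c <= C /\ v <= env m C.
Proof.
move=> v0; have [d0|d0] := posnP d.
  exists (Num.max c 0); rewrite le_max lexx; split=> //.
  apply: le_trans (v0 d0) _; rewrite envelopeE mulr_ge0 ?envelope1_ge0//.
  by rewrite le_max lexx orbT.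
exists (Num.max c (v / env m 1)); rewrite le_max lexx; split=> //.
rewrite envelopeE mulrC -ler_pdivrMr ?envelope1_gt0//.
by rewrite le_max lexx orbT.
Qed.

Lemma exists_level_envelope m (phi : R) : (1 <= m)%N -> 0 < phi ->
  (Vlevel P Delta SX m < +oo)%E ->
  exists C, 0 < C /\ (Vlevel P Delta SX m <= (env m C * phi)%:E)%E.
Proof.
move=> m1 phi0 V.
have VE : Vlevel P Delta SX m = (fine (Vlevel P Delta SX m))%:E.
  rewrite fineK// ge0_fin_numE//.
  by apply: le_trans (VlevelK_le_Vlevel m 0); rewrite lee_fin VlevelK_ge0.
have [|C [C1 HC]] := @exists_envelope m 1 (fine (Vlevel P Delta SX m) / phi).
  move=> d0; rewrite ler_pdivrMr// mul0r -lee_fin -VE.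
  have := @Vlevel_le m 0; rewrite block_cov_dim0// mulr0 addr0; apply => K.
  by rewrite big1// => h _; rewrite block_cov_dim0// normr0.
exists C; split; first exact: lt_le_trans C1.
by rewrite VE lee_fin -ler_pdivrMr.
Qed.

(** Once the envelope dominates [c_0], it is a common factor of all terms of
    [V_m]. *)
Lemma enlarged_level_boundP (Ct psi : nat -> R) (B : R) :
  (forall h, 0 < psi h) -> (forall K, \sum_(1 <= h < K) psi h <= B) ->
  covariance_decay P Delta p beta Lambda M SX Ct psi ->
  enlarged_level_bound P Delta p beta Lambda M SX Ct (Phi_decay psi).
Proof.
move=> psi0 HB [_ Hdec]; set S := (\sum_(1 <= h <oo) (psi h)%:E)%E.
have Sge K : ((\sum_(1 <= h < K) psi h)%:E <= S)%E.
  by rewrite -sumEFin; apply: nneseries_lim_ge => h _ _; rewrite lee_fin ltW.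
have SE : S = (fine S)%:E.
  rewrite fineK// ge0_fin_numE.
    apply: (@le_lt_trans _ _ B%:E); last exact: ltry.
    by apply: nneseries_le_real => // h; exact: ltW.
  by apply: le_trans (Sge 0); rewrite lee_fin sumr_ge0// => h _; exact: ltW.
have PhiE : Phi_decay psi = (1 + 2 * fine S)%:E.
  by rewrite /Phi_decay -/S SE.
rewrite PhiE; split; first exact: ltry.
move=> m /andP[m2 mM]; have m1 : (1 <= m)%N by exact: ltnW.
split; first by apply: exists_envelope => d0; rewrite block_cov_dim0.
move=> C CC c0; rewrite -EFinM.
apply: (@le_trans _ _ (block_cov P Delta SX 0 m + 2 * (env m C * fine S))%:E).
  apply: Vlevel_le => K; apply: (@le_trans _ _ (\sum_(1 <= h < K) env m C * psi h)).
    apply: ler_sum_nat => h /andP[h1 _]; apply: le_trans (Hdec m h _ h1) _.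
      by rewrite m1.
    by rewrite ler_pM2r// envelopeE [leRHS]envelopeE ler_wpM2l// envelope1_ge0.
  have C0 : 0 <= env m C by exact: le_trans (block_cov0_ge0 m) c0.
  by rewrite -mulr_sumr ler_wpM2l// -lee_fin -SE.
by rewrite lee_fin mulrDr mulr1 mulrCA lerD2r.
Qed.

End envelopes.

(** Geometric sums are bounded through the comparison with [(1 + h)^-2]. *)
Lemma sum_psi_exp_le (lambda : R) K : 0 < lambda ->
  \sum_(1 <= h < K) psi_exp Delta lambda h <=
    (2 + 4 / (lambda * Delta) ^+ 2) * (1 + (2 - 1)^-1).
Proof.
move=> l0; have lD : 0 < lambda * Delta by exact: mulr_gt0.
apply: le_trans (_ : (2 + 4 / (lambda * Delta) ^+ 2) *
    \sum_(1 <= h < K) (1 + h%:R) `^ (- 2) <= _).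
  rewrite mulr_sumr; apply: ler_sum => h _.
  by rewrite /psi_exp -mulrA [h%:R * _]mulrC mulrA expRN_le_powR.
rewrite ler_wpM2l// ?sum_powRN_le ?ltr1n//.
by rewrite addr_ge0// divr_ge0// sqr_ge0.
Qed.

Lemma Phi_mixing_gt0 (lambda : R) m : 0 < lambda ->
  0 < @Phi_mixing R d Delta lambda m.
Proof.
move=> l0; rewrite /Phi_mixing ltr_pwDl// divr_ge0 ?mulr_ge0 ?exprn_ge0//.
by rewrite subr_ge0 -expR0 ler_expR oppr_le0 divr_ge0// mulr_ge0// ltW.
Qed.

(** An exponent strictly between 1 and [nu] is still summable. *)
Lemma Vlevel_fin_mixing CX nu m : mixing_poly P X CX nu -> 1 < nu ->
  (Vlevel P Delta SX m < +oo)%E.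
Proof.
move=> H nu1; have [|D _ HD] := mixing_covariance_decay (nu' := (1 + nu) / 2) m H.
  by apply/andP; split; lra.
apply: (Vlevel_fin (psi_poly_gt0 _) _ HD) => K.
by apply: sum_powRN_le; lra.
Qed.

End blocks.

End random_signatures.

(** * Error of the block-averaging estimator *)

Theorem theorem3p3 (R : realType) (disp : measure_display)
    (Omega : measurableType disp) (P : probability Omega R) (d M : nat)
    (p beta Delta Capprox gamma Lambda : R)
    (X : Omega -> R -> 'rV[R]_d) (XX SX : Omega -> R -> R -> tensor R d)
    (hp : 1 <= p) (hM : (Num.truncn p <= M)%N) (hbeta : beta = 1 / p)
    (hDelta : 0 < Delta)
    (hLambda : lyons_constant p Lambda)
    (hX : continuous_process X)
    (hXX : random_geometric_rough_path p X XX)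
    (hS : forall o, lyons_extension p (XX o) (SX o))
    (hmoment : moment_control P p beta X XX)
    (hstat : stationarity P p X XX)
    (hdisc : discretization_rate P Delta M X SX Capprox gamma)
    (hdep : [\/ exists CX lambdaX, mixing_exp P X CX lambdaX,
                exists CX nu, mixing_poly P X CX nu,
                exists Ct lambda, decay_exp P Delta p beta Lambda M SX Ct lambda |
                exists Ct nu, decay_poly P Delta p beta Lambda M SX Ct nu]) :
  (exists VK : nat -> R,
    [/\ (forall K, (1 <= K)%N ->
           (2%:E * variance_term P Delta M SX K <= (VK K)%:E)%E) /\
        (forall K n, (1 <= K)%N -> (2 <= n)%N ->
           (mse P Delta M X SX K n <=
              (2 * Capprox * Delta `^ gamma / (n.-1)%:R `^ gamma + VK K)%:E)%E),
        [/\ forall CX lambdaX, mixing_exp P X CX lambdaX ->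
              summable_rate P Delta M X SX VK /\
              exists Ct : nat -> R, forall m, (2 <= m <= M)%N ->
                0 < Ct m /\
                (Vlevel P Delta SX m <=
                   (@envelope R d Delta p beta Lambda m (Ct m) *
                      @Phi_mixing R d Delta lambdaX m)%:E)%E,
            forall Ct lambda, decay_exp P Delta p beta Lambda M SX Ct lambda ->
              summable_rate P Delta M X SX VK /\
              enlarged_level_bound P Delta p beta Lambda M SX Ct
                (Phi_decay (psi_exp Delta lambda)),
            forall CX nu, mixing_poly P X CX nu -> 1 < nu ->
              summable_rate P Delta M X SX VK /\
              exists Ct Phi : nat -> R, forall m, (2 <= m <= M)%N ->
                [/\ 0 < Ct m, 0 < Phi m &
                (Vlevel P Delta SX m <=
                   (@envelope R d Delta p beta Lambda m (Ct m) * Phi m)%:E)%E] &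
            forall Ct nu, decay_poly P Delta p beta Lambda M SX Ct nu -> 1 < nu ->
              summable_rate P Delta M X SX VK /\
              enlarged_level_bound P Delta p beta Lambda M SX Ct
                (Phi_decay (psi_poly nu))],
        forall CX nu, mixing_poly P X CX nu -> nu <= 1 ->
          forall eps, 0 < eps < nu ->
            (Veps P Delta M X SX nu eps < +oo)%E /\
            forall K, (1 <= K)%N ->
              ((VK K)%:E <=
                 Veps P Delta M X SX nu eps * (K%:R `^ (- nu + eps))%:E)%E &
        forall Ct nu, decay_poly P Delta p beta Lambda M SX Ct nu ->
          (nu < 1 ->
             (Vpoly P Delta M X SX nu < +oo)%E /\
             forall K, (1 <= K)%N ->
               ((VK K)%:E <=
                  Vpoly P Delta M X SX nu * (K%:R `^ (- nu))%:E)%E) /\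
          (nu = 1 ->
             (Vlog P Delta M X SX < +oo)%E /\
             forall K, (2 <= K)%N ->
               ((VK K)%:E <=
                  Vlog P Delta M X SX * (K%:R^-1 * ln K%:R)%:E)%E)]) /\
  (exists C : R, forall K, (1 <= K)%N ->
     (level1_variance P Delta SX K <= (C * K%:R ^- 2)%:E)%E).
Proof.
have M1 : (1 <= M)%N by apply: leq_trans hM; rewrite truncn_gt0.
have [Lambda0 _] := hLambda.
have psiE0 l h : 0 < psi_exp Delta l h by exact: expR_gt0.
have rateP := summable_rateP hp hX hXX hS hmoment hstat hDelta M1.
split; last first.
  exists (fine (V1 P X)) => K K1.
  rewrite (level1_varianceE hp hX hXX hS hmoment hDelta) lee_fin mulrC.
  exact: (level_variance1_le hp hX hXX hS hmoment hstat hDelta).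
(* Twice the variance term itself serves as [V_K]. *)
exists (twice_variance P SX Delta M); split.
- split=> [K _|K n K1 n2]; first exact: (variance_term_le hp hX hXX hS hmoment hDelta).
  exact: (mse_le hp hX hXX hS hmoment hstat hDelta).
- split.
  + move=> CX l H; have HP := mixing_exp_poly H.
    have V m : (Vlevel P Delta SX m < +oo)%E.
      by apply: (Vlevel_fin_mixing hp hX hXX hS hmoment hstat hDelta m HP); rewrite ltr1n.
    split; first exact: rateP.
    have [_ l0 _] := H.
    have /choice[Ct HCt] : forall m, exists C, (2 <= m <= M)%N -> 0 < C /\
        (Vlevel P Delta SX m <= (@envelope R d Delta p beta Lambda m C *
           @Phi_mixing R d Delta l m)%:E)%E.
      move=> m; have [m0|m1] := posnP m; first by exists 0; rewrite m0.
      have phi0 := @Phi_mixing_gt0 R d Delta hDelta l m l0.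
      have [C HC] := exists_level_envelope hp hX hXX hS hmoment hDelta
        Lambda0 m1 phi0 (V m).
      by exists C.
    by exists Ct.
  + move=> Ct l [l0 H]; have sumP K := sum_psi_exp_le hDelta K l0.
    split; last exact: (enlarged_level_boundP hp hX hXX hS hmoment hDelta Lambda0 (psiE0 l) sumP H).
    apply: rateP => m /andP[m2 mM]; have [_ Hm] := H.
    by apply: (Vlevel_fin (psiE0 l) sumP) => h; apply: Hm; rewrite ltnW.
  + move=> CX nu H nu1; have V m := Vlevel_fin_mixing hp hX hXX hS hmoment hstat hDelta m H nu1.
    split; first exact: rateP.
    have /choice[Ct HCt] : forall m, exists C, (2 <= m <= M)%N -> 0 < C /\
        (Vlevel P Delta SX m <= (@envelope R d Delta p beta Lambda m C * 1)%:E)%E.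
      move=> m; have [m0|m1] := posnP m; first by exists 0; rewrite m0.
      have [C HC] := exists_level_envelope hp hX hXX hS hmoment hDelta
        Lambda0 m1 ltr01 (V m).
      by exists C.
    by exists Ct, (fun=> 1) => m mM; have [C0 HV] := HCt m mM; split.
  + move=> Ct nu [_ H] nu1; have sumP K := sum_powRN_le K nu1.
    have psi0 := @psi_poly_gt0 R nu.
    split; last exact: (enlarged_level_boundP hp hX hXX hS hmoment hDelta Lambda0 psi0 sumP H).
    apply: rateP => m /andP[m2 mM]; have [_ Hm] := H.
    by apply: (Vlevel_fin psi0 sumP) => h; apply: Hm; rewrite ltnW.
- move=> CX nu H nu1 eps /andP[eps0 epsnu].
  (* Covariance decay of order [nu - eps], which is below 1. *)
  have -> : Veps P Delta M X SX nu eps = Vpoly P Delta M X SX (nu - eps).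
    by congr (Vsup _ _ _ _ _ _ _); apply/funext => K; congr (_ `^ _); ring.
  have -> : - nu + eps = - (nu - eps) by ring.
  apply: (Vsup_poly hp hX hXX hS hmoment hstat hDelta M1).
    by apply/andP; split; lra.
  move=> m _; have [|D _ HD] := @mixing_covariance_decay R disp Omega P d p beta X XX SX
    hp hX hXX hS hmoment hstat Delta hDelta CX nu (nu - eps) m H.
    by apply/andP; split; lra.
  by exists D.
- move=> Ct nu [nu0 [_ H]].
  have HD m : (2 <= m <= M)%N -> exists D, forall h, (1 <= h)%N ->
      `|block_cov P Delta SX h m| <= D * psi_poly nu h.
    move=> /andP[m2 mM]; exists (@envelope R d Delta p beta Lambda m (Ct m)) => h.
    by apply: H; rewrite ltnW.
  split=> [nu1|nuE]; last first.
    by rewrite nuE in HD; exact: (Vsup_log hp hX hXX hS hmoment hstat hDelta M1 HD).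
  apply: (Vsup_poly hp hX hXX hS hmoment hstat hDelta M1 _ HD).
  by rewrite nu0.
Qed.
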